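(* Let $0<q<1$ and $I_0=\mathbb{Z}$, and define on $I_0\times I_0\times I_0$ the function $$P^0_{q^2}(p,v,w)=(-q)^{p-w}q^{(p-w)(v-w)}\frac{1}{(q^2;q^2)_\infty}\Psi(0;q^{2v-2w+2}\mid q^2,q^{2p-2w+2}).$$ Then for $r,s,t\in\mathbb{Z}$ and $p\in I_0$, the vectors $$\xi^0_{r,s,p,t}=\sum_{v,w\in I_0,\ v-w=t}P^0_{q^2}(p,v,w)\,e_v\otimes e_{r+p-w}\otimes e_w\otimes e_{s-p+v}$$ form an orthonormal basis of $\mathscr{H}_0\otimes\mathscr{H}_0=(l^2(I_0)\otimes l^2(\mathbb{Z}))\otimes(l^2(I_0)\otimes l^2(\mathbb{Z}))$. Moreover, denoting by $W_0$ the unitary $$W_0:\mathscr{H}_0\otimes\mathscr{H}_0\to l^2(\mathbb{Z})\otimes l^2(\mathbb{Z})\otimes\mathscr{H}_0:\ \xi^0_{r,s,p,t}\mapsto e_r\otimes e_s\otimes e_p\otimes e_t,$$ one has $$W_0^*(1\otimes x)W_0=\Delta_0(x)\qquad\text{for all }x\in\mathscr{L}^\infty(\widetilde E_q(2))=B(l^2(I_0))\bar\otimes\mathscr{L}(\mathbb{Z}).$$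
   Context: $(a;q)_n=\prod_{k=0}^{n-1}(1-q^ka)$ for $n\in\mathbb{N}\cup\{\infty\}$, and $\Psi(a;b\mid q,z)=\sum_{n=0}^\infty\frac{(a;q)_n(bq^n;q)_\infty}{(q;q)_n}(-1)^nq^{\frac12n(n-1)}z^n$. The $e_i$ denote standard basis vectors. $\mathscr{L}(\mathbb{Z})\subseteq B(l^2(\mathbb{Z}))$ is the von Neumann algebra generated by the forward bilateral shift $S$, and $\mathscr{H}_0=l^2(I_0)\otimes l^2(\mathbb{Z})$. The von Neumann bialgebra $(\mathscr{L}^\infty(\widetilde E_q(2)),\Delta_0)$: on $\mathscr{H}_0$ consider the unitary $a_0=S^*\otimes1$, i.e. $a_0(e_n\otimes e_k)=e_{n-1}\otimes e_k$, and the unbounded normal operator $b_0$ having the linear span of the vectors $e_n\otimes e_k$ as a core, with $b_0(e_n\otimes e_k)=q^n\,e_n\otimes e_{k+1}$. Then $\mathscr{L}^\infty(\widetilde E_q(2))=B(l^2(I_0))\bar\otimes\mathscr{L}(\mathbb{Z})$, and $\Delta_0:\mathscr{L}^\infty(\widetilde E_q(2))\to\mathscr{L}^\infty(\widetilde E_q(2))\bar\otimes\mathscr{L}^\infty(\widetilde E_q(2))$ is the unique unital normal $^*$-homomorphism which (extended to affiliated operators) satisfies $\Delta_0(a_0)=a_0\otimes a_0$ and $\Delta_0(b_0)=b_0\otimes a_0\dot+a_0^*\otimes b_0$, where $\dot+$ denotes the closure of the sum of two unbounded operators. *)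

(* Defs.v *)
From HB Require Import structures.
From mathcomp Require Import all_boot all_order all_algebra finmap.
From mathcomp Require Import complex.
From mathcomp Require Import all_classical all_reals all_analysis.
From mathcomp Require Import ring.

Set Implicit Arguments.
Unset Strict Implicit.
Unset Printing Implicit Defensive.

Import Order.TTheory GRing.Theory Num.Theory.
Import numFieldNormedType.Exports.

Local Open Scope classical_set_scope.
Local Open Scope ring_scope.
Local Open Scope complex_scope.

(* The usual topology and norm of the complex numbers. *)
HB.instance Definition _ (R : realType) := NormedModule.copy R[i] R[i]^o.

Section SquareSummable.
Variables (R : realType) (I : choiceType).
Implicit Types (f g : I -> R[i]) (A : {fset I}) (M : R).

Definition sqnorm f : \bar R :=
  \esum_(i in [set: I]) (Normc.normc (f i) ^+ 2)%:E.

Definition square_summable : {pred (I -> R[i])} :=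
  [pred f | (sqnorm f < +oo)%E].

Lemma sqnorm_leP f M :
  (sqnorm f <= M%:E)%E <->
  (forall A, \sum_(i <- enum_fset A) Normc.normc (f i) ^+ 2 <= M).
Proof.
split=> [fM A|fM].
  rewrite -lee_fin (le_trans _ fM)// -sumEFin; apply: ereal_sup_ubound.
  exists [set` A]; first by split=> //; exact: finite_fset.
  by rewrite fsbig_finite//= ?set_fsetK//; exact: finite_fset.
apply: ge_ereal_sup => _ [X [finX _] <-].
by rewrite fsbig_finite//= sumEFin lee_fin.
Qed.

Lemma sqnorm_ge0 f : (0 <= sqnorm f)%E.
Proof. by apply: esum_ge0 => i _; rewrite lee_fin sqr_ge0. Qed.

Lemma square_summableP f :
  (f \in square_summable) <-> (exists M, (sqnorm f <= M%:E)%E).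
Proof.
split=> [|[M fM]]; last by rewrite inE (le_lt_trans fM)// ltry.
rewrite inE => foo; exists (fine (sqnorm f)).
by rewrite fineK// ge0_fin_numE// sqnorm_ge0.
Qed.

Lemma normcD_sqr_le (a b : R) (x y : R[i]) : 0 < a -> 0 < b ->
  Normc.normc (x + y) ^+ 2 <=
  (1 + b / a) * Normc.normc x ^+ 2 + (1 + a / b) * Normc.normc y ^+ 2.
Proof.
move=> a0 b0; have n0 (z : R[i]) : 0 <= Normc.normc z by case: z => *; exact: sqrtr_ge0.
have := le_normcD x y; move: (n0 x) (n0 y) (n0 (x + y)).
set u := Normc.normc x; set v := Normc.normc y; move=> u0 v0 w0 uv.
apply: (@le_trans _ _ ((u + v) ^+ 2)); first by rewrite lerXn2r// nnegrE addr_ge0.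
rewrite -subr_ge0.
have -> : (1 + b / a) * u ^+ 2 + (1 + a / b) * v ^+ 2 - (u + v) ^+ 2 =
          (b * u - a * v) ^+ 2 / (a * b).
  by field; rewrite !gt_eqF.
by rewrite divr_ge0 ?sqr_ge0// mulr_ge0// ltW.
Qed.

Lemma sqnormD_le (a b : R) f g M N : 0 < a -> 0 < b ->
  (sqnorm f <= M%:E)%E -> (sqnorm g <= N%:E)%E ->
  (sqnorm (f + g)%R
    <= ((1 + b / a) * M + (1 + a / b) * N)%R%:E)%E.
Proof.
move=> a0 b0 /sqnorm_leP fM /sqnorm_leP gN; apply/sqnorm_leP => A.
apply: le_trans (lerD (ler_wpM2l _ (fM A)) (ler_wpM2l _ (gN A))).
- rewrite !mulr_sumr -big_split/=; apply: ler_sum => i _.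
  exact: normcD_sqr_le.
- by rewrite addr_ge0// divr_ge0// ltW.
- by rewrite addr_ge0// divr_ge0// ltW.
Qed.

Lemma sqnormZ_le (c : R[i]) f M : (sqnorm f <= M%:E)%E ->
  (sqnorm (c *: f)%R <= (Normc.normc c ^+ 2 * M)%R%:E)%E.
Proof.
move=> /sqnorm_leP fM; apply/sqnorm_leP => A.
apply: le_trans (ler_wpM2l _ (fM A)); last exact: sqr_ge0.
rewrite mulr_sumr; apply: ler_sum => i _.
by rewrite -exprMn -Normc.normcM.
Qed.

Lemma square_summable_submod : submod_closed square_summable.
Proof.
split.
  apply/square_summableP; exists 0; apply/sqnorm_leP => A.
  by rewrite big1// => i _; rewrite Normc.normc0 expr0n.
move=> c f g /square_summableP[M fM] /square_summableP[N gN].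
apply/square_summableP; eexists; apply: (@sqnormD_le 1 1) => //.
  exact: sqnormZ_le fM.
exact: gN.
Qed.

HB.instance Definition _ := GRing.isSubmodClosed.Build R[i] (I -> R[i])
  square_summable square_summable_submod.

End SquareSummable.


Section l2.
Variables (R : realType) (I : choiceType).

Record l2 := L2 { l2fun :> I -> R[i]; _ : l2fun \in @square_summable R I }.
HB.instance Definition _ := [isSub for l2fun].
HB.instance Definition _ := [Choice of l2 by <:].
HB.instance Definition _ := [SubChoice_isSubLmodule of l2 by <:].

Definition l2norm (f : l2) : R := Num.sqrt (fine (sqnorm f)).

Lemma l2norm_ge0 f : 0 <= l2norm f.
Proof. exact: sqrtr_ge0. Qed.

Lemma sqnormE (f : l2) : sqnorm f = (l2norm f ^+ 2)%:E.
Proof.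
rewrite /l2norm sqr_sqrtr ?fine_ge0 ?sqnorm_ge0// fineK//.
by rewrite ge0_fin_numE ?sqnorm_ge0//; have := valP f; rewrite inE.
Qed.

Lemma l2norm_le (f : l2) M : 0 <= M -> (sqnorm f <= (M ^+ 2)%:E)%E -> l2norm f <= M.
Proof.
by move=> M0; rewrite sqnormE lee_fin ler_pXn2r// nnegrE l2norm_ge0.
Qed.

Lemma l2norm0_eq0 f : l2norm f = 0 -> f = 0.
Proof.
move=> f0; apply/val_inj/funext => i /=; apply: Normc.eq0_normc.
have /sqnorm_leP/(_ [fset i]%fset) : (sqnorm f <= 0%:E)%E.
  by rewrite sqnormE f0 expr0n.
rewrite big_seq_fset1 => h; apply/eqP; rewrite -sqrf_eq0 eq_le h/=.
exact: sqr_ge0.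
Qed.

Lemma ler_l2normD f g : l2norm (f + g) <= l2norm f + l2norm g.
Proof.
have [f0|] := leP (l2norm f) 0.
  have -> : f = 0 by apply/l2norm0_eq0/eqP; rewrite eq_le f0 l2norm_ge0.
  by rewrite add0r lerDr l2norm_ge0.
have [g0|] := leP (l2norm g) 0.
  have -> : g = 0 by apply/l2norm0_eq0/eqP; rewrite eq_le g0 l2norm_ge0.
  by rewrite addr0 lerDl l2norm_ge0.
move=> g0 f0; apply: l2norm_le; first by rewrite addr_ge0// ltW.
have fE : (sqnorm f <= (l2norm f ^+ 2)%:E)%E by rewrite sqnormE.
have gE : (sqnorm g <= (l2norm g ^+ 2)%:E)%E by rewrite sqnormE.
apply: le_trans (sqnormD_le f0 g0 fE gE) _.
by rewrite lee_fin le_eqVlt; apply/orP; left; apply/eqP; field; rewrite !gt_eqF.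
Qed.

Lemma l2normZ_le (c : R[i]) f : l2norm (c *: f) <= Normc.normc c * l2norm f.
Proof.
have c0 : 0 <= Normc.normc c by case: c => *; exact: sqrtr_ge0.
apply: l2norm_le; first by rewrite mulr_ge0 ?l2norm_ge0.
by rewrite exprMn; apply: sqnormZ_le; rewrite sqnormE.
Qed.

Lemma l2normZ (c : R[i]) f : l2norm (c *: f) = Normc.normc c * l2norm f.
Proof.
apply/eqP; rewrite eq_le l2normZ_le/=.
have [->|c0] := eqVneq c 0; first by rewrite Normc.normc0 mul0r l2norm_ge0.
have n0 : 0 < Normc.normc c.
  rewrite lt_def; apply/andP; split.
    by apply: contra c0 => /eqP /Normc.eq0_normc ->.
  by case: (c) => *; exact: sqrtr_ge0.
rewrite mulrC -ler_pdivlMr// mulrC -Normc.normcV.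
by have := l2normZ_le c^-1 (c *: f); rewrite scalerA mulVf// scale1r.
Qed.

Let normC (f : l2) : R[i] := (l2norm f)%:C.

Let ler_normCD f g : normC (f + g) <= normC f + normC g.
Proof. by rewrite -rmorphD lecR ler_l2normD. Qed.

Let normCZ (c : R[i]) f : normC (c *: f) = `|c| * normC f.
Proof. by rewrite /normC l2normZ rmorphM. Qed.

Let normC0_eq0 f : normC f = 0 -> f = 0.
Proof. by move=> /(congr1 (@complex.Re R))/= /l2norm0_eq0. Qed.

HB.instance Definition _ :=
  Lmodule_isNormed.Build R[i] l2 ler_normCD normCZ normC0_eq0.

End l2.

Section basis_and_tensor.
Variables (R : realType).

Lemma ket_subproof (I : choiceType) (i : I) :
  (fun j => (j == i)%:R) \in @square_summable R I.
Proof.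
apply/square_summableP; exists 1; apply/sqnorm_leP => A.
have [iA|iA] := boolP (i \in A).
  rewrite (big_fsetD1 i)//= eqxx Normc.normc1 expr1n big_seq big1 ?addr0// => j.
  by rewrite !inE => /andP[/negPf-> _]; rewrite Normc.normc0 expr0n.
rewrite big_seq big1 ?ler01// => j jA.
suff /negPf-> : j != i by rewrite Normc.normc0 expr0n.
by apply: contra iA => /eqP <-.
Qed.

Definition ket (I : choiceType) (i : I) : l2 R I := L2 (ket_subproof i).

Lemma esumZ_le (I : choiceType) (u : I -> R) (c M : R) : 0 <= c ->
  (forall A : {fset I}, \sum_(i <- enum_fset A) u i <= M) ->
  (\esum_(i in [set: I]) (c * u i)%:E <= (c * M)%:E)%E.
Proof.
move=> c0 uM; apply: ge_ereal_sup => _ [X [finX _] <-].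
by rewrite fsbig_finite//= sumEFin lee_fin -mulr_sumr ler_wpM2l.
Qed.

Lemma tensor_subproof (I J : choiceType) (f : l2 R I) (g : l2 R J) :
  (fun p : I * J => f p.1 * g p.2) \in @square_summable R (I * J)%type.
Proof.
have /square_summableP[M /sqnorm_leP fM] := valP f.
have /square_summableP[N /sqnorm_leP gN] := valP g.
have N0 : 0 <= N by have := gN fset0; rewrite big_seq_fset0.
apply/square_summableP; exists (N * M); rewrite /sqnorm.
have -> : [set: I * J] = [set: I] `*`` (fun=> [set: J]).
  by apply/seteqP; split.
rewrite -(@esum_esum R I J _ _
  (fun i j => (Normc.normc (f i * g j) ^+ 2)%:E)); last first.
  by move=> *; rewrite lee_fin sqr_ge0.
apply: le_trans (esumZ_le N0 fM); apply: le_esum => i _.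
rewrite [N * _]mulrC; under eq_esum do rewrite Normc.normcM exprMn.
by apply: esumZ_le; rewrite ?sqr_ge0.
Qed.

Definition tensor (I J : choiceType) (f : l2 R I) (g : l2 R J) :
  l2 R (I * J)%type := L2 (tensor_subproof f g).

Lemma shift_subproof (f : l2 R int) :
  (fun n => f (n - 1)) \in @square_summable R int.
Proof.
have := valP f; rewrite !inE; congr (_ < _)%E.
apply: (@reindex_esum _ _ _ _ _ (fun n : int => n - 1)).
split=> // [n m _ _ /addIr//|n _]; by exists (n + 1) => //; rewrite addrK.
Qed.

Definition shift (f : l2 R int) : l2 R int := L2 (shift_subproof f).

End basis_and_tensor.


Arguments ket {R I} i.
Arguments shift {R} f.

(* l^2(I) (x) l^2(J) is identified with l^2(I * J), so that
   e_i (x) e_j = e_(i, j). *)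
Notation "f \ox g" := (tensor f g) (at level 40, left associativity)
  : ring_scope.

(* Sum over D of a family of vectors: the limit, in norm, of the net of its
   finite partial sums. *)
Definition unordered_sum (K : numFieldType) (V : normedModType K)
    (T : choiceType) (D : set T) (f : T -> V) : V :=
  lim (\sum_(i <- enum_fset A | i \in D) f i @[A -->
    filter_from setT (fun A : {fset T} => [set B | (A `<=` B)%fset])]).

Section operators.
Variable R : realType.
Implicit Types I J : choiceType.

Definition inner I (f g : l2 R I) : R[i] :=
  unordered_sum [set: I] (fun i => f i * (g i)^*%C : R[i]).

Definition span (V : lmodType R[i]) (A : set V) : set V :=
  [set v | exists (n : nat) (c : 'I_n -> R[i]) (a : 'I_n -> V),
     (forall i, A (a i)) /\ v = \sum_(i < n) c i *: a i].

Definition orthonormal_basis (T : eqType) I (F : T -> l2 R I) : Prop :=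
  (forall s t, inner (F s) (F t) = (s == t)%:R) /\
  closure (span (range F)) = setT.

Definition bounded_op I J : set (l2 R I -> l2 R J) :=
  [set x | linear x /\ exists c : R[i], forall f, `|x f| <= c * `|f|].

Definition unitary I J (w : l2 R I -> l2 R J) : Prop :=
  [/\ linear w, forall f g, inner (w f) (w g) = inner f g
    & forall h, exists f, w f = h].

(* adjoint and optensor: the operator determined by the stated property, which
   exists for bounded arguments; xget gives the zero operator otherwise. *)
Definition adjoint I J (x : l2 R I -> l2 R J) : l2 R J -> l2 R I :=
  xget (fun=> 0) [set y | forall f g, inner (x f) g = inner f (y g)].

Definition optensor I I' J J' (x : l2 R I -> l2 R I') (y : l2 R J -> l2 R J') :
    l2 R (I * J)%type -> l2 R (I' * J')%type :=
  xget (fun=> 0) [set z | bounded_op z /\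
                          forall f g, z (f \ox g) = x f \ox y g].

Definition commutant I (A : set (l2 R I -> l2 R I)) : set (l2 R I -> l2 R I) :=
  [set x | bounded_op x /\ forall y, A y -> x \o y = y \o x].

Definition vN_generated I (A : set (l2 R I -> l2 R I)) :
    set (l2 R I -> l2 R I) :=
  commutant (commutant (A `|` @adjoint I I @` A)).

Definition vN_tensor I J (M : set (l2 R I -> l2 R I))
    (N : set (l2 R J -> l2 R J)) :
    set (l2 R (I * J)%type -> l2 R (I * J)%type) :=
  vN_generated [set z | exists x y, [/\ M x, N y & z = optensor x y]].

(* The ultraweakly (sigma-weakly) continuous functionals on B(l^2(I)):
   x |-> \sum_n <x xi_n, eta_n>, with \sum_n |xi_n|^2, \sum_n |eta_n|^2
   finite. *)
Definition ultraweak_functional I (phi : (l2 R I -> l2 R I) -> R[i]) : Prop :=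
  exists xi eta : nat -> l2 R I,
    [/\ cvgn (series (fun n => `|xi n| ^+ 2)),
        cvgn (series (fun n => `|eta n| ^+ 2))
      & forall x, phi x = limn (series (fun n => inner (x (xi n)) (eta n)))].

Definition ultraweak_cvg I (F : set_system (l2 R I -> l2 R I))
    (x : l2 R I -> l2 R I) : Prop :=
  forall phi, ultraweak_functional phi -> phi y @[y --> F] --> phi x.

Record unital_normal_star_hom I J (M : set (l2 R I -> l2 R I))
    (N : set (l2 R J -> l2 R J))
    (D : (l2 R I -> l2 R I) -> (l2 R J -> l2 R J)) : Prop := {
  hom_maps : forall x, M x -> N (D x);
  hom_unital : D idfun = idfun;
  hom_linear : forall (c : R[i]) x y, M x -> M y ->
    D (c *: x + y) = c *: D x + D y;
  hom_mul : forall x y, M x -> M y -> D (x \o y) = D x \o D y;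
  hom_star : forall x, M x -> D (adjoint x) = adjoint (D x);
  (* continuity on M for the ultraweak topologies, in terms of filters on M *)
  hom_normal : forall (F : set_system (l2 R I -> l2 R I)) x,
    ProperFilter F -> F M -> M x ->
    ultraweak_cvg F x -> ultraweak_cvg (D y @[y --> F]) (D x)
}.

(* Unbounded operators from l^2(I) to l^2(J) are represented by their graphs,
   sets of pairs in l^2(I) * l^2(J); closures are taken in this product. *)
Definition graph I J (x : l2 R I -> l2 R J) : set (l2 R I * l2 R J) :=
  [set p | p.2 = x p.1].

Definition graph_tensor I I' J J' (T : set (l2 R I * l2 R I'))
    (U : set (l2 R J * l2 R J')) :
    set (l2 R (I * J)%type * l2 R (I' * J')%type) :=
  closure (span [set p | exists t u,
    [/\ T t, U u & p = (t.1 \ox u.1, t.2 \ox u.2)]]).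

Definition graph_closed_sum I J (T U : set (l2 R I * l2 R J)) :
    set (l2 R I * l2 R J) :=
  closure [set p | exists g h, [/\ T (p.1, g), U (p.1, h) & p.2 = g + h]].

(* The extension of a normal homomorphism D on M to a closed operator T
   affiliated with M (Woronowicz): D(T) is the closed operator such that
   D(T) D(x) = D(T x) for all x in M with T x in M, the vectors D(x) f, for
   such x and arbitrary f, spanning a core. *)
Definition affiliated_ext I J (M : set (l2 R I -> l2 R I))
    (D : (l2 R I -> l2 R I) -> (l2 R J -> l2 R J)) (T : set (l2 R I * l2 R I)) :
    set (l2 R J * l2 R J) :=
  closure (span [set p | exists x y f,
    [/\ M x, M y, forall g, T (x g, y g) & p = (D x f, D y f)]]).

End operators.

Section quantum_E2.
Variable R : realType.
Implicit Types q : R.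

Definition L_Z : set (l2 R int -> l2 R int) := vN_generated [set shift].

Definition Linfty_E2 :
    set (l2 R (int * int)%type -> l2 R (int * int)%type) :=
  vN_tensor (@bounded_op R int int) L_Z.

Definition a0 : l2 R (int * int)%type -> l2 R (int * int)%type :=
  optensor (adjoint shift) idfun.

Definition b0 q : set (l2 R (int * int)%type * l2 R (int * int)%type) :=
  closure (span [set p | exists n k : int,
    p = (ket n \ox ket k, (q ^ n)%:C *: (ket n \ox ket (k + 1)))]).

Record is_Delta0 q (D : (l2 R (int * int)%type -> l2 R (int * int)%type) ->
    (l2 R ((int * int) * (int * int))%type ->
     l2 R ((int * int) * (int * int))%type)) : Prop := {
  Delta0_hom :
    unital_normal_star_hom Linfty_E2 (vN_tensor Linfty_E2 Linfty_E2) D;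
  Delta0_a0 : D a0 = optensor a0 a0;
  Delta0_b0 : affiliated_ext Linfty_E2 D (b0 q) =
    graph_closed_sum (graph_tensor (b0 q) (graph a0))
                     (graph_tensor (graph (adjoint a0)) (b0 q))
}.

Definition qpoch (a q : R) (n : nat) : R := \prod_(k < n) (1 - q ^+ k * a).

Definition qpoch_oo (a q : R) : R := limn (qpoch a q).

Definition Psi (a b q z : R) : R :=
  limn (series (fun n : nat =>
    qpoch a q n * qpoch_oo (b * q ^+ n) q / qpoch q q n
    * (-1) ^+ n * q ^+ (n * n.-1)./2 * z ^+ n)).

(* P^0_{q^2}, in terms of q *)
Definition P0 q (p v w : int) : R :=
  (- q) ^ (p - w) * q ^ ((p - w) * (v - w)) * (qpoch_oo (q ^+ 2) (q ^+ 2))^-1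
  * Psi 0 (q ^ (2 * v - 2 * w + 2)) (q ^+ 2) (q ^ (2 * p - 2 * w + 2)).

Definition xi0 q (r s p t : int) : l2 R ((int * int) * (int * int))%type :=
  unordered_sum [set vw : int * int | vw.1 - vw.2 = t] (fun vw =>
    let: (v, w) := vw in (P0 q p v w)%:C *:
      ((ket v \ox ket (r + p - w)) \ox (ket w \ox ket (s - p + v)))).

End quantum_E2.

(* Main.v *)
(** The orthogonality of the vectors xi0 is that of the q-Hankel transform.  On
    the block v - w = t the matrix P^0 is Toeplitz, and its symbol is
    (-q^(1+t)/z;q^2)_oo / (-q^(1+t)z;q^2)_oo for t >= 0 (a shift of the one for
    -t when t < 0), which has modulus one on the unit circle; in terms of
    coefficients, orthogonality is two applications of Fubini.

    Let pi(x) = W0 Delta0(x) W0^*.  The contiguity relation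
    q^t c^(t+1)_(n+1) + c^(t+1)_n = q^n c^t_n of the matrix entries shows that
    W0 carries the closed sum Delta0(b0) into the operator e_(r,s,p,t) |->
    q^p e_(r,s,p,t+1).  With E_n = e_nn (x) 1 and u = 1 (x) S, this gives
    q^n pi(E_n) e_(r,s,p,t+1) = q^p pi(u) pi(E_n) e_(r,s,p,t); as pi(u) is
    isometric, |pi(E_n) e_(r,s,p,t)| is geometric in t with ratio q^(p-n), and
    being bounded on Z it vanishes unless p = n.  Normality (sum_n E_n = 1) then
    forces pi(E_n) = 1 (x) E_n, hence pi(u) = 1 (x) u; and pi(a0) = 1 (x) a0 is
    a direct computation.  For general x, the corner E_n x E_m has Laurent
    entries, and its Fejer means are polynomials in a0, u, E_m, bounded by the
    norm of x; normality gives pi(E_n x E_m) = 1 (x) E_n x E_m, hence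
    pi(x) = 1 (x) x entrywise. *)
From HB Require Import structures.
From mathcomp Require Import all_boot all_order all_algebra finmap complex.
From mathcomp Require Import all_classical all_reals all_analysis.
From mathcomp Require Import ring lra zify.
Require Import Defs.

Set Implicit Arguments.
Unset Strict Implicit.
Unset Printing Implicit Defensive.

Import Order.TTheory GRing.Theory Num.Theory.
Import numFieldNormedType.Exports.

Local Open Scope classical_set_scope.
Local Open Scope ring_scope.
Local Open Scope complex_scope.

(** * Unordered sums *)

(** Normality is used only along sequences, and a sequence that is bounded in norm converges
    ultraweakly as soon as its matrix entries converge. Every approximation must therefore be
    bounded: Fejer means replace Fourier truncations, whose norms may grow with the degree, and they
    are taken on corners, where only the second index has to be averaged. The extension of [Delta0]
    to [b0] is given by closures of spans and is never determined as an operator: a linear relation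
    between the two components of a pair, tested against fixed vectors, survives spans and closures,
    so it is enough to check it before closing. Completeness of the [xi0] needs no density argument,
    since [xi0_mx] has orthonormal columns as well as rows. Its entries become convolutions only
    after order and argument of the q-Bessel function are exchanged, a symmetry read off from a
    double series. Finally, [adjoint] and [optensor] are choices with default zero; where existence
    is not at hand, the default case is treated separately. *)

Definition fin_net (T : choiceType) : set_system {fset T} :=
  filter_from setT (fun A : {fset T} => [set B | (A `<=` B)%fset]).

Instance fin_net_proper (T : choiceType) : ProperFilter (@fin_net T).
Proof.
apply: filter_from_proper => [|A _]; last by exists A; exact: fsubset_refl.
apply: filter_from_filter => [|A B _ _]; first by exists fset0.
by exists (A `|` B)%fset => // C /= /[!fsubUset]/andP[].
Qed.

Lemma fin_netP (T : choiceType) (P : set {fset T}) :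
  fin_net P <-> exists A, forall B, (A `<=` B)%fset -> P B.
Proof. by split=> [[A _ AP]|[A AP]]; exists A. Qed.

Lemma sum_fsetM (V : nmodType) (S T : choiceType) (B : {fset S}) (C : {fset T})
    (F : S * T -> V) :
  \sum_(p <- enum_fset (B `*` C)%fset) F p =
  \sum_(i <- enum_fset B) \sum_(j <- enum_fset C) F (i, j).
Proof.
rewrite -big_allpairs; apply: perm_big; apply: uniq_perm.
- exact: fset_uniq.
- by apply: allpairs_uniq; rewrite ?fset_uniq// => -[] ? ? [].
move=> [i j]; rewrite in_fsetM; apply/andP/allpairsP => /=.
  by move=> [iB jC]; exists (i, j).
by move=> [[k l] /= [kB lC [-> ->]]].
Qed.

Section usum.
Context {K : numFieldType} {V : normedModType K}.

(** The inductive wrapper keeps the filter statement from being unfolded, so that two families can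
    be compared by [congr usum]. *)
Variant usum (T : choiceType) (f : T -> V) (s : V) : Prop :=
  Usum of (\sum_(i <- enum_fset A) f i) @[A --> @fin_net T] --> s.

Lemma usumP (T : choiceType) (f : T -> V) s : usum f s <->
  forall e : K, 0 < e -> exists A : {fset T}, forall B, (A `<=` B)%fset ->
    `|s - \sum_(i <- enum_fset B) f i| <= e.
Proof.
split=> [[/cvgrPdist_le fs] e e0|fs].
  by have /fin_netP := fs e e0.
by split; apply/cvgrPdist_le => e e0; apply/fin_netP; exact: fs.
Qed.

Lemma usum_unique (T : choiceType) (f : T -> V) s s' :
  usum f s -> usum f s' -> s = s'.
Proof. by move=> [fs] [fs']; exact: cvg_unique fs fs'. Qed.

Lemma unordered_sumE (T : choiceType) (D : set T) (f : T -> V) s :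
  usum (fun i => if i \in D then f i else 0) s -> unordered_sum D f = s.
Proof.
rewrite /unordered_sum => -[fs]; apply: cvg_lim => //.
by under eq_cvg do rewrite big_mkcond.
Qed.

Lemma usumD (T : choiceType) (f g : T -> V) s t :
  usum f s -> usum g t -> usum (fun i => f i + g i) (s + t).
Proof.
move=> [fs] [gt]; split.
by under eq_cvg do rewrite big_split/=; exact: cvgD.
Qed.

Lemma usumZ (T : choiceType) c (f : T -> V) s :
  usum f s -> usum (fun i => c *: f i) (c *: s).
Proof.
move=> [fs]; split.
by under eq_cvg do rewrite -scaler_sumr; apply: cvgZ => //; exact: cvg_cst.
Qed.

Lemma usumN (T : choiceType) (f : T -> V) s :
  usum f s -> usum (fun i => - f i) (- s).
Proof.
by move=> /(usumZ (-1)); rewrite scaleN1r; under eq_fun do rewrite scaleN1r.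
Qed.

Lemma usumB (T : choiceType) (f g : T -> V) s t :
  usum f s -> usum g t -> usum (fun i => f i - g i) (s - t).
Proof. by move=> fs /usumN; exact: usumD. Qed.

Lemma usum_fin (T : choiceType) (A : {fset T}) (f : T -> V) :
  (forall i, i \notin A -> f i = 0) -> usum f (\sum_(i <- enum_fset A) f i).
Proof.
move=> f0; apply/usumP => e e0; exists A => B AB.
by rewrite (big_fset_incl _ AB) ?subrr ?normr0 1?ltW// => i _; exact: f0.
Qed.

Lemma usum1 (T : choiceType) (j : T) (f : T -> V) :
  (forall i, i != j -> f i = 0) -> usum f (f j).
Proof.
move=> f0; rewrite -(big_seq_fset1 +%R j f).
by apply: usum_fin => i /[!inE]; exact: f0.
Qed.

Lemma usum0 (T : choiceType) : usum (fun _ : T => 0 : V) 0.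
Proof. by have := @usum_fin T fset0 (fun=> 0); rewrite big_seq_fset0; exact. Qed.

(* Reindexing along an injection whose range carries the support. *)
Lemma usum_inj (S T : choiceType) (h : S -> T) (f : T -> V) s :
  injective h -> (forall i, (forall j, h j <> i) -> f i = 0) ->
  usum (f \o h) s <-> usum f s.
Proof.
move=> hI f0.
have sumE (A : {fset S}) (B : {fset T}) : (h @` A `<=` B)%fset ->
    (forall j, h j \in B -> j \in A) ->
    \sum_(i <- enum_fset B) f i = \sum_(j <- enum_fset A) f (h j).
  move=> AB BA; rewrite -(big_fset_incl _ AB) => [|i iB iA].
    by rewrite big_imfset//= => x y _ _ /hI.
  apply: f0 => j hj; move: iA; rewrite -hj => /imfsetP; apply.
  by exists j => //; apply: BA; rewrite hj.
split=> /usumP fs; apply/usumP => e /fs[A HA].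
  exists (h @` A)%fset => B AB.
  have finB : finite_set [set j | h j \in B].
    apply: (@finite_preimage _ _ [set` B]) => [x y _ _ /hI//|].
    exact: finite_fset.
  have BE j : (j \in fset_set [set j | h j \in B]) = (h j \in B).
    by rewrite in_fset_set// mem_setE.
  rewrite (sumE (fset_set [set j | h j \in B])) => [||j]; last by rewrite BE.
  - apply: HA; apply/fsubsetP => j jA; rewrite BE.
    by apply: (fsubsetP AB); apply/imfsetP; exists j.
  - by apply/fsubsetP => _ /imfsetP[j/= jB ->]; rewrite -BE.
have finA : finite_set [set j | h j \in A].
  apply: (@finite_preimage _ _ [set` A]) => [x y _ _ /hI//|].
  exact: finite_fset.
have AE j : (j \in fset_set [set j | h j \in A]) = (h j \in A).
  by rewrite in_fset_set// mem_setE.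
exists (fset_set [set j | h j \in A]) => B AB.
rewrite -(sumE B (A `|` h @` B)%fset) ?fsubsetUr => [|//|j].
  by apply: HA; exact: fsubsetUl.
rewrite in_fsetU => /orP[jA|/imfsetP[k/= kB /hI->//]].
by apply: (fsubsetP AB); rewrite AE.
Qed.

Lemma usum_bij (S T : choiceType) (h : S -> T) (f : T -> V) s :
  bijective h -> usum (f \o h) s <-> usum f s.
Proof.
move=> [h' hK h'K]; apply: usum_inj => [|i /(_ (h' i))]; first exact: can_inj hK.
by rewrite h'K.
Qed.

(** Unconditional convergence over the product and along each row suffices. Once a finite [B]
    contains the first projections of a good [A], a rectangle over [B] and a large [C] approximates
    both the total and the rows of [B]. *)
Lemma usum_fubini (S T : choiceType) (F : S * T -> V) r s :
  usum F s -> (forall i, usum (fun j => F (i, j)) (r i)) -> usum r s.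
Proof.
move=> /usumP Fs Fr; apply/usumP => e e0.
have [A HA] := Fs _ (divr_gt0 e0 (ltr0Sn K 1)).
pose A1 := [fset p.1 | p in A]%fset; pose A2 := [fset p.2 | p in A]%fset.
exists A1 => B A1B.
(* The rows of [B] share an error of [e / 2]; the [1 +] covers an empty [B]. *)
pose d := e / 2 / (1 + #|` B|%:R).
have d0 : 0 < d by rewrite !divr_gt0// ltr_wpDr.
pose c i := projT1 (cid ((usumP _ _).1 (Fr i) d d0)).
have cP i C : (c i `<=` C)%fset -> `|r i - \sum_(j <- enum_fset C) F (i, j)| <= d.
  by move: C; rewrite /c; case: cid.
pose C := (A2 `|` \bigcup_(i <- B) c i)%fset.
have -> : s - \sum_(i <- enum_fset B) r i =
    (s - \sum_(p <- enum_fset (B `*` C)%fset) F p) -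
    \sum_(i <- enum_fset B) (r i - \sum_(j <- enum_fset C) F (i, j)).
  by rewrite sum_fsetM sumrB opprB addrA subrK.
rewrite (le_trans (ler_normB _ _))// [e]splitr lerD//.
  apply: HA; apply/fsubsetP => p pA; rewrite in_fsetM !inE.
  apply/andP; split; last by apply/orP; left; apply/imfsetP; exists p.
  by apply: (fsubsetP A1B); apply/imfsetP; exists p.
rewrite (le_trans (ler_norm_sum _ _ _))//.
apply: (@le_trans _ _ (\sum_(i <- enum_fset B) d)).
  rewrite big_seq [leRHS]big_seq; apply: ler_sum => i iB; apply: cP.
  by apply: fsubsetU; apply/orP; right; exact: bigfcup_sup.
rewrite big_const_seq count_predT iter_addr_0 -[_ *+ _]mulr_natr.
rewrite /d -mulrA ler_piMr//; first by rewrite ltW// divr_gt0.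
by rewrite mulrC ler_pdivrMr ?ltr_wpDr// mul1r lerDr.
Qed.

End usum.

Lemma sum_fsetD (V : nmodType) (T : choiceType) (A B : {fset T}) (f : T -> V) :
  (A `<=` B)%fset -> \sum_(i <- enum_fset B) f i =
  \sum_(i <- enum_fset A) f i + \sum_(i <- enum_fset (B `\` A)%fset) f i.
Proof.
move=> AB; rewrite (big_fsetID _ (mem A)); congr (_ + _).
  congr (bigop _ (enum_fset _) _); apply/fsetP => i; rewrite !inE/=.
  by apply: andb_idl => /(fsubsetP AB).
by congr (bigop _ (enum_fset _) _); apply/fsetP => i; rewrite !inE/= andbC.
Qed.

Lemma ler_sum_fset (K : numDomainType) (T : choiceType) (A B : {fset T})
    (f : T -> K) : (forall i, 0 <= f i) -> (A `<=` B)%fset ->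
  \sum_(i <- enum_fset A) f i <= \sum_(i <- enum_fset B) f i.
Proof. by move=> f0 AB; rewrite (sum_fsetD f AB) lerDl sumr_ge0. Qed.

Section usum_bounds.
Context {K : numFieldType} {V : normedModType K} {T : choiceType}.

Lemma usum_le_norm (f : T -> V) s (M : K) : usum f s ->
  (forall A : {fset T}, `|\sum_(i <- enum_fset A) f i| <= M) -> `|s| <= M.
Proof.
move=> /usumP fs fM; apply/ler_addgt0Pr => e /fs[A /(_ A (fsubset_refl _)) HA].
rewrite -[s](subrK (\sum_(i <- enum_fset A) f i)) addrC.
by rewrite (le_trans (ler_normD _ _))// lerD.
Qed.

End usum_bounds.

Lemma usum_series (K : numFieldType) (V : normedModType K) (f : nat -> V) s : usum f s -> series f @ \oo --> s.
Proof.
move=> /usumP fs; apply/cvgrPdist_le => e /fs[A HA].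
near=> n.
have -> : series f n = \sum_(i <- enum_fset [fset i in iota 0 n]%fset) f i.
  rewrite /series/= /index_iota subn0; apply: perm_big; apply: uniq_perm.
  - exact: iota_uniq.
  - exact: fset_uniq.
  - by move=> i; rewrite !inE.
apply: HA; apply/fsubsetP => i iA; rewrite !inE mem_iota/=.
suff : (\max_(i <- enum_fset A) i < n)%N by apply: leq_ltn_trans; exact: leq_bigmax_seq.
by near: n; exists (\max_(i <- enum_fset A) i).+1.
Unshelve. all: by end_near. Qed.

Section usum_real.
Context {R : realType} {T : choiceType}.

Lemma usum_ge_sum (f : T -> R) s A : (forall i, 0 <= f i) -> usum f s ->
  \sum_(i <- enum_fset A) f i <= s.
Proof.
move=> f0 /usumP fs; apply/ler_addgt0Pr => e /fs[B HB].
rewrite (le_trans (ler_sum_fset f0 (fsubsetUl A B)))//.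
by have := HB _ (fsubsetUr A B); rewrite ler_distlC => /andP[_]; rewrite addrC.
Qed.

Lemma usum_ge0 (f : T -> R) s : (forall i, 0 <= f i) -> usum f s -> 0 <= s.
Proof. by move=> f0 /(usum_ge_sum fset0 f0); rewrite big_seq_fset0. Qed.

Lemma usum_nneg (f : T -> R) M : (forall i, 0 <= f i) ->
  (forall A : {fset T}, \sum_(i <- enum_fset A) f i <= M) -> exists s, usum f s.
Proof.
move=> f0 fM; pose E := range (fun A : {fset T} => \sum_(i <- enum_fset A) f i).
have supE : has_sup E.
  by split; [exists (\sum_(i <- enum_fset fset0) f i), fset0|exists M => _ [A _ <-]].
exists (sup E); apply/usumP => e e0.
have [_ [A _ <-] HA] := sup_adherent e0 supE.
exists A => B AB; rewrite ler_distlC; apply/andP; split.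
  by rewrite (le_trans (ltW HA))// ler_sum_fset.
apply: ler_wpDr; first exact: ltW.
by apply: (ub_le_sup (proj2 supE)); exists B.
Qed.

Lemma usum_abs (f : T -> R) M :
  (forall A : {fset T}, \sum_(i <- enum_fset A) `|f i| <= M) -> exists s, usum f s.
Proof.
move=> fM; have [a ha] := usum_nneg (fun i => normr_ge0 (f i)) fM.
(* [f] is the difference of the nonnegative families [|f| + f] and [|f|], whose partial sums are at
   most [2 * M] and [M]. *)
have [|A|b hb] := @usum_nneg (fun i => `|f i| + f i) (2 * M).
- by move=> i; have := ler_norm (- f i); rewrite normrN; lra.
- rewrite big_split/= (le_trans (lerD (fM A) (le_trans (ler_sum _ _) (fM A))))//.
    by move=> i _; exact: ler_norm.
  by rewrite mulr_natl mulr2n.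
exists (b - a); have := usumB hb ha.
by under eq_fun do rewrite addrAC subrr add0r.
Qed.

Lemma usum_cmp (f g : T -> R) s : (forall i, `|f i| <= g i) -> usum g s ->
  exists t, usum f t.
Proof.
move=> fg gs; apply: (@usum_abs _ s) => A.
have g0 i : 0 <= g i by exact: le_trans (fg i).
by rewrite (le_trans (ler_sum _ (fun i _ => fg i)))// usum_ge_sum.
Qed.

End usum_real.

Section usum_complex.
Context {R : realType} {T : choiceType}.
Implicit Types (f : T -> R[i]).

Lemma normCE (z : R[i]) : `|z| = (Normc.normc z)%:C.
Proof. by case: z => a b; rewrite normc_def. Qed.

Lemma normc_ge0 (z : R[i]) : 0 <= Normc.normc z.
Proof. by case: z => *; exact: sqrtr_ge0. Qed.

Lemma posC (e : R[i]) : 0 < e -> e = (complex.Re e)%:C /\ 0 < complex.Re e.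
Proof. by case: e => a b; rewrite ltcE/= => /andP[/eqP-> a0]. Qed.

Lemma usumCP (V : normedModType R[i]) (f : T -> V) s : usum f s <->
  forall e : R, 0 < e -> exists A : {fset T}, forall B, (A `<=` B)%fset ->
    `|s - \sum_(i <- enum_fset B) f i| <= e%:C.
Proof.
rewrite usumP; split=> fs e => [e0|/posC[-> e0]]; apply: fs => //.
by rewrite ltcR.
Qed.

Lemma usum_real (f : T -> R) s : usum f s -> usum (fun i => (f i)%:C) s%:C.
Proof.
move=> /usumP fs; apply/usumCP => e /fs[A HA]; exists A => B /HA.
by rewrite -rmorph_sum -rmorphB/= normc_def/= expr0n addr0 sqrtr_sqr lecR.
Qed.

Lemma usum_conj f s : usum f s -> usum (fun i => (f i)^*%C) s^*%C.
Proof.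
move=> /usumP fs; apply/usumP => e /fs[A HA]; exists A => B /HA.
by rewrite -rmorph_sum -rmorphB/= !normCE; case: (_ - _) => a b /=; rewrite sqrrN.
Qed.

Lemma usumM (V := R[i]) (c : R[i]) f s : usum f s -> usum (fun i => c * f i) (c * s).
Proof. exact: usumZ. Qed.

Lemma usum_absC f M :
  (forall A : {fset T}, \sum_(i <- enum_fset A) Normc.normc (f i) <= M) ->
  exists s, usum f s.
Proof.
move=> fM.
have [|a ha] := @usum_abs R T (fun i => complex.Re (f i)) M.
  move=> A; apply: le_trans (fM A); apply: ler_sum => i _.
  by rewrite -lecR -normCE normc_ge_Re.
have [|b hb] := @usum_abs R T (fun i => complex.Im (f i)) M.
  move=> A; apply: le_trans (fM A); apply: ler_sum => i _.
  rewrite -lecR -normCE; have := normc_ge_Re ('i * f i).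
  by rewrite normrM normCi mul1r; case: (f i) => u v /=; rewrite !mul0r mul1r sub0r normrN.
exists (a%:C + 'i * b%:C).
have := usumD (usum_real ha) (usumM 'i (usum_real hb)).
by congr usum; apply/funext => i; rewrite -complexE.
Qed.

Lemma usum_le_normc f s g G : usum f s -> (forall i, Normc.normc (f i) <= g i) ->
  usum g G -> Normc.normc s <= G.
Proof.
move=> fs fg gG; rewrite -lecR -normCE; apply: usum_le_norm fs _ => A.
rewrite (le_trans (ler_norm_sum _ _ _))//.
rewrite (eq_bigr (fun i => (Normc.normc (f i))%:C))// -rmorph_sum lecR.
apply: le_trans (usum_ge_sum A _ gG); first exact: ler_sum.
by move=> i; exact: le_trans (normc_ge0 _) (fg i).
Qed.

(** Dominated convergence along an arbitrary filter: outside a finite set carrying [g] up to [e / 3]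
    all the sums are uniformly small, and on that set only finitely many limits are involved. *)
Lemma usum_tannery (U : Type) (F : set_system U) {FF : Filter F}
    (f_ : U -> T -> R[i]) f (s_ : U -> R[i]) s (g : T -> R) G :
  (forall u, usum (f_ u) (s_ u)) -> usum f s -> usum g G ->
  (forall u i, Normc.normc (f_ u i) <= g i) ->
  (forall i, Normc.normc (f i) <= g i) ->
  (forall i, f_ u i @[u --> F] --> f i) -> s_ u @[u --> F] --> s.
Proof.
move=> fs_ fs gG fg_ fg ff; apply/cvgrPdist_le => e' e'0; have [-> e0] := posC e'0.
set e := complex.Re e' in e0 *.
have g0 i : 0 <= g i by exact: le_trans (normc_ge0 _) (fg i).
have [A HA] := (usumP _ _).1 gG (e / 3) (divr_gt0 e0 (ltr0Sn _ _)).
have tail (h : T -> R[i]) t : usum h t -> (forall i, Normc.normc (h i) <= g i) ->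
    `|t - \sum_(i <- enum_fset A) h i| <= (e / 3)%:C.
  move=> ht hg.
  have hs : usum (fun i => if i \in A then h i else 0) (\sum_(i <- enum_fset A) h i).
    rewrite [X in usum _ X](_ : _ = \sum_(i <- enum_fset A) if i \in A then h i else 0).
      by apply: usum_fin => i /negPf->.
    by rewrite big_seq [RHS]big_seq; apply: eq_bigr => i ->.
  apply: usum_le_norm (usumB ht hs) _ => B.
  rewrite (le_trans (ler_norm_sum _ _ _))//.
  apply: (@le_trans _ _ (\sum_(i <- enum_fset (A `|` B)%fset)
      (if i \in A then 0 else g i))%:C).
    apply: (@le_trans _ _ (\sum_(i <- enum_fset B) if i \in A then 0 else g i)%:C).
      rewrite rmorph_sum; apply: ler_sum => i _.
      by case: ifP => _; rewrite ?subrr ?normr0// subr0 normCE lecR.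
    by rewrite lecR; apply: ler_sum_fset; [move=> i; case: ifP|exact: fsubsetUr].
  rewrite lecR (sum_fsetD _ (fsubsetUl A B)) big_seq big1 ?add0r => [|i ->//].
  rewrite big_seq (eq_bigr g) => [|i]; last by rewrite in_fsetD => /andP[/negPf->].
  rewrite -big_seq -(lerD2l (\sum_(i <- enum_fset A) g i)).
  rewrite -(sum_fsetD _ (fsubsetUl A B)).
  rewrite (le_trans (usum_ge_sum _ g0 gG))// -lerBlDl.
  by rewrite (le_trans (ler_norm _))// HA.
have cvA : \sum_(i <- enum_fset A) f_ u i @[u --> F] --> \sum_(i <- enum_fset A) f i.
  by apply: cvg_big => [|i _]; [exact: add_continuous|exact: ff].
near=> u.
rewrite -[s - _](subrKA (\sum_(i <- enum_fset A) f i)).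
rewrite -[X in `|_ + X|](subrKA (\sum_(i <- enum_fset A) f_ u i)).
rewrite -/e (_ : e = e / 3 + (e / 3 + e / 3)); last by field.
rewrite !rmorphD/= (le_trans (ler_normD _ _))// lerD//; first exact: tail.
rewrite (le_trans (ler_normD _ _))// lerD//; last by rewrite distrC; exact: tail.
near: u; move/cvgrPdist_le : cvA; apply.
by rewrite ltcR divr_gt0.
Unshelve. all: by end_near. Qed.

End usum_complex.

(** * The Hilbert space l2 *)

Section l2_theory.
Context {R : realType}.
Implicit Types I J : choiceType.

Lemma l2_ext I (f g : l2 R I) : (forall i, f i = g i) -> f = g.
Proof. by move=> fg; apply/val_inj/funext. Qed.

Lemma l2E0 I i : (0 : l2 R I) i = 0.
Proof. by []. Qed.

Lemma l2ED I (f g : l2 R I) i : (f + g) i = f i + g i.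
Proof. by []. Qed.

Lemma l2EB I (f g : l2 R I) i : (f - g) i = f i - g i.
Proof. by []. Qed.

Lemma l2EZ I c (f : l2 R I) i : (c *: f) i = c * f i.
Proof. by []. Qed.

Lemma l2Esum I (T : Type) (r : seq T) (F : T -> l2 R I) i :
  (\sum_(t <- r) F t) i = \sum_(t <- r) F t i.
Proof.
by elim/big_rec2: _ => [|t x y _ <-].
Qed.

Lemma ketE I (i j : I) : ket i j = (j == i)%:R :> R[i].
Proof. by []. Qed.

Lemma l2normE I (f : l2 R I) : `|f| = (l2norm f)%:C.
Proof. by []. Qed.

Lemma usum_l2norm I (f : l2 R I) :
  usum (fun i => Normc.normc (f i) ^+ 2) (l2norm f ^+ 2).
Proof.
have fM A : \sum_(i <- enum_fset A) Normc.normc (f i) ^+ 2 <= l2norm f ^+ 2.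
  by move: A; apply/sqnorm_leP; rewrite sqnormE.
have [s fs] := usum_nneg (fun i => sqr_ge0 (Normc.normc (f i))) fM.
suff -> : l2norm f ^+ 2 = s by [].
apply/eqP; rewrite eq_le; apply/andP; split.
  rewrite -lee_fin -sqnormE; apply/sqnorm_leP => A.
  by apply: usum_ge_sum fs => i; exact: sqr_ge0.
rewrite (le_trans (ler_norm s))//; apply: usum_le_norm fs _ => A.
by rewrite ger0_norm// sumr_ge0// => i _; exact: sqr_ge0.
Qed.

Lemma normc_sqr (z : R[i]) : z * z^*%C = (Normc.normc z ^+ 2)%:C.
Proof.
case: z => a b /=; rewrite sqr_sqrtr ?addr_ge0 ?sqr_ge0//.
by apply/eqP; rewrite eq_complex/=; apply/andP; split; apply/eqP; ring.
Qed.

Lemma normc_conj (z : R[i]) : Normc.normc z^*%C = Normc.normc z.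
Proof. by case: z => a b /=; rewrite sqrrN. Qed.

Lemma normc_mul_le (x y : R[i]) : Normc.normc (x * y^*%C) <=
  (Normc.normc x ^+ 2 + Normc.normc y ^+ 2) / 2.
Proof.
rewrite Normc.normcM normc_conj.
have := sqr_ge0 (Normc.normc x - Normc.normc y); lra.
Qed.

Lemma inner_usum I (f g : l2 R I) : usum (fun i => f i * (g i)^*%C) (inner f g).
Proof.
have [|s fgs] := @usum_absC R I (fun i => f i * (g i)^*%C)
    ((l2norm f ^+ 2 + l2norm g ^+ 2) / 2).
  move=> A; rewrite (le_trans (ler_sum _ (fun i _ => normc_mul_le _ _)))//.
  rewrite -mulr_suml ler_pM2r ?invr_gt0// big_split lerD//;
    by apply: usum_ge_sum (usum_l2norm _) => i; exact: sqr_ge0.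
suff -> : inner f g = s by [].
by apply: unordered_sumE; under eq_fun do rewrite in_setT.
Qed.

Lemma inner_conj I (f g : l2 R I) : inner g f = (inner f g)^*%C.
Proof.
apply: usum_unique (inner_usum g f) _; have := usum_conj (inner_usum f g).
by congr usum; apply/funext => i; rewrite rmorphM/= conjcK mulrC.
Qed.

Lemma innerDl I (f g h : l2 R I) : inner (f + g) h = inner f h + inner g h.
Proof.
apply: usum_unique (inner_usum _ _) _.
have := usumD (inner_usum f h) (inner_usum g h).
by congr usum; apply/funext => i; rewrite l2ED mulrDl.
Qed.

Lemma innerZl I c (f h : l2 R I) : inner (c *: f) h = c * inner f h.
Proof.
apply: usum_unique (inner_usum _ _) _; have := usumM c (inner_usum f h).
by congr usum; apply/funext => i; rewrite l2EZ mulrA.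
Qed.

Lemma innerDr I (f g h : l2 R I) : inner h (f + g) = inner h f + inner h g.
Proof. by rewrite ![inner h _]inner_conj innerDl rmorphD. Qed.

Lemma innerZr I c (f h : l2 R I) : inner h (c *: f) = c^*%C * inner h f.
Proof. by rewrite ![inner h _]inner_conj innerZl rmorphM. Qed.

Lemma innerNl I (f h : l2 R I) : inner (- f) h = - inner f h.
Proof. by rewrite -scaleN1r innerZl mulN1r. Qed.

Lemma innerNr I (f h : l2 R I) : inner h (- f) = - inner h f.
Proof. by rewrite -scaleN1r innerZr rmorphN1 mulN1r. Qed.

Lemma inner0l I (h : l2 R I) : inner 0 h = 0.
Proof. by rewrite -(scale0r 0) innerZl mul0r. Qed.

Lemma inner0r I (h : l2 R I) : inner h 0 = 0.
Proof. by rewrite inner_conj inner0l rmorph0. Qed.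

Lemma inner_suml I (T : Type) (r : seq T) (F : T -> l2 R I) h :
  inner (\sum_(t <- r) F t) h = \sum_(t <- r) inner (F t) h.
Proof. by apply: (big_morph (fun f => inner f h)) => [f g|]; rewrite ?innerDl ?inner0l. Qed.

Lemma inner_sumr I (T : Type) (r : seq T) (F : T -> l2 R I) h :
  inner h (\sum_(t <- r) F t) = \sum_(t <- r) inner h (F t).
Proof. by apply: (big_morph (inner h)) => [f g|]; rewrite ?innerDr ?inner0r. Qed.

Lemma inner_norm I (f : l2 R I) : inner f f = (l2norm f ^+ 2)%:C.
Proof.
apply: usum_unique (inner_usum f f) _.
by under eq_fun do rewrite normc_sqr; exact: usum_real (usum_l2norm f).
Qed.

Lemma inner_eq I (f g : l2 R I) : (forall h, inner f h = inner g h) -> f = g.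
Proof.
move=> fg; apply/eqP; rewrite -subr_eq0; apply/eqP/l2norm0_eq0/eqP.
by rewrite -sqrf_eq0 -(inj_eq (@complexI R))/= -inner_norm innerDl innerNl fg subrr.
Qed.

Lemma inner_ketr I (f : l2 R I) i : inner f (ket i) = f i.
Proof.
have -> : f i = f i * (ket i i : R[i])^*%C by rewrite ketE eqxx rmorph1 mulr1.
apply: usum_unique (inner_usum _ _) _.
by apply: (usum1 (f := fun j => f j * (ket i j : R[i])^*%C)) => j /negPf ji; rewrite ketE ji rmorph0 mulr0.
Qed.

Lemma inner_ketl I (f : l2 R I) i : inner (ket i) f = (f i)^*%C.
Proof. by rewrite inner_conj inner_ketr. Qed.

Lemma inner_ket I (i j : I) : inner (ket i) (ket j) = (i == j)%:R :> R[i].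
Proof. by rewrite inner_ketr ketE eq_sym. Qed.

Lemma l2norm_ket I (i : I) : l2norm (ket i : l2 R I) = 1.
Proof.
apply/eqP; rewrite -(@eqrXn2 _ 2) ?l2norm_ge0// expr1n; apply/eqP.
by apply: (@complexI R); rewrite -inner_norm inner_ket eqxx.
Qed.

Lemma inner_le2 I (f g : l2 R I) :
  Normc.normc (inner f g) <= (l2norm f ^+ 2 + l2norm g ^+ 2) / 2.
Proof.
apply: usum_le_normc (inner_usum f g) (fun i => normc_mul_le _ _) _.
have := usumZ (2^-1) (usumD (usum_l2norm f) (usum_l2norm g)).
rewrite [X in usum _ X](mulrC _) => H; move: H.
by congr usum; apply/funext => i; rewrite [LHS]mulrC.
Qed.

Lemma normcR (a : R) : Normc.normc a%:C = `|a|.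
Proof. by rewrite /= expr0n addr0 sqrtr_sqr. Qed.

(** [inner_le2] is the arithmetic-geometric form; applied to the normalised vectors it gives the
    product form. *)
Lemma cauchy_schwarz I (f g : l2 R I) :
  Normc.normc (inner f g) <= l2norm f * l2norm g.
Proof.
have [/l2norm0_eq0->|f0] := eqVneq (l2norm f) 0.
  by rewrite inner0l Normc.normc0 mulr_ge0 ?l2norm_ge0.
have [/l2norm0_eq0->|g0] := eqVneq (l2norm g) 0.
  by rewrite inner0r Normc.normc0 mulr_ge0 ?l2norm_ge0.
have {}f0 : 0 < l2norm f by rewrite lt_def f0 l2norm_ge0.
have {}g0 : 0 < l2norm g by rewrite lt_def g0 l2norm_ge0.
have := inner_le2 ((l2norm f)^-1%:C *: f) ((l2norm g)^-1%:C *: g).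
rewrite !l2normZ innerZl innerZr !Normc.normcM normc_conj !normcR.
rewrite !ger0_norm ?invr_ge0 ?l2norm_ge0// !mulVf ?gt_eqF//.
rewrite expr1n -mulr2n divff// mulrA -invfM mulrC ler_pdivrMr ?mulr_gt0// mul1r.
by rewrite mulrC.
Qed.

End l2_theory.

(** * Bounded operators *)

Section bounded.
Context {R : realType}.
Implicit Types I J : choiceType.

Lemma bounded_opI I J (x : l2 R I -> l2 R J) (c : R) : linear x ->
  (forall f, l2norm (x f) <= c * l2norm f) -> bounded_op x.
Proof.
by move=> xl xc; split=> //; exists c%:C => f; rewrite !l2normE -rmorphM lecR.
Qed.

Lemma bounded_opE I J (x : l2 R I -> l2 R J) : bounded_op x ->
  exists2 c : R, 0 <= c & forall f, l2norm (x f) <= c * l2norm f.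
Proof.
(* The order on [R[i]] compares real parts once the imaginary parts agree, so the real part of [c]
   is a bound; the absolute value makes it nonnegative. *)
move=> [_ [c xc]]; exists `|complex.Re c|; first exact: normr_ge0.
move=> f; have := xc f; rewrite !l2normE lecE => /andP[_].
case: c {xc} => a b /=; rewrite mulr0 subr0 => /le_trans; apply.
by rewrite ler_wpM2r ?l2norm_ge0// ler_norm.
Qed.

Section linear.
Variables (I J : choiceType) (x : l2 R I -> l2 R J).
Hypothesis xl : linear x.

Lemma linE0 : x 0 = 0.
Proof. by have := xl (-1) 0 0; rewrite scaler0 addr0 scaleN1r addNr. Qed.

Lemma linED f g : x (f + g) = x f + x g.
Proof. by have := xl 1 f g; rewrite !scale1r. Qed.

Lemma linEZ c f : x (c *: f) = c *: x f.
Proof. by have := xl c f 0; rewrite linE0 !addr0. Qed.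

Lemma linEB f g : x (f - g) = x f - x g.
Proof. by rewrite linED -scaleN1r linEZ scaleN1r. Qed.

Lemma linEsum (T : Type) (r : seq T) (F : T -> l2 R I) :
  x (\sum_(t <- r) F t) = \sum_(t <- r) x (F t).
Proof. by apply: (big_morph x) => [f g|]; rewrite ?linED ?linE0. Qed.

End linear.

Lemma l2norm_bound I (f : l2 R I) M : 0 <= M ->
  (forall A : {fset I}, \sum_(i <- enum_fset A) Normc.normc (f i) ^+ 2 <= M ^+ 2) ->
  l2norm f <= M.
Proof. by move=> M0 /sqnorm_leP fM; exact: l2norm_le. Qed.

Lemma l2norm_sum_le I (f : l2 R I) A :
  \sum_(i <- enum_fset A) Normc.normc (f i) ^+ 2 <= l2norm f ^+ 2.
Proof. by apply: usum_ge_sum (usum_l2norm f) => i; exact: sqr_ge0. Qed.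

(** The squared distance of [f] from its partial sum over [B] is the sum of [|f i|^2] outside [B], a
    tail of [usum_l2norm]. *)
Lemma ket_usum I (f : l2 R I) : usum (fun i => f i *: ket i) f.
Proof.
apply/usumCP => e e0.
have [A HA] := (usumP _ _).1 (usum_l2norm f) (e ^+ 2) (exprn_gt0 _ e0).
exists A => B AB; rewrite l2normE lecR; apply: l2norm_bound (ltW e0) _ => C.
pose u i := if i \in B then 0 else Normc.normc (f i) ^+ 2.
rewrite (eq_bigr u) => [|i _]; last first.
  rewrite l2EB l2Esum /u.
  have -> : \sum_(j <- enum_fset B) (f j *: ket j) i = if i \in B then f i else 0.
    rewrite (eq_bigr (fun j => f j * (i == j)%:R))//.
    case: ifP => iB.
      rewrite (big_fsetD1 i)// eqxx mulr1 big_seq big1 => [|j]; first by rewrite /= addr0.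
      by rewrite !inE eq_sym => /andP[/negPf-> _]; rewrite mulr0.
    rewrite big_seq big1// => j jB; case: eqP => [ij|]; last by rewrite mulr0.
    by rewrite ij jB in iB.
  by case: ifP; rewrite ?subrr ?subr0// Normc.normc0 expr0n.
apply: (@le_trans _ _ (\sum_(i <- enum_fset (B `|` C)%fset) u i)).
  by apply: ler_sum_fset (fsubsetUr _ _) => i; rewrite /u; case: ifP => // _; exact: sqr_ge0.
rewrite (sum_fsetD _ (fsubsetUl B C)) big_seq big1 ?add0r => [|i iB]; last by rewrite /u iB.
rewrite big_seq (eq_bigr (fun i => Normc.normc (f i) ^+ 2)) => [|i]; last first.
  by rewrite in_fsetD /u => /andP[/negPf->].
rewrite -big_seq -(lerD2l (\sum_(i <- enum_fset B) Normc.normc (f i) ^+ 2)).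
rewrite -(sum_fsetD _ (fsubsetUl B C)) (le_trans (l2norm_sum_le _ _))//.
by rewrite -lerBlDl (le_trans (ler_norm _))// HA.
Qed.

Lemma bounded_usum I J (x : l2 R I -> l2 R J) (T : choiceType) (u : T -> l2 R I) s :
  bounded_op x -> usum u s -> usum (fun t => x (u t)) (x s).
Proof.
move=> xb /usumCP us; have [c c0 xc] := bounded_opE xb; have [xl _] := xb.
apply/usumCP => e e0; have c1 : 0 < c + 1 by rewrite ltr_wpDl.
have [A HA] := us (e / (c + 1)) (divr_gt0 e0 c1).
exists A => B /HA; rewrite -linEsum// -linEB// !l2normE !lecR => H.
rewrite (le_trans (xc _))// (le_trans (ler_wpM2l c0 H))//.
by rewrite mulrCA ler_piMr ?ltW// ltr_pdivrMr// mul1r ltrDl.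
Qed.

Lemma usum_inner I (T : choiceType) (u : T -> l2 R I) s h :
  usum u s -> usum (fun t => inner (u t) h) (inner s h).
Proof.
move=> /usumCP us; apply/usumCP => e e0.
have h1 : 0 < l2norm h + 1 by rewrite ltr_wpDl ?l2norm_ge0.
have [A HA] := us (e / (l2norm h + 1)) (divr_gt0 e0 h1).
exists A => B /HA; rewrite -inner_suml -innerNl -innerDl normCE l2normE !lecR => H.
rewrite (le_trans (cauchy_schwarz _ _))// (le_trans (ler_wpM2r (l2norm_ge0 _) H))//.
by rewrite -mulrA ler_piMr ?ltW// mulrC ltr_pdivrMr// mul1r ltrDl.
Qed.

Lemma bounded_ext I J (x y : l2 R I -> l2 R J) : bounded_op x -> bounded_op y ->
  (forall i, x (ket i) = y (ket i)) -> x = y.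
Proof.
move=> xb yb xy; apply/funext => f.
apply: usum_unique (bounded_usum xb (ket_usum f)) _.
have := bounded_usum yb (ket_usum f).
congr usum; apply/funext => i.
by have [xl _] := xb; have [yl _] := yb; rewrite !linEZ// xy.
Qed.

Lemma bounded_comp I J K (x : l2 R J -> l2 R K) (y : l2 R I -> l2 R J) :
  bounded_op x -> bounded_op y -> bounded_op (x \o y).
Proof.
move=> xb yb; have [xl _] := xb; have [yl _] := yb.
have [c c0 xc] := bounded_opE xb; have [d d0 yd] := bounded_opE yb.
apply: (@bounded_opI _ _ _ (c * d)) => [a f g /=|f /=]; first by rewrite yl xl.
by rewrite (le_trans (xc _))// -mulrA ler_wpM2l.
Qed.

Lemma bounded_id I : bounded_op (@idfun (l2 R I)).
Proof. by apply: (@bounded_opI _ _ _ 1) => // f; rewrite mul1r. Qed.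

Lemma bounded_cst0 I J : bounded_op (fun _ : l2 R I => 0 : l2 R J).
Proof.
apply: (@bounded_opI _ _ _ 0) => [a f g|f]; first by rewrite scaler0 addr0.
by rewrite mul0r; apply: l2norm_bound => // A; rewrite big1// => i _; rewrite l2E0 Normc.normc0 expr0n.
Qed.

Lemma lin_opE I J c (x y : l2 R I -> l2 R J) f : (c *: x + y) f = c *: x f + y f.
Proof. by []. Qed.

Lemma bounded_lin I J c (x y : l2 R I -> l2 R J) :
  bounded_op x -> bounded_op y -> bounded_op (c *: x + y).
Proof.
move=> xb yb; have [xl _] := xb; have [yl _] := yb.
have [a a0 xa] := bounded_opE xb; have [b b0 yb'] := bounded_opE yb.
apply: (@bounded_opI _ _ _ (Normc.normc c * a + b)) => [d f g|f].
  rewrite !lin_opE xl yl !scalerDr !scalerA [c * d]mulrC.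
  by rewrite addrACA.
rewrite lin_opE (le_trans (ler_l2normD _ _))// mulrDl lerD// l2normZ -mulrA.
by rewrite ler_wpM2l ?normc_ge0.
Qed.

End bounded.

(** * Shifts, diagonal projections, tensor products and adjoints *)

Section constructions.
Context {R : realType}.
Implicit Types I J : choiceType.

(* Weighted composition: zero unless the resulting function is square
   summable, see wcompE. *)
Definition wcomp I J (h : J -> I) (m : J -> R[i]) (f : l2 R I) : l2 R J :=
  insubd 0 (fun j => m j * f (h j)).

Lemma sum_inj_le I J (h : J -> I) (f : l2 R I) A : injective h ->
  \sum_(j <- enum_fset A) Normc.normc (f (h j)) ^+ 2 <= l2norm f ^+ 2.
Proof.
move=> hI; apply: le_trans (l2norm_sum_le f (h @` A)%fset).
by rewrite big_imfset//= => x y _ _ /hI.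
Qed.

Section wcomp.
Variables (I J : choiceType) (h : J -> I) (m : J -> R[i]).
Hypotheses (hI : injective h) (m1 : forall j, Normc.normc (m j) <= 1).

Let wcomp_sum (f : l2 R I) A :
  \sum_(j <- enum_fset A) Normc.normc (m j * f (h j)) ^+ 2 <= l2norm f ^+ 2.
Proof.
apply: le_trans (sum_inj_le f A hI); apply: ler_sum => j _.
by rewrite Normc.normcM exprMn ler_piMl ?sqr_ge0// expr_le1 ?normc_ge0.
Qed.

Lemma wcompE f j : wcomp h m f j = m j * f (h j).
Proof.
rewrite /wcomp val_insubd.
have -> // : (fun j => m j * f (h j)) \in @square_summable R J.
by apply/square_summableP; exists (l2norm f ^+ 2); apply/sqnorm_leP; exact: wcomp_sum.
Qed.

Lemma wcomp_linear : linear (wcomp h m).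
Proof.
move=> c f g; apply: l2_ext => j.
by rewrite l2ED l2EZ !wcompE l2ED l2EZ mulrDr mulrCA.
Qed.

Lemma wcomp_le f : l2norm (wcomp h m f) <= l2norm f.
Proof.
apply: l2norm_bound; rewrite ?l2norm_ge0// => A.
by rewrite (eq_bigr (fun j => Normc.normc (m j * f (h j)) ^+ 2)) => [|j _]; rewrite ?wcompE.
Qed.

Lemma wcomp_bounded : bounded_op (wcomp h m).
Proof.
by apply: (@bounded_opI _ _ _ _ 1) => [|f]; [exact: wcomp_linear|rewrite mul1r wcomp_le].
Qed.

End wcomp.

Definition l2_restrict I (p : pred I) : l2 R I -> l2 R I :=
  wcomp id (fun i => (p i)%:R).

Definition pullback I J (h : J -> I) : l2 R I -> l2 R J := wcomp h (fun=> 1).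

Lemma restrictE I (p : pred I) f i : l2_restrict p f i = (p i)%:R * f i.
Proof.
by rewrite wcompE// => j; case: (p j); rewrite ?Normc.normc1 ?Normc.normc0 ?ler01.
Qed.

Lemma restrict_bounded I (p : pred I) : bounded_op (l2_restrict p).
Proof.
apply: wcomp_bounded => // j.
by case: (p j); rewrite ?Normc.normc1 ?Normc.normc0 ?ler01.
Qed.

Lemma pullbackE I J (h : J -> I) f j : injective h -> pullback h f j = f (h j).
Proof. by move=> hI; rewrite wcompE ?mul1r// => ?; rewrite Normc.normc1. Qed.

Lemma pullback_bounded I J (h : J -> I) : injective h -> bounded_op (pullback h).
Proof. by move=> hI; apply: wcomp_bounded => // ?; rewrite Normc.normc1. Qed.

Lemma pullback_ket I J (h : J -> I) (h' : I -> J) i :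
  cancel h h' -> cancel h' h -> pullback h (ket i) = ket (h' i).
Proof.
move=> hK h'K; apply: l2_ext => j; rewrite pullbackE ?ketE; last exact: can_inj hK.
by rewrite (can2_eq hK h'K).
Qed.

Lemma restrict_ket I (p : pred I) i : l2_restrict p (ket i) = (p i)%:R *: ket i.
Proof.
apply: l2_ext => j; rewrite restrictE l2EZ ketE.
by case: eqP => [->//|]; rewrite !mulr0.
Qed.

Lemma inner_pullback I J (h : J -> I) (h' : I -> J) f g :
  cancel h h' -> cancel h' h -> inner (pullback h f) g = inner f (pullback h' g).
Proof.
move=> hK h'K; have hI := can_inj hK; have h'I := can_inj h'K.
apply: usum_unique (inner_usum _ _) _.
rewrite -(usum_bij _ _ (Bijective h'K hK)).
have := inner_usum f (pullback h' g).
by congr usum; apply/funext => i /=; rewrite !pullbackE// h'K.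
Qed.

Lemma inner_restrict I (p : pred I) f g : inner (l2_restrict p f) g = inner f (l2_restrict p g).
Proof.
apply: usum_unique (inner_usum _ _) _; have := inner_usum f (l2_restrict p g).
congr usum; apply/funext => i; rewrite !restrictE.
by case: (p i); rewrite ?mul1r// !mul0r rmorph0 mulr0.
Qed.

Lemma tensorE I J (f : l2 R I) (g : l2 R J) i j : (f \ox g) (i, j) = f i * g j.
Proof. by []. Qed.

Lemma ket_tensor I J (i : I) (j : J) : ket i \ox ket j = ket (i, j) :> l2 R _.
Proof.
apply: l2_ext => -[k l]; rewrite tensorE !ketE xpair_eqE.
by case: eqP; rewrite /= ?mul1r ?mul0r.
Qed.

Lemma tensor_le I J (f : l2 R I) (g : l2 R J) : l2norm (f \ox g) <= l2norm f * l2norm g.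
Proof.
apply: l2norm_bound => [|A]; first by rewrite mulr_ge0 ?l2norm_ge0.
pose B := [fset p.1 | p in A]%fset; pose C := [fset p.2 | p in A]%fset.
apply: (@le_trans _ _ (\sum_(p <- enum_fset (B `*` C)%fset) Normc.normc ((f \ox g) p) ^+ 2)).
  apply: ler_sum_fset => [p|]; first exact: sqr_ge0.
  apply/fsubsetP => p pA; rewrite in_fsetM.
  by apply/andP; split; apply/imfsetP; exists p.
rewrite sum_fsetM exprMn.
apply: le_trans (ler_pM _ _ (l2norm_sum_le f B) (l2norm_sum_le g C)).
- rewrite mulr_suml; apply: ler_sum => i _; rewrite mulr_sumr; apply: ler_sum => j _.
  by rewrite tensorE Normc.normcM exprMn.
- by apply: sumr_ge0 => i _; exact: sqr_ge0.
- by apply: sumr_ge0 => i _; exact: sqr_ge0.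
Qed.

Lemma tensor_boundedr I J (f : l2 R I) : bounded_op (fun g : l2 R J => f \ox g).
Proof.
apply: bounded_opI (tensor_le f) => c g h.
by apply: l2_ext => -[i j]; rewrite l2ED l2EZ !tensorE l2ED l2EZ mulrDr mulrCA.
Qed.

Lemma tensor_boundedl I J (g : l2 R J) : bounded_op (fun f : l2 R I => f \ox g).
Proof.
apply: (@bounded_opI _ _ _ _ (l2norm g)) => [c f h|f]; last by rewrite mulrC tensor_le.
by apply: l2_ext => -[i j]; rewrite l2ED l2EZ !tensorE l2ED l2EZ mulrDl mulrA.
Qed.

Lemma tensor_ext I J K (x y : l2 R (I * J)%type -> l2 R K) :
  bounded_op x -> bounded_op y -> (forall f g, x (f \ox g) = y (f \ox g)) -> x = y.
Proof.
by move=> xb yb xy; apply: bounded_ext => // -[i j]; rewrite -ket_tensor.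
Qed.

(** Bounded operators that agree on simple tensors agree on kets, so the choice made by [xget] is
    forced as soon as one candidate exists. *)
Lemma optensorE I I' J J' (x : l2 R I -> l2 R I') (y : l2 R J -> l2 R J') z :
  bounded_op z -> (forall f g, z (f \ox g) = x f \ox y g) -> optensor x y = z.
Proof.
move=> zb zE; rewrite /optensor; case: xgetP => [w _ [wb wE]|/(_ z)/not_andP[]//].
by apply: tensor_ext => // f g; rewrite wE zE.
Qed.

Lemma adjointE I J (x : l2 R I -> l2 R J) y :
  (forall f g, inner (x f) g = inner f (y g)) -> adjoint x = y.
Proof.
move=> xy; rewrite /adjoint; case: xgetP => [w _ xw|/(_ y)//].
apply/funext => g; apply: inner_eq => h.
by rewrite !(inner_conj h) -xw -xy.
Qed.

Lemma adjoint_pullback I J (h : J -> I) (h' : I -> J) :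
  cancel h h' -> cancel h' h -> adjoint (pullback h) = pullback h'.
Proof. by move=> hK h'K; apply: adjointE => f g; exact: inner_pullback. Qed.

Lemma adjoint_restrict I (p : pred I) : adjoint (l2_restrict p) = l2_restrict p.
Proof. by apply: adjointE => f g; exact: inner_restrict. Qed.

End constructions.

(** * Unitary matrices *)

Section unitary_matrix.
Context {R : realType} {T I : choiceType}.
Variable F : T -> l2 R I.
Hypothesis Fo : forall s t, inner (F s) (F t) = (s == t)%:R.

Lemma bessel f (A : {fset T}) :
  \sum_(t <- enum_fset A) Normc.normc (inner f (F t)) ^+ 2 <= l2norm f ^+ 2.
Proof.
set S := \sum_(t <- _) _; pose g := \sum_(t <- enum_fset A) inner f (F t) *: F t.
have gh h : inner g h = \sum_(t <- enum_fset A) inner f (F t) * inner (F t) h.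
  by rewrite inner_suml; apply: eq_bigr => t _; rewrite innerZl.
have SE : S%:C = \sum_(t <- enum_fset A) inner f (F t) * (inner f (F t))^*%C.
  by rewrite rmorph_sum; apply: eq_bigr => t _; rewrite normc_sqr.
have gf : inner g f = S%:C.
  by rewrite gh SE; apply: eq_bigr => t _; rewrite -inner_conj.
have gg : inner g g = S%:C.
  rewrite gh SE big_seq [RHS]big_seq; apply: eq_bigr => t tA; congr (_ * _).
  rewrite inner_conj gh; congr (_^*%C).
  rewrite (big_fsetD1 t)// Fo eqxx mulr1 big_seq big1 => [|s]; first by rewrite /= addr0.
  by rewrite !inE Fo => /andP[/negPf-> _]; rewrite mulr0.
have : 0 <= l2norm (f - g) ^+ 2 by exact: sqr_ge0.
rewrite -lecR -inner_norm innerDl !innerDr !innerNl !innerNr gg gf.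
by rewrite (inner_conj g f) gf /= inner_norm oppr0 subrr addr0 -rmorphB lecR subr_ge0.
Qed.

Definition coords (f : l2 R I) : l2 R T := insubd 0 (fun t => inner f (F t)).

Lemma coordsE f t : coords f t = inner f (F t).
Proof.
rewrite /coords val_insubd.
have -> // : (fun t => inner f (F t)) \in @square_summable R T.
by apply/square_summableP; exists (l2norm f ^+ 2); apply/sqnorm_leP; exact: bessel.
Qed.

Lemma coords_bounded : bounded_op coords.
Proof.
apply: (@bounded_opI _ _ _ _ 1) => [c f g|f].
  by apply: l2_ext => t; rewrite l2ED l2EZ !coordsE innerDl innerZl.
rewrite mul1r; apply: l2norm_bound (l2norm_ge0 _) _ => A.
rewrite (eq_bigr (fun t => Normc.normc (inner f (F t)) ^+ 2)) => [|t _]; rewrite ?coordsE//.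
exact: bessel.
Qed.

Lemma coords_F t : coords (F t) = ket t.
Proof. by apply: l2_ext => s; rewrite coordsE Fo ketE eq_sym. Qed.

End unitary_matrix.

Section unitary_matrix2.
Context {R : realType} {T I : choiceType}.
Variables (F : T -> l2 R I) (G : I -> l2 R T).
Hypothesis Fo : forall s t, inner (F s) (F t) = (s == t)%:R.
Hypothesis Go : forall i j, inner (G i) (G j) = (i == j)%:R.
Hypothesis FG : forall i t, G i t = (F t i)^*%C.

Lemma coords_ket i : coords F (ket i) = G i.
Proof. by apply: l2_ext => t; rewrite coordsE// inner_ketl FG. Qed.

Lemma coords_ket' t : coords G (ket t) = F t.
Proof. by apply: l2_ext => i; rewrite coordsE// inner_ketl FG conjcK. Qed.

(** Orthonormality of [G] acts as completeness of [F]: [coords F] sends [ket i] to the column [G i],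
    which [coords G] sends back to [ket i]. The density of the span of [F] is then a consequence. *)
Lemma coords_comp : coords G \o coords F = idfun.
Proof.
apply: bounded_ext => [||i].
- by apply: bounded_comp; exact: coords_bounded.
- exact: bounded_id.
- by rewrite /= coords_ket coords_F.
Qed.

Lemma coordsK : cancel (coords F) (coords G).
Proof. by move=> f; rewrite -[RHS]/(idfun f) -coords_comp. Qed.

Lemma inner_coords f h : inner (coords F f) h = inner f (coords G h).
Proof.
have [W Wl] := (coords_bounded Fo, coords_bounded Go).
apply: usum_unique (_ : usum (fun i => inner (f i *: coords F (ket i)) h) _) _.
  have := usum_inner h (bounded_usum W (ket_usum f)).
  by congr usum; apply/funext => i; rewrite linEZ//; case: W.
have := inner_usum f (coords G h); congr usum; apply/funext => i.
rewrite innerZl; congr (_ * _).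
by rewrite coordsE// coords_ket -inner_conj.
Qed.

End unitary_matrix2.

Section unitary_matrix3.
Context {R : realType} {T I : choiceType}.
Variables (F : T -> l2 R I) (G : I -> l2 R T).
Hypothesis Fo : forall s t, inner (F s) (F t) = (s == t)%:R.
Hypothesis Go : forall i j, inner (G i) (G j) = (i == j)%:R.
Hypothesis FG : forall i t, G i t = (F t i)^*%C.

Let GF i t : F t i = (G i t)^*%C. Proof. by rewrite FG conjcK. Qed.

Lemma coordsK' : cancel (coords G) (coords F).
Proof. exact: coordsK. Qed.

Lemma coords_unitary : unitary (coords F).
Proof.
split; first by have [] := coords_bounded Fo.
- by move=> f g; rewrite (inner_coords Fo Go FG) (coordsK Fo Go FG).
- by move=> h; exists (coords G h); exact: coordsK'.
Qed.

Lemma adjoint_coords : adjoint (coords F) = coords G.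
Proof. by apply: adjointE => f g; exact: inner_coords. Qed.

Lemma closure_usum (V : normedModType R[i]) (S : choiceType) (u : S -> V) s (A : set V) :
  usum u s -> (forall B : {fset S}, A (\sum_(i <- enum_fset B) u i)) -> closure A s.
Proof.
move=> [us] uA; rewrite closureEcvg.
exists (\sum_(i <- enum_fset B) u i @[B --> @fin_net S]); [exact: fmap_proper_filter|split=> //].
move=> P /= AP; apply/fin_netP; exists fset0 => B _; apply: AP; exact: uA.
Qed.

Lemma coords_basis : closure (span (range F)) = setT.
Proof.
apply/seteqP; split=> // f _.
have := bounded_usum (coords_bounded Go) (ket_usum (coords F f)).
rewrite (coordsK Fo Go FG) => fs; apply: closure_usum fs _ => B.
exists #|` B|, (fun k => coords F f (tnth (in_tuple (enum_fset B)) k)),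
  (fun k => F (tnth (in_tuple (enum_fset B)) k)); split=> [k|]; first by exists (tnth (in_tuple (enum_fset B)) k).
rewrite big_tnth; apply: eq_bigr => k _.
rewrite linEZ; last by have [] := coords_bounded Go.
by rewrite (coords_ket' Go FG).
Qed.

End unitary_matrix3.

(** * Hahn-Exton q-Bessel functions *)

Lemma usum_mull {R : realType} {T : choiceType} (c : R) (f : T -> R) s :
  usum f s -> usum (fun i => c * f i) (c * s).
Proof. exact: usumZ. Qed.

(** * Domination by geometric series *)

Section geometric.
Context {R : realType}.
Variable q : R.
Hypothesis q01 : 0 < q < 1.

(** The cut-off at zero makes [geo] a majorant on all of [int] for the series below, whose terms
    carry [ipoch] and vanish at negative indices. *)
Definition geo (k : int) : R := if 0 <= k then q ^ k else 0.

Lemma geo_ge0 k : 0 <= geo k.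
Proof. by rewrite /geo; case: ifP => // _; rewrite exprz_ge0// ltW//; case/andP: q01. Qed.

Lemma geo_le1 k : geo k <= 1.
Proof.
case/andP: q01 => q0 q1; case: k => n; rewrite /geo/= ?ler01//.
by rewrite -exprnP exprn_ile1// ltW.
Qed.

Lemma geo_usum : exists2 G, 0 <= G & usum geo G.
Proof.
case/andP: q01 => q0 q1.
have [|A|G hG] := @usum_nneg R nat (fun n => q ^+ n) (1 - q)^-1.
- by move=> n; rewrite exprn_ge0 ?ltW.
- have [N AN] : exists N, forall i, i \in A -> (i < N)%N.
    by exists (\max_(i <- enum_fset A) i).+1 => i iA; rewrite ltnS; exact: leq_bigmax_seq.
  have sub : (A `<=` [fset i in iota 0 N])%fset.
    by apply/fsubsetP => i iA; rewrite !inE mem_iota/= AN.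
  have q0n n : 0 <= q ^+ n by rewrite exprn_ge0 ?ltW.
  apply: le_trans (ler_sum_fset q0n sub) _.
  have -> : \sum_(i <- enum_fset [fset i in iota 0 N]%fset) q ^+ i = \sum_(0 <= i < N) q ^+ i.
    rewrite /index_iota subn0; apply: perm_big; apply: uniq_perm.
    - exact: fset_uniq.
    - exact: iota_uniq.
    - by move=> i; rewrite !inE.
  have q1' : 0 < 1 - q by rewrite subr_gt0.
  rewrite -(ler_pM2l q1') mulfV ?gt_eqF// big_mkord -opprB mulNr -subrX1 opprB.
  by rewrite lerBlDr lerDl exprn_ge0 ?ltW.
exists G; first by apply: usum_ge0 hG => n; rewrite exprn_ge0 ?ltW.
apply/(usum_inj G (h := Posz)) => [m n []//|[n /(_ n)//|n _]|//].
by rewrite /geo.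
Qed.

Lemma usum_geo (f : int -> R) C : (forall k, `|f k| <= C * geo k) -> exists s, usum f s.
Proof.
by move=> fC; have [G _ /(usumZ C) hG] := geo_usum; apply: usum_cmp hG.
Qed.

Lemma usum_geo_le (f : int -> R) C s G : (forall k, `|f k| <= C * geo k) ->
  usum f s -> usum geo G -> `|s| <= C * G.
Proof.
move=> fC fs hG; apply: usum_le_norm fs _ => A.
rewrite (le_trans (ler_norm_sum _ _ _))//.
rewrite (le_trans (ler_sum _ (fun i _ => fC i)))//.
apply: usum_ge_sum (usumZ C hG) => i; exact: le_trans (normr_ge0 _) (fC i).
Qed.

Lemma usum_geo2 (F : int * int -> R) C :
  (forall k l, `|F (k, l)| <= C * (geo k * geo l)) -> exists s, usum F s.
Proof.
move=> FC; have [G G0 hG] := geo_usum.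
have C0 : 0 <= C by have := le_trans (normr_ge0 _) (FC 0 0); rewrite /geo/= expr0z mulr1 mulr1.
apply: (@usum_abs _ _ _ (C * (G * G))) => A.
pose B1 := [fset p.1 | p in A]%fset; pose B2 := [fset p.2 | p in A]%fset.
apply: (@le_trans _ _ (\sum_(p <- enum_fset (B1 `*` B2)%fset) `|F p|)).
  apply: ler_sum_fset => // ; apply/fsubsetP => p pA; rewrite in_fsetM.
  by apply/andP; split; apply/imfsetP; exists p.
rewrite sum_fsetM.
apply: (@le_trans _ _ (\sum_(k <- enum_fset B1) \sum_(l <- enum_fset B2) C * (geo k * geo l))).
  by apply: ler_sum => k _; apply: ler_sum => l _.
under eq_bigr do rewrite -!mulr_sumr.
rewrite -mulr_sumr ler_wpM2l// -mulr_suml ler_pM ?sumr_ge0// => [k _|l _||].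
- exact: geo_ge0.
- exact: geo_ge0.
- by apply: usum_ge_sum hG; exact: geo_ge0.
- by apply: usum_ge_sum hG; exact: geo_ge0.
Qed.

End geometric.

(** * q-Bessel series and their symmetry *)

Section qseries.
Context {R : realType}.
Variable q : R.
Hypothesis q01 : 0 < q < 1.
Let Q := q ^+ 2.
Let q0 : 0 < q. Proof. by case/andP: q01. Qed.
Let q1 : q < 1. Proof. by case/andP: q01. Qed.
Let qn0 : q != 0. Proof. by rewrite gt_eqF. Qed.
Let Q0 : 0 < Q. Proof. exact: exprn_gt0. Qed.
Let Q1 : Q < 1. Proof. by rewrite expr_lt1// ltW. Qed.

(* 1 / (q^2; q^2)_k, extended by zero to k < 0. *)
Definition ipoch (k : int) : R :=
  if k is Posz n then (qpoch (q ^+ 2) (q ^+ 2) n)^-1 else 0.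

Lemma qpoch_gt0 n : 0 < qpoch Q Q n.
Proof.
by apply: prodr_gt0 => k _; rewrite subr_gt0 -exprSr exprn_ilt1// ltW.
Qed.

Lemma qpochS a n : qpoch a Q n.+1 = qpoch a Q n * (1 - Q ^+ n * a).
Proof. by rewrite /qpoch big_ord_recr. Qed.

Lemma ipoch0 : ipoch 0 = 1.
Proof. by rewrite /ipoch /= /qpoch big_ord0 invr1. Qed.

Lemma ipoch_rec k : (1 - q ^ (2 * k)) * ipoch k = ipoch (k - 1).
Proof.
case: k => [[|n]|n]; rewrite ?mulr0 ?expr0z ?subrr ?mul0r//.
have -> : (n.+1%:Z - 1) = n by lia.
have -> : q ^ (2 * n.+1%:Z) = Q ^+ n * Q by rewrite -exprSr -exprM.
rewrite /ipoch qpochS invfM mulrCA mulfV ?mulr1// gt_eqF//.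
by rewrite subr_gt0 -exprSr exprn_ilt1// ltW.
Qed.

Lemma ipoch_ge0 k : 0 <= ipoch k.
Proof. by case: k => n //=; rewrite invr_ge0 ltW// qpoch_gt0. Qed.

(** Each factor satisfies [1/(1 - Q^(n+1)) <= 1 + Q^n/(1 - Q) <= exp(Q^n/(1 - Q))], and the
    exponents add up to at most [(1 - Q)^-2]. *)
Lemma ipoch_bounded : exists2 C, 0 < C & forall k, ipoch k <= C.
Proof.
pose C := expR ((1 - Q)^-1 * (1 - Q)^-1); exists C; first exact: expR_gt0.
case=> n /=; last by rewrite ltW// expR_gt0.
have Q1' : 0 < 1 - Q by rewrite subr_gt0.
have E : (qpoch Q Q n)^-1 <= expR ((1 - Q)^-1 * \sum_(k < n) Q ^+ k).
  elim: n => [|n IHn]; first by rewrite /qpoch !big_ord0 mulr0 expR0 invr1.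
  rewrite qpochS big_ord_recr/= invfM mulrDr expRD ler_pM//.
  - by rewrite invr_ge0 ltW// qpoch_gt0.
  - by rewrite invr_ge0 subr_ge0 -exprSr exprn_ile1// ltW.
  apply: le_trans (expR_ge1Dx _).
  have Qn : 0 <= Q ^+ n by rewrite exprn_ge0// ltW.
  have Qn1 : Q ^+ n <= 1 by rewrite exprn_ile1// ltW.
  have d0 : 0 < 1 - Q ^+ n * Q.
    by rewrite subr_gt0 -exprSr exprn_ilt1// ltW.
  rewrite -[leLHS]mul1r ler_pdivrMr//.
  set z := Q ^+ n in Qn Qn1 *; set i := (1 - Q)^-1.
  have iQ : i * (1 - Q) - 1 = 0 by rewrite mulVf ?subrr// gt_eqF.
  rewrite -subr_ge0 (_ : _ - 1 =
    i * z * ((1 - Q) ^+ 2 + Q * (1 - z)) + z * Q * (i * (1 - Q) - 1)); last by ring.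
  rewrite iQ mulr0 addr0 !mulr_ge0 ?invr_ge0 ?(ltW Q1')// addr_ge0 ?sqr_ge0//.
  by rewrite mulr_ge0 ?(ltW Q0)// subr_ge0.
apply: le_trans E _; rewrite ler_expR ler_wpM2l ?invr_ge0 ?(ltW Q1')//.
rewrite -(ler_pM2l Q1') mulfV ?gt_eqF// -opprB mulNr -subrX1 opprB.
by rewrite lerBlDr lerDl exprn_ge0 ?ltW.
Qed.

Lemma ler_q (a b : int) : b <= a -> q ^ a <= q ^ b.
Proof.
move=> ba; rewrite -(subrK b a) expfzDr// ler_piMl//; first by rewrite ltW// exprz_gt0.
have : 0 <= a - b by rewrite subr_ge0.
by case: (a - b) => // n _; rewrite -exprnP exprn_ile1// ltW.
Qed.

Lemma ltr0q (a : int) : 0 < q ^ a.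
Proof. exact: exprz_gt0. Qed.

Lemma normq (a : int) : `|q ^ a| = q ^ a.
Proof. by rewrite gtr0_norm// ltr0q. Qed.

Lemma normN1 (a : int) : `|(-1 : R) ^ a| = 1.
Proof. by rewrite expN1r normrX normrN1 expr1n. Qed.

Lemma N1D (a b : int) : (-1 : R) ^ (a + b) = (-1) ^ a * (-1) ^ b.
Proof. by rewrite expfzDr// oppr_eq0 oner_eq0. Qed.

Lemma N1V (a : int) : (-1 : R) ^ (- a) = (-1) ^ a.
Proof. by rewrite -exprz_inv invrN1. Qed.

(** The terms of Euler's series for [(q^(2j+2); q^2)_oo]. The value is never compared with the
    infinite product here; the recurrence [euler_rec] carries all that is used. *)
Definition eulerT (j l : int) : R := (-1) ^ l * q ^ (l * (l + 1) + 2 * j * l) * ipoch l.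

Definition euler (j : int) : R := unordered_sum setT (eulerT j).

Definition besselT (t n k : int) : R :=
  (-1) ^ k * q ^ (k * (k + 1) + 2 * n * k) * ipoch k * ipoch (t + k).

(* Up to the factor z^t, Jackson's third q-Bessel function of order t for the
   base q^2, at z = q^n. *)
Definition qbessel (t n : int) : R := unordered_sum setT (besselT t n).

(** Completing the square, [k(k+1) + 2jk = (k+j)^2 + k - j^2], leaves the geometric factor [q^k] and
    the constant [q^(-j^2)]. *)
Lemma geo_gauss C (j k : int) (x : R) : 0 <= C -> (k < 0 -> x = 0) -> `|x| <= C ->
  `|q ^ (k * (k + 1) + 2 * j * k) * x| <= C * q ^ (- (j * j)) * geo q k.
Proof.
move=> C0 x0 xC; rewrite /geo; case: (leP 0 k) => k0; last by rewrite x0 ?mulr0 ?normr0.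
rewrite normrM normq [leLHS]mulrC -[leRHS]mulrA -expfzDr// ler_pM// ?(ltW (ltr0q _))//.
apply: ler_q; rewrite -subr_ge0.
by rewrite (_ : _ - _ = (k + j) ^+ 2) ?sqr_ge0//; ring.
Qed.

Lemma ipochN k : k < 0 -> ipoch k = 0.
Proof. by case: k. Qed.

Let C := projT1 (cid2 ipoch_bounded).
Let C_gt0 : 0 < C. Proof. by rewrite /C; case: cid2. Qed.
Let ipoch_le k : `|ipoch k| <= C.
Proof. by rewrite /C; case: cid2 => c c0 cP /=; rewrite ger0_norm ?ipoch_ge0. Qed.

Lemma ipochM_le k l : `|ipoch k * ipoch l| <= C * C.
Proof. by rewrite normrM ler_pM. Qed.

Lemma eulerT_le j k : `|eulerT j k| <= C * q ^ (- (j * j)) * geo q k.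
Proof.
rewrite /eulerT -[X in `|X|]mulrA normrM normN1 mul1r; apply: geo_gauss => //.
- exact: ltW.
- exact: ipochN.
Qed.

Lemma eulerP j : usum (eulerT j) (euler j).
Proof.
have [s hs] := usum_geo q01 (eulerT_le j).
suff -> : euler j = s by [].
by apply: unordered_sumE; under eq_fun do rewrite in_setT.
Qed.

Lemma besselT_le t n k : `|besselT t n k| <= C * C * q ^ (- (n * n)) * geo q k.
Proof.
rewrite /besselT -[X in `|X|]mulrA -[X in `|X|]mulrA normrM normN1 mul1r; apply: geo_gauss.
- by rewrite mulr_ge0// ltW.
- by move=> k0; rewrite ipochN ?mul0r.
- exact: ipochM_le.
Qed.

Lemma qbesselP t n : usum (besselT t n) (qbessel t n).
Proof.
have [s hs] := usum_geo q01 (besselT_le t n).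
suff -> : qbessel t n = s by [].
by apply: unordered_sumE; under eq_fun do rewrite in_setT.
Qed.

(** Replacing [n] by [n + 1] multiplies the [k]-th term by [q^(2k)], which supplies the factor
    [1 - q^(2(t+1+k))] of [ipoch_rec]. *)
Lemma qbessel_rec t n :
  qbessel (t + 1) n - q ^ (2 * t + 2) * qbessel (t + 1) (n + 1) = qbessel t n.
Proof.
apply: usum_unique (qbesselP t n).
have := usumB (qbesselP (t + 1) n) (usumZ (q ^ (2 * t + 2)) (qbesselP (t + 1) (n + 1))).
congr usum; apply/funext => k; rewrite /besselT.
have -> : q ^ (k * (k + 1) + 2 * (n + 1) * k) = q ^ (k * (k + 1) + 2 * n * k) * q ^ (2 * k).
  by rewrite -expfzDr//; congr (_ ^ _); ring.
have -> : ipoch (t + k) = (1 - q ^ (2 * t + 2) * q ^ (2 * k)) * ipoch (t + 1 + k).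
  rewrite -expfzDr// (_ : 2 * t + 2 + 2 * k = 2 * (t + 1 + k)); last by ring.
  by rewrite ipoch_rec; congr ipoch; ring.
by rewrite /GRing.scale/=; ring.
Qed.

Lemma euler_rec j : euler (j - 1) = (1 - q ^ (2 * j)) * euler j.
Proof.
have sh : usum (fun l => q ^ (2 * j) * eulerT j (l - 1)) (q ^ (2 * j) * euler j).
  apply: usumZ; apply/(usum_bij (eulerT j) (euler j) (h := fun l : int => l - 1)).
    by exists (fun l => l + 1) => l; rewrite ?subrK ?addrK.
  exact: eulerP.
apply: usum_unique (eulerP _) _; rewrite mulrBl mul1r.
have := usumB (eulerP j) sh; congr usum; apply/funext => l; rewrite /eulerT.
rewrite -ipoch_rec.
have -> : q ^ (l * (l + 1) + 2 * j * l) = q ^ (l * (l + 1) + 2 * (j - 1) * l) * q ^ (2 * l).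
  by rewrite -expfzDr//; congr (_ ^ _); ring.
have -> : (-1 : R) ^ (l - 1) = - (-1) ^ l by rewrite N1D N1V expr1z mulrN1.
have E : q ^ (2 * j) * q ^ ((l - 1) * (l - 1 + 1) + 2 * j * (l - 1)) =
    q ^ (l * (l + 1) + 2 * (j - 1) * l).
  by rewrite -expfzDr//; congr (_ ^ _); ring.
by rewrite -E; ring.
Qed.

(** The factor [1 - q^(2j)] of [euler_rec] vanishes at [j = 0], and the zero propagates
    downwards. *)
Lemma eulerN n : euler (Negz n) = 0.
Proof.
elim: n => [|n IHn].
  by have := euler_rec 0; rewrite mulr0 expr0z subrr mul0r.
have -> : Negz n.+1 = Negz n - 1 by lia.
by rewrite euler_rec IHn mulr0.
Qed.

Lemma euler_ipoch j : euler j = euler 0 * ipoch j.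
Proof.
case: j => n; last by rewrite eulerN mulr0.
elim: n => [|n IHn]; first by rewrite /ipoch /qpoch big_ord0 invr1 mulr1.
have u0 : 1 - q ^ (2 * n.+1%:Z) != 0.
  have -> : q ^ (2 * n.+1%:Z) = q ^+ (2 * n.+1)%N by [].
  by rewrite gt_eqF// subr_gt0 exprn_ilt1// ltW.
apply: (mulfI u0); rewrite -euler_rec mulrCA ipoch_rec.
by have -> : n.+1%:Z - 1 = n by lia.
Qed.

(** Otherwise [euler_ipoch] would make every [euler n] vanish, whereas [euler n] tends to 1: its
    term at [l = 0] is 1 and the remaining ones are dominated by [q^n] times a convergent series. *)
Lemma euler0_neq0 : euler 0 != 0.
Proof.
apply/negP => /eqP h0.
have [G G0 hG] := geo_usum q01.
have H (n : nat) : 1 <= q ^ n%:Z * (C * G).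
  pose f (l : int) : R := if l == 0 then 1 else 0.
  have e0 : usum f 1 by rewrite -[1 in X in usum _ X]/(f 0); apply: usum1 => i /negPf i0; rewrite /f i0.
  have := usumB e0 (eulerP n); rewrite euler_ipoch h0 mul0r subr0 => U.
  rewrite -[leLHS]normr1; rewrite mulrA; apply: usum_geo_le U hG => k.
  rewrite /f; case: eqP => [->|/eqP k0].
    rewrite /eulerT !mulr0 !mul0r addr0 !expr0z !mul1r ipoch0 subrr normr0.
    by rewrite !mulr_ge0 ?geo_ge0 ?(ltW C_gt0) ?(ltW (ltr0q _)).
  rewrite sub0r normrN /eulerT -mulrA normrM normN1 mul1r normrM normq /geo.
  case: (leP 0 k) => k1; last by rewrite ipochN// normr0 !mulr0.
  rewrite [leRHS]mulrAC -expfzDr//; apply: ler_pM => //; first exact: ltW (ltr0q _).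
  have {}k1 : 1 <= k by lia.
  apply: ler_q; rewrite -subr_ge0.
  have -> : k * (k + 1) + 2 * Posz n * k - (Posz n + k) = k * k + Posz n * (2 * k - 1) by ring.
  by rewrite addr_ge0// mulr_ge0//; lia.
have [N HN] : exists N : nat, q ^+ N * (C * G) < 1.
  have := cvg_expr (_ : `|q| < 1); rewrite ger0_norm ?ltW// => /(_ q1)/cvgrPdist_lt.
  have CG : 0 < C * G + 1 by rewrite ltr_wpDl// mulr_ge0// ltW.
  move=> /(_ (C * G + 1)^-1); rewrite invr_gt0 => /(_ CG)[N _ /(_ N (leqnn _))]/=.
  rewrite sub0r normrN ger0_norm ?exprn_ge0 ?ltW// => qN; exists N.
  apply: (@le_lt_trans _ _ (q ^+ N * (C * G + 1))); last by rewrite -ltr_pdivlMr// div1r.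
  by rewrite ler_wpM2l ?lerDl// exprn_ge0 ?ltW.
by have := H N; rewrite -exprnP leNgt HN.
Qed.

(** The factor [q^(2kl)] couples two Euler series. Summed over the second index, the family gives
    [euler 0 * qbessel t n]; as it is invariant under exchanging both [n] with [t] and the two
    indices, [qbessel] is symmetric. *)
Definition eulerT2 (t n : int) (p : int * int) : R :=
  eulerT n p.1 * eulerT t p.2 * q ^ (2 * p.1 * p.2).

Lemma eulerT2_sum t n : exists s, usum (eulerT2 t n) s.
Proof.
apply: (@usum_geo2 _ q q01 _ (C * q ^ (- (n * n)) * (C * q ^ (- (t * t))))) => k l.
rewrite /eulerT2 /= normrM normq (normrM (eulerT n k)).
have [k0|k0] := ltP k 0.
  by rewrite {1}/eulerT ipochN// mulr0 normr0 !mul0r !mulr_ge0 ?geo_ge0 ?(ltW C_gt0) ?(ltW (ltr0q _)).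
have [l0|l0] := ltP l 0.
  by rewrite {2}/eulerT [ipoch l]ipochN// !mulr0 normr0 mulr0 !mul0r !mulr_ge0 ?geo_ge0 ?(ltW C_gt0) ?(ltW (ltr0q _)).
rewrite -[leRHS]mulr1 ler_pM ?mulr_ge0 ?(ltW (ltr0q _))//.
  by rewrite [leRHS]mulrACA; apply: ler_pM => //; exact: eulerT_le.
rewrite -[leRHS](expr0z q); apply: ler_q; nia.
Qed.

Lemma euler_qbessel t n s : usum (eulerT2 t n) s -> s = euler 0 * qbessel t n.
Proof.
move=> hs; apply: (usum_unique (f := fun k => euler 0 * besselT t n k)); last first.
  exact: usumZ (qbesselP t n).
apply: usum_fubini hs _ => /= k.
have -> : euler 0 * besselT t n k = eulerT n k * euler (t + k).
  by rewrite (euler_ipoch (t + k)) /besselT /eulerT; ring.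
have := usumZ (eulerT n k) (eulerP (t + k)); congr usum; apply/funext => /= l.
rewrite /eulerT2 /= /GRing.scale/= -mulrA; congr (_ * _); rewrite /eulerT.
have -> : q ^ (l * (l + 1) + 2 * (t + k) * l) = q ^ (l * (l + 1) + 2 * t * l) * q ^ (2 * k * l).
  by rewrite -expfzDr//; congr (_ ^ _); ring.
ring.
Qed.

Lemma qbessel_sym t n : qbessel t n = qbessel n t.
Proof.
have [s hs] := eulerT2_sum t n.
apply: (mulfI euler0_neq0); rewrite -(euler_qbessel hs); apply: euler_qbessel.
apply/(usum_bij _ _ (h := fun p : int * int => (p.2, p.1))).
  by exists (fun p => (p.2, p.1)) => -[].
by move: hs; congr usum; apply/funext => -[k l]; rewrite /eulerT2/=; congr (_ * _); [ring|congr (_ ^ _); ring].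
Qed.

(* The matrix entry of P0 on the diagonal p - w = n of the block v - w = t. *)
Definition pcoef (t n : int) : R := (-1) ^ n * q ^ (n * (1 + t)) * qbessel t n.

Lemma pcoef_rec t n : q ^ t * pcoef (t + 1) (n + 1) + pcoef (t + 1) n = q ^ n * pcoef t n.
Proof.
rewrite /pcoef -(qbessel_rec t n) N1D expr1z.
have -> : q ^ (n * (1 + (t + 1))) = q ^ n * q ^ (n * (1 + t)).
  by rewrite -expfzDr//; congr (_ ^ _); ring.
have E : q ^ t * q ^ ((n + 1) * (1 + (t + 1))) = q ^ n * q ^ (n * (1 + t)) * q ^ (2 * t + 2).
  by rewrite -!expfzDr//; congr (_ ^ _); ring.
rewrite (_ : q ^ t * _ = - (-1) ^ n * (q ^ t * q ^ ((n + 1) * (1 + (t + 1)))) * qbessel (t + 1) (n + 1)).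
  by rewrite E; ring.
by ring.
Qed.

(** Shifting the summation index by [t] exchanges the two factors [ipoch k] and [ipoch (t + k)]. *)
Lemma pcoefN t n : pcoef (- t) n = pcoef t (n + t).
Proof.
have sh : usum (fun k => besselT (- t) n (k + t)) (qbessel (- t) n).
  apply/(usum_bij (besselT (- t) n) _ (h := fun k : int => k + t)).
    by exists (fun l => l - t) => l; rewrite ?subrK ?addrK.
  exact: qbesselP.
suff E : qbessel (- t) n = (-1) ^ t * q ^ (t * t + t + 2 * n * t) * qbessel t (n + t).
  rewrite /pcoef E N1D.
  have -> : q ^ ((n + t) * (1 + t)) = q ^ (n * (1 - t)) * q ^ (t * t + t + 2 * n * t).
    by rewrite -expfzDr//; congr (_ ^ _); ring.
  ring.
apply: usum_unique sh _.
have := usumZ ((-1) ^ t * q ^ (t * t + t + 2 * n * t)) (qbesselP t (n + t)).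
congr usum; apply/funext => k /=; rewrite /besselT /GRing.scale/= N1D.
have -> : q ^ ((k + t) * (k + t + 1) + 2 * n * (k + t)) =
    q ^ (t * t + t + 2 * n * t) * q ^ (k * (k + 1) + 2 * (n + t) * k).
  by rewrite -expfzDr//; congr (_ ^ _); ring.
rewrite (_ : - t + (k + t) = k) ?(addrC k t); [ring|ring].
Qed.

(** * Orthogonality within a Toeplitz block *)

Section convolution.
Variable t : int.
Hypothesis t0 : 0 <= t.

Let x (m : int) : R := (-1) ^ m * q ^ (m * (1 + t)) * ipoch m.
Let y (k : int) : R := q ^ (k * k + t * k) * ipoch k.

(** Here [t >= 0] enters: it gives [m(1+t) >= m] for [m >= 0], so that the Taylor series [x]
    converges absolutely on the unit circle. *)
Let x_le m : `|x m| <= C * geo q m.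
Proof.
rewrite /x -mulrA normrM normN1 mul1r normrM normq /geo mulrC.
case: (leP 0 m) => m0; last by rewrite ipochN// normr0 mul0r mulr0.
by rewrite ler_pM ?(ltW (ltr0q _)) ?ler_q//; nia.
Qed.

Let y_le m : `|y m| <= C * geo q m.
Proof.
rewrite /y normrM normq /geo mulrC.
case: (leP 0 m) => m0; last by rewrite ipochN// normr0 mul0r mulr0.
by rewrite ler_pM ?(ltW (ltr0q _)) ?ler_q//; nia.
Qed.

Let geoC_le m : C * geo q m <= C.
Proof. by rewrite ler_piMr ?geo_le1// ltW. Qed.

(** The series of [qbessel n t], rather than that of [qbessel t n], contains [ipoch (n + k)] and is
    therefore a convolution in [n]; this is the use of [qbessel_sym]. *)
Let pcoef_conv n : usum (fun k => x (n + k) * y k) (pcoef t n).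
Proof.
have := usumZ ((-1) ^ n * q ^ (n * (1 + t))) (qbesselP n t); rewrite -qbessel_sym.
congr usum; apply/funext => k /=; rewrite /besselT /x /y /GRing.scale/= N1D.
have -> : q ^ ((n + k) * (1 + t)) = q ^ (n * (1 + t)) * q ^ (k * (1 + t)).
  by rewrite -expfzDr//; congr (_ ^ _); ring.
have -> : q ^ (k * (k + 1) + 2 * t * k) = q ^ (k * (1 + t)) * q ^ (k * k + t * k).
  by rewrite -expfzDr//; congr (_ ^ _); ring.
ring.
Qed.

(* x and y are the Taylor coefficients of 1/(-q^(1+t)z;q^2)_oo and of its
   inverse. *)
Let xy m : usum (fun k => x (m - k) * y k) (m == 0)%:R.
Proof.
pose w (m k : int) : R := (-1) ^ k * q ^ (k * k - k) * ipoch k * ipoch (m - k).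
have w_le m' k : `|w m' k| <= C * C * q ^ (- (-1 * -1)) * geo q k.
  rewrite /w -2![X in `|X|]mulrA normrM normN1 mul1r.
  have -> : k * k - k = k * (k + 1) + 2 * -1 * k by ring.
  apply: geo_gauss.
  - by rewrite mulr_ge0// ltW.
  - by move=> k0; rewrite ipochN ?mul0r.
  - exact: ipochM_le.
have [s ws] := usum_geo q01 (w_le m).
(* [(1 - q^(2m)) * w m k] telescopes as [v k - v (k - 1)], so the sum of [w m] vanishes unless
   [m = 0]. *)
pose v (k : int) : R := (-1) ^ k * q ^ (k * k + k) * ipoch k * ipoch (m - 1 - k).
have v_le k : `|v k| <= C * C * q ^ (- (0 * 0)) * geo q k.
  rewrite /v -2![X in `|X|]mulrA normrM normN1 mul1r.
  have -> : k * k + k = k * (k + 1) + 2 * 0 * k by ring.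
  apply: geo_gauss.
  - by rewrite mulr_ge0// ltW.
  - by move=> k0; rewrite ipochN ?mul0r.
  - exact: ipochM_le.
have [u us] := usum_geo q01 v_le.
have us' : usum (fun k => v (k - 1)) u.
  apply/(usum_bij v u (h := fun k : int => k - 1)) => //.
  by exists (fun l => l + 1) => l; rewrite ?subrK ?addrK.
have wm : (1 - q ^ (2 * m)) * s = 0.
  rewrite -(subrr u); apply: usum_unique (usumZ (1 - q ^ (2 * m)) ws) _.
  have := usumB us us'; congr usum; apply/funext => k /=; rewrite /v /w /GRing.scale/=.
  rewrite (_ : m - 1 - (k - 1) = m - k); last by ring.
  rewrite (_ : m - 1 - k = m - k - 1); last by ring.
  rewrite -!ipoch_rec.
  have -> : (-1 : R) ^ (k - 1) = - (-1) ^ k by rewrite N1D N1V expr1z mulrN1.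
  have -> : (k - 1) * (k - 1) + (k - 1) = k * k - k by ring.
  have -> : q ^ (k * k + k) = q ^ (k * k - k) * q ^ (2 * k).
    by rewrite -expfzDr//; congr (_ ^ _); ring.
  have -> : q ^ (2 * m) = q ^ (2 * k) * q ^ (2 * (m - k)).
    by rewrite -expfzDr//; congr (_ ^ _); ring.
  ring.
have sE : s = (m == 0)%:R.
  case: eqP => [m0|/eqP m0].
    apply: usum_unique ws _; rewrite m0.
    have -> : 1%:R = w 0 0 by rewrite /w !mulr0 subr0 !expr0z ipoch0 !mulr1.
    apply: usum1 => k k0; rewrite /w sub0r.
    have [k1|k1] := ltP k 0; first by rewrite ipochN// mulr0 mul0r.
    by rewrite (@ipochN (- k)) ?mulr0//; lia.
  move/eqP : wm; rewrite mulf_eq0 => /orP[|/eqP//].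
  rewrite subr_eq0 eq_sym => /eqP qm.
  have : 2 * m = 0 by apply: (ieexprIz q0); rewrite ?lt_eqF// qm expr0z.
  by move/eqP; rewrite mulf_eq0/= (negPf m0).
have := usumZ ((-1) ^ m * q ^ (m * (1 + t))) ws.
rewrite sE; have -> : ((-1) ^ m * q ^ (m * (1 + t))) *: ((m == 0)%:R : R) = (m == 0)%:R.
  by case: eqP => [->|_]; rewrite /GRing.scale/= ?mul0r ?expr0z ?mulr1 ?mulr0.
congr usum; apply/funext => k /=; rewrite /w /x /y /GRing.scale/= N1D N1V.
have E : q ^ ((m - k) * (1 + t)) * q ^ (k * k + t * k) = q ^ (m * (1 + t)) * q ^ (k * k - k).
  by rewrite -!expfzDr//; congr (_ ^ _); ring.
rewrite (_ : _ * (q ^ (k * k + t * k) * _) = (-1) ^ m * (-1) ^ k *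
  (q ^ ((m - k) * (1 + t)) * q ^ (k * k + t * k)) * ipoch (m - k) * ipoch k); last by ring.
by rewrite E; ring.
Qed.

Let pcoef_bound : exists2 M, 0 <= M & forall n, `|pcoef t n| <= M.
Proof.
have [G G0 hG] := geo_usum q01.
exists (C * C * G); first by rewrite !mulr_ge0// ltW.
move=> n; apply: usum_geo_le (pcoef_conv n) hG => k.
rewrite normrM -mulrA ler_pM//; first exact: le_trans (x_le _) (geoC_le _).
Qed.

(** In generating functions: the symbol of [pcoef t] is [x(z) y(1/z)], and multiplying by [y(z)]
    leaves [y(1/z)] because [x(z) y(z) = 1]. *)
Let y_pcoef n : usum (fun k => y k * pcoef t (n - k)) (y (- n)).
Proof.
have [s hs] : exists s, usum (fun p : int * int => y p.1 * (x (n - p.1 + p.2) * y p.2)) s.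
  apply: (@usum_geo2 _ q q01 _ (C * C * C)) => k l /=; rewrite normrM [X in _ * X]normrM.
  have := le_trans (x_le (n - k + l)) (geoC_le _).
  set X := `|x _| => hX.
  rewrite [leLHS]mulrCA (_ : C * C * C * _ = C * ((C * geo q k) * (C * geo q l))); last by ring.
  by apply: ler_pM => //; [rewrite /X|apply: ler_pM].
have H : usum (fun k => y k * pcoef t (n - k)) s.
  by apply: usum_fubini hs _ => /= k; have := usum_mull (y k) (pcoef_conv (n - k)).
suff -> : y (- n) = s by [].
have hs' : usum (fun p : int * int => y p.2 * (x (n - p.2 + p.1) * y p.1)) s.
  apply/(usum_bij (fun p : int * int => y p.1 * (x (n - p.1 + p.2) * y p.2)) s (h := fun p : int * int => (p.2, p.1))) => //.
  by exists (fun p => (p.2, p.1)) => -[].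
have H' : usum (fun l => (n + l == 0)%:R * y l) s.
  apply: usum_fubini hs' _ => /= l.
  have := usumZ (y l) (xy (n + l)); rewrite /GRing.scale/= mulrC.
  congr usum; apply/funext => k /=.
  by rewrite (_ : n + l - k = n - k + l); ring.
apply: usum_unique H'; have -> : y (- n) = (n + - n == 0)%:R * y (- n) by rewrite subrr eqxx mul1r.
apply: (usum1 (f := fun l : int => (n + l == 0)%:R * y l)) => l ln.
by case: eqP => [|]; rewrite ?mul0r// => nl; move: ln; rewrite (_ : l = - n) ?eqxx//; lia.
Qed.

(** One factor is expanded by [pcoef_conv]. Summing over [k] with [n + k] fixed collapses the other
    one by [y_pcoef], and what remains is an instance of [xy]. *)
Lemma pcoef_orth_ge0 m : usum (fun n => pcoef t n * pcoef t (n + m)) (m == 0)%:R.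
Proof.
have [M M0 cM] := pcoef_bound.
pose F (p : int * int) := x p.1 * y p.2 * pcoef t (p.1 + m - p.2).
have [s hs] : exists s, usum F s.
  apply: (@usum_geo2 _ q q01 _ (C * C * M)) => k l; rewrite /F /= normrM [X in X * _]normrM.
  rewrite (_ : C * C * M * _ = (C * geo q k) * (C * geo q l) * M); last by ring.
  by apply: ler_pM => //; apply: ler_pM.
have H' : usum (fun j => x j * y (- m - j)) s.
  apply: usum_fubini hs _ => j.
  have := usumZ (x j) (y_pcoef (j + m)).
  rewrite /F (_ : - (j + m) = - m - j); last by ring.
  by congr usum; apply/funext => k /=; rewrite /GRing.scale/= mulrA.
have -> : (m == 0)%:R = s.
  apply: usum_unique H'; have := xy (- m); rewrite oppr_eq0.
  rewrite -(usum_bij _ _ (h := fun k : int => - m - k)); last first.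
    by exists (fun k : int => - m - k) => k; ring.
  by congr usum; apply/funext => k /=; congr (x _ * _); ring.
have hs' : usum (fun p : int * int => F (p.1 + p.2, p.2)) s.
  apply/(usum_bij F s (h := fun p : int * int => (p.1 + p.2, p.2))) => //.
  by exists (fun p => (p.1 - p.2, p.2)) => -[a b] /=; rewrite ?subrK ?addrK.
apply: usum_fubini hs' _ => n.
have := usumZ (pcoef t (n + m)) (pcoef_conv n); rewrite /GRing.scale/= mulrC.
congr usum; apply/funext => k /=; rewrite /F /= mulrC; congr (_ * pcoef t _); ring.
Qed.

End convolution.

Lemma pcoef_orth t m : usum (fun n => pcoef t n * pcoef t (n + m)) (m == 0)%:R.
Proof.
have [t0|t0] := leP 0 t; first exact: pcoef_orth_ge0.
have nt0 : 0 <= - t by lia.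
have := pcoef_orth_ge0 nt0 m.
rewrite -(usum_bij _ _ (h := fun n : int => n - t)); last first.
  by exists (fun k : int => k + t) => k; ring.
by congr usum; apply/funext => n /=; rewrite !pcoefN; congr (pcoef _ _ * pcoef _ _); ring.
Qed.

End qseries.

(** * The function [P0] in terms of q-Bessel coefficients *)

Section P0E.
Context {R : realType}.
Variable q : R.
Hypothesis q01 : 0 < q < 1.
Let Q := q ^+ 2.
Let q0 : 0 < q. Proof. by case/andP: q01. Qed.
Let q1 : q < 1. Proof. by case/andP: q01. Qed.
Let qn0 : q != 0. Proof. by rewrite gt_eqF. Qed.
Let Q0 : 0 < Q. Proof. exact: exprn_gt0. Qed.
Let Q1 : Q < 1. Proof. by rewrite expr_lt1// ltW. Qed.
Let P := qpoch_oo Q Q.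

Let qpoch_cvg : qpoch Q Q @ \oo --> P.
Proof.
apply: nonincreasing_is_cvgn.
  apply/nonincreasing_seqP => n; rewrite qpochS ler_piMr ?(ltW (qpoch_gt0 q01 n))//.
  by rewrite lerBlDr lerDl mulr_ge0 ?exprn_ge0 ?ltW.
by exists 0 => _ [n _ <-]; rewrite ltW// qpoch_gt0.
Qed.

Let P_neq0 : P != 0.
Proof.
have [C C0 CP] := ipoch_bounded q01.
(* The uniform bound on the reciprocals [ipoch] keeps the finite products away from zero. *)
suff : C^-1 <= P by apply: contraTneq => ->; rewrite -ltNge invr_gt0.
apply: limr_ge; first by apply/cvg_ex; exists P; exact: qpoch_cvg.
near=> n; have := CP n%:Z; rewrite /ipoch => H.
by rewrite -[leRHS]invrK lef_pV2// posrE ?invr_gt0 ?qpoch_gt0.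
Unshelve. all: by end_near. Qed.

Lemma qpoch_oo_ipoch (j : int) : qpoch_oo (q ^ (2 * j + 2)) Q = P * ipoch q j.
Proof.
case: j => n.
  have -> : q ^ (2 * Posz n + 2) = Q ^+ n.+1.
    by rewrite -exprM exprnP; congr (_ ^ _); lia.
  have nz m : qpoch Q Q m != 0 by rewrite gt_eqF// qpoch_gt0.
  have E m : qpoch (Q ^+ n.+1) Q m = (qpoch Q Q n)^-1 * qpoch Q Q (n + m).
    apply: (mulfI (nz n)); rewrite mulrA mulfV// mul1r.
    rewrite /qpoch big_split_ord/=; congr (_ * _); apply: eq_bigr => k _.
    by rewrite -exprSr -exprD; congr (1 - _ ^+ _); lia.
  rewrite /qpoch_oo (funext E) mulrC; apply: cvg_lim => //.
  apply: cvgMr; rewrite (_ : (fun m => qpoch Q Q (n + m)) = (fun m => qpoch Q Q (m + n))).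
    by rewrite cvg_shiftn; exact: qpoch_cvg.
  by apply/funext => m; rewrite addnC.
rewrite /ipoch mulr0; apply: cvg_lim => //; apply: cvg_near_cst.
near=> m; rewrite /qpoch.
have nm : (n < m)%N by near: m; exists n.+1.
(* With [j = -(n + 1)], the factor of index [n] is [1 - Q^n / Q^n = 0]. *)
rewrite (bigD1 (Ordinal nm))//=.
have -> : q ^ (2 * Negz n + 2) = (Q ^+ n)^-1.
  by rewrite -exprM exprnN; congr (_ ^ _); lia.
by rewrite mulfV ?subrr ?mul0r// expf_eq0 gt_eqF ?andbF.
Unshelve. all: by end_near. Qed.

Lemma Psi_qbessel (t n : int) :
  Psi 0 (q ^ (2 * t + 2)) Q (q ^ (2 * n + 2)) = P * qbessel q t n.
Proof.
apply: cvg_lim => //; apply: usum_series.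
have := usum_mull P (qbesselP q01 t n).
rewrite -(usum_inj _ (h := Posz)) => [|k l []//|[k|k] kP]; last 2 first.
- by have := kP k.
- by rewrite /besselT [ipoch q (Negz k)]/= mulr0 mul0r mulr0.
congr usum; apply/funext => k /=.
have -> : qpoch 0 Q k = 1 by rewrite /qpoch big1// => i _; rewrite mulr0 subr0.
have -> : q ^ (2 * t + 2) * Q ^+ k = q ^ (2 * (t + k) + 2).
  by rewrite -exprM exprnP -expfzDr//; congr (_ ^ _); lia.
rewrite qpoch_oo_ipoch /besselT /= mul1r.
have E : Q ^+ (k * k.-1)./2 * (q ^ (2 * n + 2)) ^+ k = q ^ (k%:Z * (k%:Z + 1) + 2 * n * k%:Z).
  have -> : Q ^+ (k * k.-1)./2 = q ^ (2 * (k * k.-1)./2)%N%:Z by rewrite -exprM.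
  have -> : (q ^ (2 * n + 2)) ^+ k = q ^ ((2 * n + 2) * k%:Z) by rewrite -exprz_exp.
  rewrite -expfzDr//; congr (_ ^ _).
  have : (2 * (k * k.-1)./2 = k * k.-1)%N.
    by rewrite mul2n halfK oddM; case: k => //= k; rewrite andNb subn0.
  case: k => [|k] /=; nia.
rewrite -[RHS]mulrA E -exprnP; ring.
Qed.

Lemma P0_pcoef p v w : P0 q p v w = pcoef q (v - w) (p - w).
Proof.
rewrite /P0.
have -> : 2 * v - 2 * w + 2 = 2 * (v - w) + 2 by ring.
have -> : 2 * p - 2 * w + 2 = 2 * (p - w) + 2 by ring.
rewrite Psi_qbessel -mulrA [P^-1 * _]mulrA mulVf// mul1r /pcoef expNrz -(mulrA ((-1) ^ _)).
rewrite -expfzDr//; congr (_ * _ ^ _ * _); ring.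
Qed.

End P0E.

(** * Ultraweak convergence *)

Section weak.
Context {R : realType}.
Implicit Types I J : choiceType.

Lemma cvg_real (U : Type) (F : set_system U) {FF : Filter F} (f : U -> R) (l : R) :
  f u @[u --> F] --> l -> (f u)%:C @[u --> F] --> l%:C.
Proof.
move=> /cvgrPdist_le fl; apply/cvgrPdist_le => e e0; have [-> e1] := posC e0.
apply: filterS (fl _ e1) => u; rewrite -rmorphB normCE normcR lecR; exact.
Qed.

Lemma cvg_conj (U : Type) (F : set_system U) {FF : Filter F} (f : U -> R[i]) (l : R[i]) :
  f u @[u --> F] --> l -> (f u)^*%C @[u --> F] --> l^*%C.
Proof.
move=> /cvgrPdist_le fl; apply/cvgrPdist_le => e e0.
by apply: filterS (fl _ e0) => u; rewrite -rmorphB !normCE normc_conj.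
Qed.

Lemma l2norm_approx I (f : l2 R I) (e : R) : 0 < e -> exists A : {fset I},
  forall B, (A `<=` B)%fset -> l2norm (f - \sum_(i <- enum_fset B) f i *: ket i) <= e.
Proof.
move=> e0; have [A HA] := (usumCP _ _).1 (ket_usum f) e e0.
by exists A => B /HA; rewrite l2normE lecR.
Qed.

(** On finitely supported vectors the limit involves finitely many terms, and the common bound [c]
    controls the truncation. *)
Lemma cvg_functional I (b_ : nat -> l2 R I -> R[i]) (b : l2 R I -> R[i]) (c : R) :
  0 <= c ->
  (forall n a f g, b_ n (a *: f + g) = a * b_ n f + b_ n g) ->
  (forall a f g, b (a *: f + g) = a * b f + b g) ->
  (forall n f, Normc.normc (b_ n f) <= c * l2norm f) ->
  (forall f, Normc.normc (b f) <= c * l2norm f) ->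
  (forall i, b_ n (ket i) @[n --> \oo] --> b (ket i)) ->
  forall f, b_ n f @[n --> \oo] --> b f.
Proof.
move=> c0 l_ l bc_ bc bk f.
have lin0 (h : l2 R I -> R[i]) : (forall a f g, h (a *: f + g) = a * h f + h g) -> h 0 = 0.
  by move=> hl; have := hl (-1) 0 0; rewrite scaler0 addr0 mulN1r addNr.
have linB (h : l2 R I -> R[i]) : (forall a f g, h (a *: f + g) = a * h f + h g) ->
    forall f g, h (f - g) = h f - h g.
  by move=> hl u v; have := hl (-1) v u; rewrite scaleN1r mulN1r addrC => ->; rewrite addrC.
have linS (h : l2 R I -> R[i]) (A : {fset I}) : (forall a f g, h (a *: f + g) = a * h f + h g) ->
    h (\sum_(i <- enum_fset A) f i *: ket i) = \sum_(i <- enum_fset A) f i * h (ket i).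
  by move=> hl; elim/big_rec2: _ => [|i x y _ <-]; [exact: lin0|exact: hl].
apply/cvgrPdist_le => e' e'0; have [-> e0] := posC e'0; set e := complex.Re e' in e0 *.
have c1 : 0 < c + 1 by rewrite ltr_wpDl.
have [A /(_ A (fsubset_refl _)) HA] := l2norm_approx f (divr_gt0 (divr_gt0 e0 (ltr0Sn _ 2)) c1).
set g := \sum_(i <- _) _ in HA.
have ce : c * l2norm (f - g) <= e / 3.
  rewrite (le_trans (ler_wpM2l c0 HA))// mulrCA ler_piMr ?divr_ge0 ?(ltW e0)//.
  by rewrite ler_pdivrMr// mul1r lerDl.
have gb : b_ n g @[n --> \oo] --> b g.
  rewrite linS//; under eq_cvg do rewrite linS//.
  apply: cvg_big => [|i _]; first exact: add_continuous.
  by apply: cvgM; [exact: cvg_cst|exact: bk].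
near=> n.
have -> : b f - b_ n f = b (f - g) + (b g - b_ n g) - b_ n (f - g) by rewrite !linB//; ring.
rewrite -/e (_ : e = e / 3 + e / 3 + e / 3); last by field.
rewrite !rmorphD/= (le_trans (ler_normB _ _))// lerD//; last first.
  by rewrite normCE lecR (le_trans (bc_ _ _)).
rewrite (le_trans (ler_normD _ _))// lerD//; first by rewrite normCE lecR (le_trans (bc _)).
near: n; move/cvgrPdist_le : gb; apply.
by rewrite ltcR divr_gt0.
Unshelve. all: by end_near. Qed.

(** [cvg_functional] is applied to each variable in turn; for the second one the form is conjugated
    to become linear. *)
Lemma cvg_weak I J (x_ : nat -> l2 R I -> l2 R J) x (c : R) :
  0 <= c -> (forall n, linear (x_ n)) -> linear x ->
  (forall n f, l2norm (x_ n f) <= c * l2norm f) ->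
  (forall f, l2norm (x f) <= c * l2norm f) ->
  (forall i j, inner (x_ n (ket i)) (ket j) @[n --> \oo] --> inner (x (ket i)) (ket j)) ->
  forall f g, inner (x_ n f) g @[n --> \oo] --> inner (x f) g.
Proof.
move=> c0 l_ l xc_ xc xk f g.
have kl j h : inner (x_ n h) (ket j) @[n --> \oo] --> inner (x h) (ket j).
  apply: (@cvg_functional I (fun n h => inner (x_ n h) (ket j)) (fun h => inner (x h) (ket j)) c) => //.
  - by move=> n a u v; rewrite l_ innerDl innerZl.
  - by move=> a u v; rewrite l innerDl innerZl.
  - by move=> n u; rewrite (le_trans (cauchy_schwarz _ _))// l2norm_ket mulr1.
  - by move=> u; rewrite (le_trans (cauchy_schwarz _ _))// l2norm_ket mulr1.
rewrite (inner_conj g (x f)); under eq_cvg do rewrite (inner_conj g).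
apply: cvg_conj.
apply: (@cvg_functional J (fun n h => inner h (x_ n f)) (fun h => inner h (x f)) (c * l2norm f)).
- by rewrite mulr_ge0 ?l2norm_ge0.
- by move=> n a u v; rewrite innerDl innerZl.
- by move=> a u v; rewrite innerDl innerZl.
- by move=> n u; rewrite (le_trans (cauchy_schwarz _ _))// mulrC ler_wpM2r ?l2norm_ge0.
- by move=> u; rewrite (le_trans (cauchy_schwarz _ _))// mulrC ler_wpM2r ?l2norm_ge0.
- move=> j; rewrite (inner_conj (x f)); under eq_cvg do rewrite (inner_conj (x_ _ f)).
  by apply: cvg_conj; exact: kl.
Qed.

Lemma series_sqnorm_bound I (xi : nat -> l2 R I) :
  cvgn (series (fun n => `|xi n| ^+ 2)) ->
  exists M, forall A : {fset nat}, \sum_(n <- enum_fset A) l2norm (xi n) ^+ 2 <= M.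
Proof.
move=> /cvg_ex[l /cvgrPdist_le/(_ 1 ltr01)[N _ HN]].
exists (Normc.normc l + 1) => A.
have [K AK] : exists K, forall i, i \in A -> (i < K)%N.
  by exists (\max_(i <- enum_fset A) i).+1 => i iA; rewrite ltnS; exact: leq_bigmax_seq.
pose s := \sum_(0 <= n < maxn N K) l2norm (xi n) ^+ 2.
apply: (@le_trans _ _ s).
  have sub : (A `<=` [fset i in iota 0 (maxn N K)])%fset.
    by apply/fsubsetP => i /AK iA; rewrite !inE mem_iota/= leq_max iA orbT.
  have s0 n : 0 <= l2norm (xi n) ^+ 2 by exact: sqr_ge0.
  apply: le_trans (ler_sum_fset s0 sub) _; rewrite /s /index_iota subn0.
  rewrite le_eqVlt; apply/orP; left; apply/eqP; apply: perm_big; apply: uniq_perm.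
  - exact: fset_uniq.
  - exact: iota_uniq.
  - by move=> i; rewrite !inE.
have := HN _ (leq_maxl N K).
have -> : series (fun n => `|xi n| ^+ 2) (maxn N K) = s%:C.
  by rewrite /series/= rmorph_sum; apply: eq_bigr => n _; rewrite l2normE rmorphXn.
rewrite distrC => H; have : `|s%:C| <= `|l| + 1.
  by rewrite -[s%:C](subrK l) addrC (le_trans (ler_normD _ _))// lerD2l.
rewrite !normCE -(rmorph1 (real_complex R)) -rmorphD lecR normcR.
exact: le_trans (ler_norm _).
Qed.

(** Weak convergence gives the limit of each term of an ultraweak functional, and
    [c / 2 * (|xi_k|^2 + |eta_k|^2)] is a summable majorant independent of [n], so [usum_tannery]
    applies. *)
Lemma ultraweak_bounded_seq I (x_ : nat -> l2 R I -> l2 R I) x (c : R) :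
  0 <= c -> (forall n, linear (x_ n)) -> linear x ->
  (forall n f, l2norm (x_ n f) <= c * l2norm f) ->
  (forall f, l2norm (x f) <= c * l2norm f) ->
  (forall i j, inner (x_ n (ket i)) (ket j) @[n --> \oo] --> inner (x (ket i)) (ket j)) ->
  ultraweak_cvg (x_ @ \oo) x.
Proof.
move=> c0 l_ l xc_ xc xk phi [xi [eta [/series_sqnorm_bound[M xiM] /series_sqnorm_bound[N etaN] phiE]]].
have D (y : l2 R I -> l2 R I) k : (forall f, l2norm (y f) <= c * l2norm f) ->
    Normc.normc (inner (y (xi k)) (eta k)) <=
    c / 2 * (l2norm (xi k) ^+ 2 + l2norm (eta k) ^+ 2).
  move=> yc; rewrite (le_trans (cauchy_schwarz _ _))//.
  rewrite (le_trans (ler_wpM2r (l2norm_ge0 _) (yc _)))// -!mulrA ler_wpM2l//.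
  by have := sqr_ge0 (l2norm (xi k) - l2norm (eta k)); lra.
have [|A|G hG] := @usum_nneg R nat (fun k => c / 2 * (l2norm (xi k) ^+ 2 + l2norm (eta k) ^+ 2)) (c / 2 * (M + N)).
- by move=> k; rewrite mulr_ge0 ?addr_ge0 ?sqr_ge0// divr_ge0.
- by rewrite -mulr_sumr ler_wpM2l ?divr_ge0// big_split lerD.
have S (y : l2 R I -> l2 R I) : (forall f, l2norm (y f) <= c * l2norm f) ->
    usum (fun k => inner (y (xi k)) (eta k)) (phi y).
  move=> yc; have [|s hs] := @usum_absC R nat (fun k => inner (y (xi k)) (eta k)) G.
    move=> A; apply: le_trans (usum_ge_sum A _ hG); first by apply: ler_sum => k _; exact: D.
    by move=> k; exact: le_trans (normc_ge0 _) (D y k yc).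
  rewrite phiE; have -> // : limn (series (fun k => inner (y (xi k)) (eta k))) = s.
  by apply: cvg_lim => //; exact: usum_series.
have H : phi (x_ n) @[n --> \oo] --> phi x; last exact: H.
apply: (usum_tannery (fun n => S _ (xc_ n)) (S _ xc) hG).
- by move=> n k; exact: D.
- by move=> k; exact: D.
- by move=> k; exact: (cvg_weak c0 l_ l xc_ xc xk).
Qed.

Lemma vector_functional I (f g : l2 R I) : ultraweak_functional (fun x => inner (x f) g).
Proof.
exists (fun n => if n is 0%N then f else 0), (fun n => if n is 0%N then g else 0).
have S (h : l2 R I) : cvgn (series (fun n => `|if n is 0%N then h else 0| ^+ 2)).
  apply/cvg_ex; eexists; apply: usum_series.
  apply: (usum1 (j := 0%N) (f := fun n => `|if n is 0%N then h else 0| ^+ 2 : R[i])) => -[//|n] _.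
  by rewrite normr0 expr0n.
split=> // x; apply/esym/cvg_lim => //; apply: usum_series.
rewrite -[X in usum _ X]/((fun n => inner (x (if n is 0%N then f else 0)) (if n is 0%N then g else 0)) 0%N).
by apply: usum1 => -[//|n] _; rewrite inner0r.
Qed.

End weak.

(** * A Schur multiplier bound by averaging *)

Section schur.
Context {R : realType} {I J : choiceType}.

Lemma inner_ketsum (x : l2 R I -> l2 R I) (A : {fset I}) (a b : I -> R[i]) : linear x ->
  inner (x (\sum_(i <- enum_fset A) a i *: ket i)) (\sum_(i <- enum_fset A) b i *: ket i) =
  \sum_(i <- enum_fset A) \sum_(k <- enum_fset A)
    a i * (b k)^*%C * inner (x (ket i)) (ket k).
Proof.
move=> xl; rewrite linEsum// inner_suml; apply: eq_bigr => i _.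
rewrite linEZ// innerZl inner_sumr mulr_sumr; apply: eq_bigr => k _.
by rewrite innerZr mulrA.
Qed.

Lemma l2norm_ketsum (A : {fset I}) (a : I -> R[i]) :
  l2norm (\sum_(i <- enum_fset A) a i *: ket i) ^+ 2 =
  \sum_(i <- enum_fset A) Normc.normc (a i) ^+ 2.
Proof.
apply: (@complexI R); rewrite -inner_norm.
rewrite (@inner_ketsum idfun)// rmorph_sum big_seq [RHS]big_seq; apply: eq_bigr => i iA.
rewrite (big_fsetD1 i)// inner_ket eqxx mulr1 normc_sqr big_seq big1 => [|k]; first by rewrite /= addr0.
by rewrite !inE eq_sym inner_ket => /andP[/negPf-> _]; rewrite mulr0.
Qed.

(* The entries of z' are those of z times the multiplier
   (1/N) sum_j 1_(P j)(i) 1_(P j)(k), so that <z' f, g> is the average over j of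
   the <z (P j f), P j g>, to which Cauchy-Schwarz applies. *)
Lemma schur_bound (z z' : l2 R I -> l2 R I) (c c' N : R) (P : J -> pred I) :
  0 < N -> 0 <= c -> 0 <= c' -> linear z -> linear z' ->
  (forall f, l2norm (z f) <= c * l2norm f) ->
  (forall f, l2norm (z' f) <= c' * l2norm f) ->
  (forall A : {fset I}, exists S : {fset J}, forall i k, i \in A -> k \in A ->
    \sum_(j <- enum_fset S) (P j i && P j k)%:R * inner (z (ket i)) (ket k) =
    N%:C * inner (z' (ket i)) (ket k)) ->
  (forall (S : {fset J}) i, \sum_(j <- enum_fset S) (P j i)%:R <= N) ->
  forall f, l2norm (z' f) <= c * l2norm f.
Proof.
move=> N0 c0 c'0 zl z'l zc z'c' zz' PN.
pose fin (f : l2 R I) (A : {fset I}) : l2 R I := \sum_(i <- enum_fset A) f i *: ket i.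
have finP (f : l2 R I) A : l2norm (fin f A) <= l2norm f.
  rewrite -(@ler_pXn2r _ 2) ?nnegrE ?l2norm_ge0//.
  by rewrite l2norm_ketsum; exact: l2norm_sum_le.
have key A (f g : l2 R I) : Normc.normc (inner (z' (fin f A)) (fin g A)) <=
    c * ((l2norm f ^+ 2 + l2norm g ^+ 2) / 2).
  have [S HS] := zz' A.
  pose w (f : l2 R I) j : l2 R I := \sum_(i <- enum_fset A) ((P j i)%:R * f i) *: ket i.
  have E : N%:C * inner (z' (fin f A)) (fin g A) =
      \sum_(j <- enum_fset S) inner (z (w f j)) (w g j).
    rewrite inner_ketsum// mulr_sumr.
    under [RHS]eq_bigr do rewrite inner_ketsum//.
    rewrite [RHS]exchange_big/= big_seq [RHS]big_seq; apply: eq_bigr => i iA.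
    rewrite [RHS]exchange_big/= mulr_sumr big_seq [RHS]big_seq; apply: eq_bigr => k kA.
    rewrite mulrCA -HS// mulr_sumr; apply: eq_bigr => j _.
    by rewrite rmorphM/= conjc_nat -mulnb natrM; ring.
  have W (h : l2 R I) : \sum_(j <- enum_fset S) l2norm (w h j) ^+ 2 <= N * l2norm h ^+ 2.
    under eq_bigr do rewrite l2norm_ketsum.
    rewrite exchange_big/=; apply: le_trans (ler_wpM2l (ltW N0) (l2norm_sum_le h A)).
    rewrite mulr_sumr; apply: ler_sum => i _.
    apply: le_trans (ler_wpM2r (sqr_ge0 _) (PN S i)).
    rewrite mulr_suml; apply: ler_sum => j _.
    by case: (P j i); rewrite ?mul1r// mul0r Normc.normc0 expr0n mul0r.
  rewrite -(ler_pM2l N0) -[X in X * Normc.normc _](ger0_norm (ltW N0)) -normcR -Normc.normcM E.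
  apply: (@le_trans _ _ (\sum_(j <- enum_fset S) c * ((l2norm (w f j) ^+ 2 + l2norm (w g j) ^+ 2) / 2))).
    rewrite -lecR -normCE rmorph_sum (le_trans (ler_norm_sum _ _ _))//.
    apply: ler_sum => j _; rewrite normCE lecR (le_trans (cauchy_schwarz _ _))//.
    rewrite (le_trans (ler_wpM2r (l2norm_ge0 _) (zc _)))// -mulrA ler_wpM2l//.
    by have := sqr_ge0 (l2norm (w f j) - l2norm (w g j)); lra.
  rewrite -mulr_sumr mulrCA ler_wpM2l// -mulr_suml mulrA ler_wpM2r// big_split mulrDr.
  by apply: lerD; exact: W.
(* The a priori bound [c'] controls the truncation error and does not enter the limit. *)
have key2 (f g : l2 R I) : Normc.normc (inner (z' f) g) <=
    c * ((l2norm f ^+ 2 + l2norm g ^+ 2) / 2).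
  apply/ler_addgt0Pr => e e0.
  pose K := c' * (l2norm f + l2norm g) + 1.
  have K0 : 0 < K by rewrite ltr_wpDl// mulr_ge0// addr_ge0 ?l2norm_ge0.
  have [A HA] := l2norm_approx f (divr_gt0 e0 K0).
  have [B HB] := l2norm_approx g (divr_gt0 e0 K0).
  have {HA} := HA _ (fsubsetUl A B); have {HB} := HB _ (fsubsetUr A B).
  set C := (A `|` B)%fset; rewrite -/(fin f C) -/(fin g C) => gC fC.
  have -> : inner (z' f) g = inner (z' (fin f C)) (fin g C) +
      (inner (z' (f - fin f C)) g + inner (z' (fin f C)) (g - fin g C)).
    by rewrite linEB// innerDl innerNl innerDr innerNr; ring.
  rewrite (le_trans (le_normcD _ _))// lerD//.
  rewrite (le_trans (le_normcD _ _))//.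
  apply: (@le_trans _ _ (c' * (e / K) * l2norm g + c' * l2norm f * (e / K))).
    apply: lerD; rewrite (le_trans (cauchy_schwarz _ _))//.
      by rewrite ler_wpM2r ?l2norm_ge0// (le_trans (z'c' _))// ler_wpM2l.
    rewrite ler_pM ?l2norm_ge0// (le_trans (z'c' _))// ler_wpM2l//.
  rewrite (_ : _ + _ = c' * (l2norm f + l2norm g) * (e / K)); last by ring.
  by rewrite mulrCA ler_piMr ?(ltW e0)// ler_pdivrMr// mul1r lerDl.
move=> f; have [->|f0] := eqVneq (l2norm (z' f)) 0; first by rewrite mulr_ge0 ?l2norm_ge0.
have {}f0 : 0 < l2norm (z' f) by rewrite lt_def f0 l2norm_ge0.
have n0 : 0 < l2norm f.
  rewrite lt_def l2norm_ge0 andbT; apply: contraTneq (z'c' f) => ->.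
  by rewrite mulr0 -ltNge.
(* Testing against [z' f] rescaled to the norm of [f] turns the quadratic estimate into
   [|z' f| * |f| <= c * |f|^2]. *)
have := key2 f ((l2norm f / l2norm (z' f))%:C *: z' f).
rewrite innerZr inner_norm l2normZ normcR ger0_norm ?divr_ge0 ?l2norm_ge0// divfK ?gt_eqF//.
rewrite Normc.normcM normc_conj !normcR !ger0_norm ?divr_ge0 ?sqr_ge0 ?l2norm_ge0//.
rewrite -mulr2n -[in X in _ <= c * (X / _)]mulr_natr mulfK ?pnatr_eq0//.
rewrite expr2 mulrA divfK ?gt_eqF// expr2 mulrCA ler_pM2l//.
Qed.

End schur.

(** * The basis xi0 *)

Section real_rows.
Context {R : realType} {T I : choiceType}.
Variable U : T -> I -> R.
Hypothesis Uo : forall s t, usum (fun i => U s i * U t i) (s == t)%:R.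

Definition mx_row (t : T) : l2 R I := insubd 0 (fun i => (U t i)%:C).

Lemma rowE t i : mx_row t i = (U t i)%:C.
Proof.
rewrite /mx_row val_insubd.
have -> // : (fun i => (U t i)%:C) \in @square_summable R I.
apply/square_summableP; exists 1; apply/sqnorm_leP => A.
have := Uo t t; rewrite eqxx => /(usum_ge_sum A) H; apply: le_trans (H _).
  by apply: ler_sum => j _; rewrite normcR real_normK ?num_real// expr2.
by move=> j; rewrite -expr2 sqr_ge0.
Qed.

Lemma inner_row s t : inner (mx_row s) (mx_row t) = (s == t)%:R.
Proof.
have := usum_real (Uo s t); rewrite rmorph_nat => H; apply: usum_unique H.
have := inner_usum (mx_row s) (mx_row t); congr usum; apply/funext => i.
by rewrite !rowE conjc_real rmorphM.
Qed.

End real_rows.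

Section xi0_basis.
Context {R : realType}.
Variable q : R.
Hypothesis q01 : 0 < q < 1.

Definition xi0_mx (i j : (int * int) * (int * int)) : R :=
  let: ((r, s), (p, t)) := i in let: ((v, k), (w, l)) := j in
  if [&& v - w == t, k + w == r + p & l - v == s - p] then pcoef q t (p - w) else 0.

(** Rows that differ in one of [t], [r + p], [s - p] have disjoint supports. Rows that share them
    have a common support parametrised by [n = p - w], where the sum is the autocorrelation of
    [pcoef q t] at lag [p' - p]. *)
Lemma xi0_mx_row i i' : usum (fun j => xi0_mx i j * xi0_mx i' j) (i == i')%:R.
Proof.
case: i => -[r s] [p t]; case: i' => -[r' s'] [p' t'].
have [|ne] := boolP [&& t == t', r + p == r' + p' & s - p == s' - p']; last first.
  have -> : (((r, s), (p, t)) == ((r', s'), (p', t'))) = false.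
    by apply: contraNF ne => /eqP[-> -> -> ->]; rewrite !eqxx.
  have := @usum0 R R ((int * int) * (int * int))%type; congr usum.
  apply/funext => -[[v k] [w l]] /=.
  case: and3P => [[/eqP vw /eqP kw /eqP lv]|]; last by rewrite mul0r.
  case: and3P => [[/eqP vw' /eqP kw' /eqP lv']|]; last by rewrite mulr0.
  by move: ne; rewrite -vw -vw' -kw -kw' -lv -lv' !eqxx.
move=> /and3P[/eqP tt' /eqP rp /eqP sp].
have -> : (((r, s), (p, t)) == ((r', s'), (p', t'))) = (p' - p == 0).
  rewrite subr_eq0; apply/eqP/eqP => [[_ _ -> _]//|pp].
  by rewrite pp in rp sp *; rewrite tt' (addIr _ rp) (addIr _ sp).
apply/(usum_inj _ (h := fun n : int => ((t + (p - n), r + p - (p - n)), (p - n, s - p + (t + (p - n)))))).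
- by move=> n n' [_ _ /addrI/oppr_inj].
- move=> [[v k] [w l]] hj /=; case: and3P => [[/eqP vw /eqP kw /eqP lv]|]; last by rewrite mul0r.
  by case: (hj (p - w)); congr ((_, _), (_, _)); lia.
have := pcoef_orth q01 t (p' - p); congr usum; apply/funext => n /=.
rewrite -tt'; do !case: ifP => [_|/and3P[]]; try by split; apply/eqP; lia.
by congr (pcoef _ _ _ * pcoef _ _ _); ring.
Qed.

(** The entries of a block depend on [p - w] alone, so the columns have the same autocorrelation as
    the rows; now [p] runs and [w], [w'] are fixed. *)
Lemma xi0_mx_col j j' : usum (fun i => xi0_mx i j * xi0_mx i j') (j == j')%:R.
Proof.
case: j => -[v k] [w l]; case: j' => -[v' k'] [w' l'].
have [|ne] := boolP [&& v - w == v' - w', k + w == k' + w' & l - v == l' - v']; last first.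
  have -> : (((v, k), (w, l)) == ((v', k'), (w', l'))) = false.
    by apply: contraNF ne => /eqP[-> -> -> ->]; rewrite !eqxx.
  have := @usum0 R R ((int * int) * (int * int))%type; congr usum.
  apply/funext => -[[r s] [p t]] /=.
  case: and3P => [[/eqP vw /eqP kw /eqP lv]|]; last by rewrite mul0r.
  case: and3P => [[/eqP vw' /eqP kw' /eqP lv']|]; last by rewrite mulr0.
  by move: ne; rewrite vw vw' kw kw' lv lv' !eqxx.
move=> /and3P[/eqP vw /eqP kw /eqP lv].
have -> : (((v, k), (w, l)) == ((v', k'), (w', l'))) = (w - w' == 0).
  rewrite subr_eq0; apply/eqP/eqP => [[_ _ -> _]//|ww].
  by congr ((_, _), (_, _)); lia.
apply/(usum_inj _ (h := fun n : int => ((k + w - (n + w), l - v + (n + w)), (n + w, v - w)))).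
- by move=> n n' [_ _ /addIr].
- move=> [[r s] [p t]] hj /=; case: and3P => [[/eqP e1 /eqP e2 /eqP e3]|]; last by rewrite mul0r.
  by case: (hj (p - w)); congr ((_, _), (_, _)); lia.
have := pcoef_orth q01 (v - w) (w - w'); congr usum; apply/funext => n /=.
do !case: ifP => [_|/and3P[]]; try by split; apply/eqP; lia.
by congr (pcoef _ _ _ * pcoef _ _ _); ring.
Qed.

Definition xiv : (int * int) * (int * int) -> l2 R ((int * int) * (int * int))%type :=
  mx_row xi0_mx.
Definition xiw : (int * int) * (int * int) -> l2 R ((int * int) * (int * int))%type :=
  mx_row (fun j i => xi0_mx i j).

Lemma xivE i j : xiv i j = (xi0_mx i j)%:C.
Proof. exact: rowE xi0_mx_row _ _. Qed.

Lemma xiw_xiv i j : xiw j i = (xiv i j)^*%C.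
Proof. by rewrite xivE conjc_real; exact: (rowE xi0_mx_col). Qed.

Lemma xiv_orth i i' : inner (xiv i) (xiv i') = (i == i')%:R.
Proof. exact: inner_row xi0_mx_row _ _. Qed.

Lemma xiw_orth j j' : inner (xiw j) (xiw j') = (j == j')%:R.
Proof. exact: inner_row xi0_mx_col _ _. Qed.

Lemma xi0E r s p t : xi0 q r s p t = xiv ((r, s), (p, t)).
Proof.
apply: unordered_sumE.
have := ket_usum (xiv ((r, s), (p, t))).
rewrite -(usum_inj _ (h := fun vw : int * int => ((vw.1, r + p - vw.2), (vw.2, s - p + vw.1)))) => [|[v w] [v' w'] [-> _ -> _]//|[[v k] [w l]] hj]; last first.
  rewrite xivE /=; case: and3P => [[/eqP vw /eqP kw /eqP lv]|]; last by rewrite rmorph0 scale0r.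
  by case: (hj (v, w)) => /=; congr ((_, _), (_, _)); lia.
congr usum; apply/funext => -[v w] /=; rewrite !ket_tensor xivE/= P0_pcoef//.
rewrite subrK eqxx addrK eqxx !andbT.
case: eqP => [<-|vw]; first by rewrite mem_set.
by rewrite memNset// rmorph0 scale0r.
Qed.

End xi0_basis.

(** * The von Neumann algebra *)

Section algebra.
Context {R : realType}.
Notation H := (l2 R (int * int)%type).

Lemma int_step_ind (P : int -> Prop) : P 0 -> (forall n, P n -> P (n + 1)) ->
  (forall n, P n -> P (n - 1)) -> forall n, P n.
Proof.
move=> P0 Pp Pm [] n.
  elim: n => // n IHn; have -> : Posz n.+1 = n%:Z + 1 by lia.
  exact: Pp.
elim: n => [|n IHn]; first by have := Pm _ P0; rewrite sub0r.
have -> : Negz n.+1 = Negz n - 1 by lia.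
exact: Pm.
Qed.

Definition trans1 (a : int) : l2 R int -> l2 R int := pullback (fun n => n - a).

(* Locked, so that unification does not unfold these operators. *)
Fact trans2_key : unit. Proof. by []. Qed.
Fact proj1op_key : unit. Proof. by []. Qed.

Definition trans2 (a b : int) : H -> H :=
  locked_with trans2_key (pullback (fun p : int * int => (p.1 - a, p.2 - b))).

Lemma trans2_def a b : trans2 a b = pullback (fun p : int * int => (p.1 - a, p.2 - b)).
Proof. by rewrite /trans2; case: trans2_key. Qed.

Definition proj1op (p : pred int) : H -> H :=
  locked_with proj1op_key (l2_restrict (fun x : int * int => p x.1)).

Lemma proj1op_def p : proj1op p = l2_restrict (fun x : int * int => p x.1).
Proof. by rewrite /proj1op; case: proj1op_key. Qed.

Let subK (a : int) : cancel (fun n : int => n - a) (fun n => n + a).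
Proof. by move=> n; rewrite subrK. Qed.
Let addK (a : int) : cancel (fun n : int => n + a) (fun n => n - a).
Proof. by move=> n; rewrite addrK. Qed.
Let subK2 (a b : int) : cancel (fun p : int * int => (p.1 - a, p.2 - b)) (fun p => (p.1 + a, p.2 + b)).
Proof. by case=> m n /=; rewrite !subrK. Qed.
Let addK2 (a b : int) : cancel (fun p : int * int => (p.1 + a, p.2 + b)) (fun p => (p.1 - a, p.2 - b)).
Proof. by case=> m n /=; rewrite !addrK. Qed.

Lemma transE a f n : trans1 a f n = f (n - a).
Proof. by rewrite pullbackE//; exact: can_inj (subK a). Qed.

Lemma trans2E a b (f : H) p : trans2 a b f p = f (p.1 - a, p.2 - b).
Proof. by rewrite trans2_def pullbackE//; exact: can_inj (subK2 a b). Qed.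

Lemma trans_bounded a : bounded_op (trans1 a).
Proof. by apply: pullback_bounded; exact: can_inj (subK a). Qed.

Lemma trans2_bounded a b : bounded_op (trans2 a b).
Proof. rewrite trans2_def; by apply: pullback_bounded; exact: can_inj (subK2 a b). Qed.

Lemma trans2_ket a b m n : trans2 a b (ket (m, n)) = ket (m + a, n + b).
Proof. by rewrite trans2_def; exact: (pullback_ket _ (subK2 a b) (addK2 a b)). Qed.

Lemma trans2D a b c d : trans2 a b \o trans2 c d = trans2 (a + c) (b + d).
Proof.
apply/funext => f; apply: l2_ext => -[m n] /=; rewrite !trans2E/=.
by congr (f (_, _)); ring.
Qed.

Lemma transD a b : trans1 a \o trans1 b = trans1 (a + b).
Proof.
by apply/funext => f; apply: l2_ext => n /=; rewrite !transE; congr (f _); ring.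
Qed.

Lemma trans2_0 : trans2 0 0 = idfun.
Proof. by apply/funext => f; apply: l2_ext => -[m n]; rewrite trans2E/= !subr0. Qed.

Lemma trans_0 : trans1 0 = idfun.
Proof. by apply/funext => f; apply: l2_ext => n; rewrite transE subr0. Qed.

Lemma inner_trans2 a b f g : inner (trans2 a b f) g = inner f (trans2 (- a) (- b) g).
Proof.
have <- : pullback (fun p : int * int => (p.1 + a, p.2 + b)) = trans2 (- a) (- b).
  apply/funext => h; apply: l2_ext => p; rewrite (trans2E (- a) (- b) h p) !opprK pullbackE//.
  exact: can_inj (addK2 a b).
by rewrite trans2_def; exact: (inner_pullback _ _ (subK2 a b) (addK2 a b)).
Qed.

Lemma adjoint_trans2 a b : adjoint (trans2 a b) = trans2 (- a) (- b).
Proof. by apply: adjointE => f g; exact: inner_trans2. Qed.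

Lemma adjoint_trans a : adjoint (trans1 a) = trans1 (- a).
Proof.
have <- : pullback (fun n : int => n + a) = trans1 (- a).
  apply/funext => h; apply: l2_ext => n; rewrite (transE (- a) h n) opprK pullbackE//.
  exact: can_inj (addK a).
exact: (adjoint_pullback (subK a) (addK a)).
Qed.

Lemma shift_trans : shift = trans1 1 :> (l2 R int -> l2 R int).
Proof. by apply/funext => f; apply: l2_ext => n; rewrite transE. Qed.

Lemma trans2_tensor a b (f g : l2 R int) : trans2 a b (f \ox g) = trans1 a f \ox trans1 b g.
Proof. by apply: l2_ext => -[m n]; rewrite trans2E !tensorE !transE. Qed.

Lemma trans2_optensor a b : trans2 a b = optensor (trans1 a) (trans1 b).
Proof.
by apply/esym/optensorE; [exact: trans2_bounded|exact: trans2_tensor].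
Qed.

Lemma a0E : @a0 R = trans2 (-1) 0.
Proof. by rewrite /a0 shift_trans adjoint_trans -trans_0 -trans2_optensor. Qed.

Lemma proj1op_bounded p : bounded_op (proj1op p).
Proof. rewrite proj1op_def; exact: restrict_bounded. Qed.

Lemma proj1opE p (f : H) x : proj1op p f x = (p x.1)%:R * f x.
Proof. rewrite proj1op_def; exact: restrictE. Qed.

Lemma proj1op_ket p m n : proj1op p (ket (m, n)) = (p m)%:R *: ket (m, n).
Proof. rewrite proj1op_def; exact: restrict_ket. Qed.

Lemma proj1op_optensor p : proj1op p = optensor (l2_restrict p) idfun.
Proof.
apply/esym/optensorE => [|f g]; first exact: proj1op_bounded.
by apply: l2_ext => -[m n]; rewrite proj1opE !tensorE restrictE mulrA.
Qed.

Lemma vN_generated_sub I (A : set (l2 R I -> l2 R I)) x :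
  A x -> bounded_op x -> vN_generated A x.
Proof.
by move=> Ax xb; split=> // y [_ yA]; rewrite yA//; left.
Qed.

Lemma commutant_comp I (A : set (l2 R I -> l2 R I)) x y :
  commutant A x -> commutant A y -> commutant A (x \o y).
Proof.
move=> [xb xA] [yb yA]; split; first exact: bounded_comp.
move=> z Az; apply/funext => f /=.
have /(congr1 (@^~ f))/= -> := yA z Az.
by have /(congr1 (@^~ (y f)))/= -> := xA z Az.
Qed.

Lemma commutant_lin I (A : set (l2 R I -> l2 R I)) c x y :
  (forall z, A z -> linear z) ->
  commutant A x -> commutant A y -> commutant A (c *: x + y).
Proof.
move=> Al [xb xA] [yb yA]; split; first exact: bounded_lin.
move=> z Az; apply/funext => f /=; rewrite !lin_opE Al//.
have /(congr1 (@^~ f))/= -> := xA z Az.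
by have /(congr1 (@^~ f))/= -> := yA z Az.
Qed.

Lemma vN_generated_lin I (A : set (l2 R I -> l2 R I)) c x y :
  vN_generated A x -> vN_generated A y -> vN_generated A (c *: x + y).
Proof. by apply: commutant_lin => z [[]]. Qed.

Lemma L_Z_trans y a : L_Z y -> trans1 a \o y = y \o trans1 a.
Proof.
move=> [_ ->//]; split; first exact: trans_bounded.
by move=> z [->|[_ -> <-]]; rewrite shift_trans ?adjoint_trans !transD addrC.
Qed.

Lemma trans_L_Z a : L_Z (trans1 a).
Proof.
split=> [|y [yb yS]]; first exact: trans_bounded.
have y1 : trans1 1 \o y = y \o trans1 1 by rewrite yS//; left; rewrite shift_trans.
have ym : trans1 (-1) \o y = y \o trans1 (-1).
  by rewrite yS//; right; exists shift => //; rewrite shift_trans adjoint_trans.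
elim/int_step_ind: a => [|n IHn|n IHn]; first by rewrite trans_0.
  rewrite addrC -transD -[LHS]/(trans1 1 \o (trans1 n \o y)) IHn.
  by rewrite -[LHS]/((trans1 1 \o y) \o trans1 n) y1.
rewrite addrC -transD -[LHS]/(trans1 (-1) \o (trans1 n \o y)) IHn.
by rewrite -[LHS]/((trans1 (-1) \o y) \o trans1 n) ym.
Qed.

Notation M := (@Linfty_E2 R).

Lemma M_trans2 a b : M (trans2 a b).
Proof.
apply: vN_generated_sub (trans2_bounded a b).
exists (trans1 a), (trans1 b); split; [exact: trans_bounded|exact: trans_L_Z|].
exact: trans2_optensor.
Qed.

Lemma M_proj1op p : M (proj1op p).
Proof.
apply: vN_generated_sub (proj1op_bounded p).
exists (l2_restrict p), idfun; split; [exact: restrict_bounded| |exact: proj1op_optensor].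
by rewrite -trans_0; exact: trans_L_Z.
Qed.

Lemma M_id : M idfun.
Proof. by rewrite -trans2_0; exact: M_trans2. Qed.

Lemma M_comp x y : M x -> M y -> M (x \o y).
Proof. exact: commutant_comp. Qed.

Lemma M_lin c x y : M x -> M y -> M (c *: x + y).
Proof. exact: vN_generated_lin. Qed.

Lemma M_bounded x : M x -> bounded_op x.
Proof. by case. Qed.

(** [M] is a double commutant, so it suffices that [trans2 0 d] commutes with the generators and
    their adjoints. The zero default of [optensor] and [adjoint] commutes with it as well. *)
Lemma trans2_commute x d : M x -> x \o trans2 0 d = trans2 0 d \o x.
Proof.
have zP z e : (exists x y, [/\ bounded_op x, L_Z y & z = optensor x y]) ->
    trans2 0 e \o z = z \o trans2 0 e.
  move=> [a [b [ab bL ->]]]; rewrite /optensor; case: xgetP => [w _ [wb wE]|_].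
    apply: tensor_ext => [||f g].
    - by apply: bounded_comp => //; exact: trans2_bounded.
    - by apply: bounded_comp => //; exact: trans2_bounded.
    - rewrite /= wE !trans2_tensor wE trans_0; congr (_ \ox _).
      by have /(congr1 (@^~ g)) := L_Z_trans e bL.
  by apply/funext => f /=; rewrite linE0//; case: (trans2_bounded 0 e).
move=> [_ ->//]; split; first exact: trans2_bounded.
move=> _ [/zP->//|[z /zP zz <-]].
rewrite /adjoint; case: xgetP => [w _ wP|_].
  apply/funext => g; apply: inner_eq => h; rewrite !(inner_conj h); congr (_^*%C) => /=.
  rewrite -{1}[d]opprK -{1}[0]oppr0 -inner_trans2 -!wP.
  have /(congr1 (@^~ h))/= <- := zz (- d).
  by rewrite inner_trans2 opprK oppr0.
by apply/funext => f /=; rewrite linE0//; case: (trans2_bounded 0 d).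
Qed.

Lemma M_laurent x m k n l : M x ->
  inner (x (ket (m, k))) (ket (n, l)) = inner (x (ket (m, 0))) (ket (n, l - k)).
Proof.
move=> Mx; have -> : ket (m, k) = trans2 0 k (ket (m, 0)) :> H.
  by rewrite trans2_ket addr0 add0r.
have /(congr1 (@^~ (ket (m, 0))))/= -> := trans2_commute k Mx.
by rewrite inner_trans2 trans2_ket oppr0 addr0.
Qed.

Lemma proj1op_trans2 p d : proj1op p \o trans2 0 d = trans2 0 d \o proj1op p.
Proof. by rewrite trans2_commute//; exact: M_proj1op. Qed.

End algebra.

(** * The operator b0 *)

Section graphs.
Context {R : realType}.
Implicit Types I J : choiceType.

Lemma cvg_inner I (U : Type) (F : set_system U) {FF : Filter F} (f_ : U -> l2 R I) (f h : l2 R I) :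
  f_ u @[u --> F] --> f -> inner (f_ u) h @[u --> F] --> inner f h.
Proof.
move=> /cvgrPdist_le ff; apply/cvgrPdist_le => e' e'0; have [-> e0] := posC e'0.
have h1 : 0 < l2norm h + 1 by rewrite ltr_wpDl ?l2norm_ge0.
have : (0 : R[i]) < (complex.Re e' / (l2norm h + 1))%:C by rewrite ltcR divr_gt0.
move=> /ff; apply: filterS => u; rewrite -innerNl -innerDl normCE l2normE !lecR => H.
rewrite (le_trans (cauchy_schwarz _ _))// (le_trans (ler_wpM2r (l2norm_ge0 _) H))//.
by rewrite -mulrA ler_piMr ?(ltW e0)// mulrC ler_pdivrMr// mul1r lerDl.
Qed.

(** Both sides are continuous in the pair. Such tested relations stand in for a description of the
    domains of closed operators. *)
Lemma closure_inner I J (A : set (l2 R I * l2 R J)) h h' a :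
  (forall p, A p -> inner p.2 h' = a * inner p.1 h) ->
  forall p, closure A p -> inner p.2 h' = a * inner p.1 h.
Proof.
move=> Ah p; rewrite closureEcvg => -[G PG [Gp AG]].
have c2 : inner x.2 h' @[x --> G] --> inner p.2 h'.
  by apply: cvg_inner; apply: cvg_comp Gp _; exact: cvg_snd.
have c1 : a * inner x.1 h @[x --> G] --> a * inner p.1 h.
  apply: cvgM; first exact: cvg_cst.
  by apply: cvg_inner; apply: cvg_comp Gp _; exact: cvg_fst.
have c3 : inner x.2 h' @[x --> G] --> a * inner p.1 h.
  by apply: cvg_trans c1; apply: near_eq_cvg; apply: AG => x /Ah.
exact: (cvg_unique (@norm_hausdorff R[i] R[i]) c2 c3).
Qed.

Lemma span_inner I J (A : set (l2 R I * l2 R J)) h h' a :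
  (forall p, A p -> inner p.2 h' = a * inner p.1 h) ->
  forall p, span A p -> inner p.2 h' = a * inner p.1 h.
Proof.
move=> Ah p [n [c [b [Ab ->]]]]; elim/big_rec: _ => [|i x _ xE] /=.
  by rewrite !inner0l mulr0.
by rewrite !innerDl !innerZl xE Ah//; ring.
Qed.

Lemma graph_tensor_coord I I' J J' (T : set (l2 R I * l2 R I')) (U : set (l2 R J * l2 R J'))
    i i' j j' a b :
  (forall p, T p -> p.2 i' = a * p.1 i) -> (forall p, U p -> p.2 j' = b * p.1 j) ->
  forall p, graph_tensor T U p -> p.2 (i', j') = a * b * p.1 (i, j).
Proof.
move=> Ta Ub p; rewrite -!inner_ketr; move: p; apply: closure_inner; apply: span_inner.
move=> _ [t [u [/Ta tE /Ub uE ->]]]; rewrite !inner_ketr /= tE uE; ring.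
Qed.

Lemma span_sub (V : lmodType R[i]) (A : set V) v : A v -> span A v.
Proof.
move=> Av; exists 1, (fun=> 1), (fun=> v); split=> //.
by rewrite big_ord1 scale1r.
Qed.

(** Boundedness of [x] makes the second components converge along with the first. *)
Lemma closure_graph I J (T : choiceType) (X : set (l2 R I * l2 R J)) (x : l2 R I -> l2 R J)
    (c : T -> R[i]) (a : T -> l2 R I) s : bounded_op x ->
  (forall k, X (a k, x (a k))) -> usum (fun k => c k *: a k) s ->
  closure (span X) (s, x s).
Proof.
move=> xb Xa cs; have [xl _] := xb.
apply: (@closure_usum R _ T (fun k => c k *: (a k, x (a k)))).
  have [cs2] := bounded_usum xb cs; case: cs => cs; split.
  have E (A : {fset T}) : \sum_(i <- enum_fset A) c i *: (a i, x (a i)) =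
      (\sum_(i <- enum_fset A) c i *: a i, \sum_(i <- enum_fset A) x (c i *: a i)).
    elim/big_rec3: _ => // i u v w _ ->; congr (_, _); by rewrite linEZ.
  by under eq_cvg do rewrite E; exact: (cvg_pair cs cs2).
move=> B; exists #|` B|, (fun k => c (tnth (in_tuple (enum_fset B)) k)),
  (fun k => (a (tnth (in_tuple (enum_fset B)) k), x (a (tnth (in_tuple (enum_fset B)) k)))).
by split=> //; rewrite big_tnth.
Qed.

End graphs.

Section b0.
Context {R : realType}.
Variable q : R.
Notation H := (l2 R (int * int)%type).

Lemma b0_coord (n k : int) (p : H * H) : b0 q p -> p.2 (n, k + 1) = (q ^ n)%:C * p.1 (n, k).
Proof.
rewrite -!inner_ketr; move: p; apply: closure_inner; apply: span_inner => _ [m [l ->]].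
rewrite !inner_ketr !ket_tensor.
rewrite -[LHS]/((q ^ m)%:C * ket (m, l + 1) (n, k + 1)) -[RHS]/((q ^ n)%:C * ket (m, l) (n, k)).
rewrite !ketE !xpair_eqE (inj_eq (addIr 1)).
by case: eqP => [->//|]; rewrite !mulr0.
Qed.

(** On the range of the projection [b0] is [q^n] times a shift; being bounded there, it is defined
    on the whole range and not only on the span of the kets. *)
Lemma b0_proj1op (n : int) (g : H) :
  b0 q (proj1op (pred1 n) g, (q ^ n)%:C *: trans2 0 1 (proj1op (pred1 n) g)).
Proof.
have xb : bounded_op ((q ^ n)%:C *: @trans2 R 0 1).
  by rewrite -[_ *: _]addr0; apply: bounded_lin; [exact: trans2_bounded|exact: bounded_cst0].
apply: (@closure_graph R _ _ int _ ((q ^ n)%:C *: @trans2 R 0 1) (fun k => g (n, k)) (fun k => ket (n, k))) => //.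
  move=> k; exists n, k; rewrite !ket_tensor; congr (_, _).
  by rewrite -[LHS]/((q ^ n)%:C *: @trans2 R 0 1 (ket (n, k))) trans2_ket addr0.
have := ket_usum (proj1op (pred1 n) g).
rewrite -(usum_inj _ (h := fun k : int => (n, k))) => [|k l []//|[m k] hk]; last first.
  rewrite proj1opE /=; case: eqP => [mn|]; last by rewrite mul0r scale0r.
  by case: (hk k); rewrite mn.
by congr usum; apply/funext => k /=; rewrite proj1opE/= eqxx mul1r.
Qed.

Hypothesis q01 : 0 < q < 1.

Let q0 : q != 0. Proof. by case/andP: q01 => ? _; rewrite gt_eqF. Qed.

Lemma closed_sum_xiv r s p t f F :
  graph_closed_sum (graph_tensor (b0 q) (graph (@a0 R)))
    (graph_tensor (graph (adjoint (@a0 R))) (b0 q)) (f, F) ->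
  inner F (xiv q ((r, s), (p, t + 1))) = (q ^ p)%:C * inner f (xiv q ((r, s), (p, t))).
Proof.
rewrite -[F]/((f, F).2) -[f in RHS]/((f, F).1); move: (f, F) => {f F}.
apply: closure_inner => -[f F] [g [h [/= gP hP ->]]].
have gE v k w l : g ((v, k + 1), (w - 1, l)) = (q ^ v)%:C * f ((v, k), (w, l)).
  have := @graph_tensor_coord R _ _ _ _ _ _ (v, k) (v, k + 1) (w, l) (w - 1, l) (q ^ v)%:C 1 _ _ _ gP.
  rewrite mulr1; apply=> [p' /b0_coord->//|[a b] ab].
  have {ab} -> : b = @a0 R a by exact: ab.
  by rewrite a0E trans2E/= opprK subr0 subrK mul1r.
have hE v k w l : h ((v + 1, k), (w, l + 1)) = (q ^ w)%:C * f ((v, k), (w, l)).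
  have := @graph_tensor_coord R _ _ _ _ _ _ (v, k) (v + 1, k) (w, l) (w, l + 1) 1 (q ^ w)%:C _ _ _ hP.
  rewrite mul1r; apply=> [[a b] ab|p' /b0_coord->//].
  have {ab} -> : b = adjoint (@a0 R) a by exact: ab.
  by rewrite a0E adjoint_trans2 trans2E/= opprK oppr0 subr0 addrK mul1r.
(* The two reindexings land on coordinates of [g] and [h] that [gE] and [hE] express by one and the
   same coordinate of [f], so the sums merge termwise. *)
have tau1 : bijective (fun j : (int * int) * (int * int) =>
    ((j.1.1, j.1.2 + 1), (j.2.1 - 1, j.2.2))).
  by exists (fun j => ((j.1.1, j.1.2 - 1), (j.2.1 + 1, j.2.2))) => -[[v k] [w l]] /=;
    rewrite ?addrK ?subrK.
have tau2 : bijective (fun j : (int * int) * (int * int) =>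
    ((j.1.1 + 1, j.1.2), (j.2.1, j.2.2 + 1))).
  by exists (fun j => ((j.1.1 - 1, j.1.2), (j.2.1, j.2.2 - 1))) => -[[v k] [w l]] /=;
    rewrite ?addrK ?subrK.
rewrite innerDl.
have Hg := inner_usum g (xiv q ((r, s), (p, t + 1))).
have Hh := inner_usum h (xiv q ((r, s), (p, t + 1))).
have {}Hg := (usum_bij _ _ tau1).2 Hg.
have {}Hh := (usum_bij _ _ tau2).2 Hh.
apply: usum_unique (usumD Hg Hh) _.
have := usumM (q ^ p)%:C (inner_usum f (xiv q ((r, s), (p, t)))).
congr usum; apply/funext => -[[v k] [w l]] /=.
rewrite gE hE !xivE// !conjc_real /=.
have -> : (v - (w - 1) == t + 1) = (v - w == t) by apply/eqP/eqP; lia.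
have -> : (k + 1 + (w - 1) == r + p) = (k + w == r + p) by apply/eqP/eqP; lia.
have -> : (v + 1 - w == t + 1) = (v - w == t) by apply/eqP/eqP; lia.
have -> : (l + 1 - (v + 1) == s - p) = (l - v == s - p) by apply/eqP/eqP; lia.
case: ifP => [/and3P[/eqP vw _ _]|_]; last by rewrite !rmorph0 !mulr0 addr0.
(* The required identity is [pcoef_rec] multiplied by [q^w], since [v = w + t] on the support. *)
have E := pcoef_rec q01 t (p - w).
have -> : p - (w - 1) = p - w + 1 by ring.
have Ev : q ^ v = q ^ w * q ^ t by rewrite -expfzDr//; congr (_ ^ _); lia.
have Ep : q ^ p = q ^ w * q ^ (p - w) by rewrite -expfzDr//; congr (_ ^ _); lia.
rewrite Ev Ep; move: E.
move: (pcoef q (t + 1) (p - w + 1)) (pcoef q (t + 1) (p - w)) (pcoef q t (p - w)) => A B C E.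
have := congr1 (fun x => (q ^ w * x)%:C) E; rewrite mulrDr !(rmorphD, rmorphM)/= => E'.
set F0 := f _.
transitivity (F0 * ((q ^ w)%:C * ((q ^ t)%:C * A%:C) + (q ^ w)%:C * B%:C)); last by ring.
by rewrite E'; ring.
Qed.

End b0.

(** * The representation pi *)

Lemma conjcM {R : realType} (x y : R[i]) : (x * y)^*%C = x^*%C * y^*%C.
Proof. exact: rmorphM. Qed.

Definition irange (N : nat) : seq int := [seq k%:Z - N%:Z | k <- iota 0 (2 * N).+1].

Lemma mem_irange N (i : int) : (i \in irange N) = (`|i| <= N)%N.
Proof.
apply/mapP/idP => [[k]|iN]; first by rewrite mem_iota => kN ->; lia.
by exists (absz (i + N%:Z)); [rewrite mem_iota; lia|lia].
Qed.

Section representation.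
Context {R : realType}.
Variable q : R.
Hypothesis q01 : 0 < q < 1.
Notation H := (l2 R (int * int)%type).
Notation H4 := (l2 R ((int * int) * (int * int))%type).
Notation M := (@Linfty_E2 R).
Variable D : (H -> H) -> (H4 -> H4).
Hypothesis hD : is_Delta0 q D.
Let hom := Delta0_hom hD.

Fact W0_key : unit. Proof. by []. Qed.
Fact W0V_key : unit. Proof. by []. Qed.
Fact rep_key : unit. Proof. by []. Qed.
Definition W0 : H4 -> H4 := locked_with W0_key (coords (xiv q)).
Definition W0V : H4 -> H4 := locked_with W0V_key (coords (xiw q)).
Lemma W0_def : W0 = coords (xiv q). Proof. rewrite /W0; case: W0_key; reflexivity. Qed.
Lemma W0V_def : W0V = coords (xiw q). Proof. rewrite /W0V; case: W0V_key; reflexivity. Qed.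

Let Fo := xiv_orth q01.
Let Go := xiw_orth q01.
Let FG := fun j i => xiw_xiv q01 i j.
Let GF i j : xiv q i j = (xiw q j i)^*%C. Proof. by rewrite FG conjcK. Qed.

Lemma W0_bounded : bounded_op W0. Proof. rewrite W0_def; exact: coords_bounded. Qed.
Lemma W0V_bounded : bounded_op W0V. Proof. rewrite W0V_def; exact: coords_bounded. Qed.

Lemma W0K : cancel W0 W0V. Proof. rewrite W0_def W0V_def; exact: coordsK Fo Go FG. Qed.
Lemma W0VK : cancel W0V W0. Proof. rewrite W0_def W0V_def; exact: coordsK Go Fo GF. Qed.

Lemma inner_W0 f g : inner (W0 f) g = inner f (W0V g).
Proof. rewrite W0_def W0V_def; exact: inner_coords Fo Go FG f g. Qed.

Lemma inner_W0V f g : inner (W0V f) g = inner f (W0 g).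
Proof. rewrite W0_def W0V_def; exact: inner_coords Go Fo GF f g. Qed.

Lemma W0E f i : W0 f i = inner f (xiv q i).
Proof. rewrite W0_def; exact: coordsE Fo f i. Qed.

Lemma W0V_ket i : W0V (ket i) = xiv q i.
Proof. rewrite W0V_def; exact: coords_ket' Go FG i. Qed.

Lemma W0_xiv i : W0 (xiv q i) = ket i.
Proof. rewrite W0_def; exact: coords_F Fo i. Qed.

Definition rep (x : H -> H) : H4 -> H4 := locked_with rep_key (W0 \o D x \o W0V).
Lemma rep_def x : rep x = W0 \o D x \o W0V. Proof. rewrite /rep; case: rep_key; reflexivity. Qed.
Lemma repE x f : rep x f = W0 (D x (W0V f)). Proof. by rewrite rep_def. Qed.

Lemma D_bounded x : M x -> bounded_op (D x).
Proof. by move=> /(hom_maps hom)[]. Qed.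

Lemma rep_bounded x : M x -> bounded_op (rep x).
Proof.
move=> /D_bounded xb; rewrite rep_def.
exact: bounded_comp (bounded_comp W0_bounded xb) W0V_bounded.
Qed.

Lemma rep_comp x y : M x -> M y -> rep (x \o y) = rep x \o rep y.
Proof.
move=> Mx My; rewrite !rep_def (hom_mul hom Mx My); apply/funext => f /=.
by rewrite (W0K (D y (W0V f))).
Qed.

Lemma rep_id : rep idfun = idfun.
Proof. by rewrite rep_def (hom_unital hom); apply/funext => f /=; rewrite (W0VK f). Qed.

Lemma rep_lin c x y : M x -> M y -> rep (c *: x + y) = c *: rep x + rep y.
Proof.
move=> Mx My; rewrite !rep_def (hom_linear hom _ Mx My); apply/funext => f /=.
have Wl := proj1 W0_bounded.
by rewrite !lin_opE/= (linED Wl) (linEZ Wl).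
Qed.

Lemma M0 : M (fun=> 0).
Proof.
have -> : (fun=> 0) = -1 *: idfun + idfun :> (H -> H).
  by apply/funext => f; rewrite lin_opE scaleN1r addNr.
by apply: M_lin; exact: M_id.
Qed.

Lemma rep0 : rep (fun=> 0) = (fun=> 0).
Proof.
have -> : (fun=> 0) = -1 *: idfun + idfun :> (H -> H).
  by apply/funext => f; rewrite lin_opE scaleN1r addNr.
rewrite rep_lin; [|exact: M_id|exact: M_id].
by apply/funext => f; rewrite lin_opE rep_id scaleN1r addNr.
Qed.

Lemma M_scale c x : M x -> M (c *: x + (fun=> 0)).
Proof. by move=> Mx; apply: M_lin => //; exact: M0. Qed.

Lemma rep_scale c x f : M x -> rep (c *: x + (fun=> 0)) f = c *: rep x f.
Proof. by move=> Mx; rewrite rep_lin//; [rewrite lin_opE rep0 addr0|exact: M0]. Qed.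

(** Covers the default value of [adjoint] without constructing adjoints of bounded operators: below,
    a zero default either makes the claim trivial or, for an invertible operator, forces every
    vector to vanish. *)
Lemma adjoint_witness I (x y : l2 R I -> l2 R I) :
  y = adjoint x -> y = (fun=> 0) \/ forall f g, inner (x f) g = inner f (y g).
Proof.
by move->; rewrite /adjoint; case: xgetP => [w _ wP|_]; [right|left].
Qed.

Lemma inner_rep_proj p f g :
  inner (rep (proj1op p) f) g = inner f (rep (proj1op p) g).
Proof.
rewrite !repE inner_W0 -[in RHS]inner_W0V.
have /adjoint_witness[->|E] : D (proj1op p) = adjoint (D (proj1op p)).
- by rewrite -(hom_star hom (M_proj1op p)) {2}proj1op_def adjoint_restrict -proj1op_def.
- by rewrite /= inner0l inner0r.
- exact: E.
Qed.

Lemma rep_trans2K a b : rep (trans2 a b) \o rep (trans2 (- a) (- b)) = idfun.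
Proof.
by rewrite -rep_comp; [rewrite trans2D !subrr trans2_0 rep_id|exact: M_trans2|exact: M_trans2].
Qed.

Lemma inner_rep_trans2 a b f g :
  inner (rep (trans2 a b) f) g = inner f (rep (trans2 (- a) (- b)) g).
Proof.
have := hom_star hom (M_trans2 a b); rewrite adjoint_trans2 => /adjoint_witness[E|E].
  have : rep (trans2 a b) \o rep (trans2 (- a) (- b)) = (fun=> 0).
    have Wl := proj1 W0_bounded; have bl := proj1 (rep_bounded (M_trans2 a b)).
    by apply/funext => h /=; rewrite [rep (trans2 (- a) _) h]repE E (linE0 Wl) (linE0 bl).
  rewrite rep_trans2K => /(congr1 (fun z : H4 -> H4 => z f))/= f0.
  by rewrite f0 inner0l (linE0 (proj1 (rep_bounded (M_trans2 a b)))) inner0l.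
by rewrite !repE inner_W0 E inner_W0V.
Qed.

Lemma l2norm_rep_trans2 a b f : l2norm (rep (trans2 a b) f) = l2norm f.
Proof.
apply/eqP; rewrite -(@eqrXn2 _ 2) ?l2norm_ge0//; apply/eqP/(@complexI R).
rewrite -!inner_norm inner_rep_trans2.
have /(congr1 (fun z : H4 -> H4 => z f))/= := rep_trans2K (- a) (- b).
by rewrite !opprK => ->.
Qed.

(** Normality is tested on the vector functional of [W0V f] and [W0V g], and [ultraweak_bounded_seq]
    supplies its hypothesis. *)
Lemma normal_seq (x_ : nat -> H -> H) x c : 0 <= c ->
  (forall n, M (x_ n)) -> M x ->
  (forall n f, l2norm (x_ n f) <= c * l2norm f) ->
  (forall f, l2norm (x f) <= c * l2norm f) ->
  (forall i j, inner (x_ n (ket i)) (ket j) @[n --> \oo] --> inner (x (ket i)) (ket j)) ->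
  forall f g, inner (rep (x_ n) f) g @[n --> \oo] --> inner (rep x f) g.
Proof.
move=> c0 Mx_ Mx xc_ xc xk f g.
have uw : ultraweak_cvg (x_ @ \oo) x.
  apply: (ultraweak_bounded_seq c0) => // [n|]; first by have [] := M_bounded (Mx_ n).
  by have [] := M_bounded Mx.
have FM : (x_ @ \oo) M by exists 0%N => // n _; exact: Mx_.
have Hn := hom_normal hom (fmap_proper_filter x_ _) FM Mx uw (vector_functional (W0V f) (W0V g)).
have E y : inner (rep y f) g = inner (D y (W0V f)) (W0V g) by rewrite repE inner_W0.
by rewrite E; under eq_cvg do rewrite E; exact: Hn.
Qed.

Local Notation U := (rep (trans2 0 1)).
Local Notation e n := (rep (proj1op (pred1 n))).

(** With [x = E_n] and [y = q^n u E_n] the graph of [b0] contains every [(x g, y g)], so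
    [(D x (W0V f), D y (W0V f))] lies in the extension, where [closed_sum_xiv] reads it in
    coordinates. *)
Lemma rep_b0 (n r s p t : int) f :
  (q ^ n)%:C * U (e n f) ((r, s), (p, t + 1)) = (q ^ p)%:C * e n f ((r, s), (p, t)).
Proof.
pose x := @proj1op R (pred1 n).
pose y := (q ^ n)%:C *: (@trans2 R 0 1 \o x) + (fun=> 0) : H -> H.
have Mx : M x by exact: M_proj1op.
have Mux : M (trans2 0 1 \o x) by apply: M_comp => //; exact: M_trans2.
have My : M y by exact: M_scale.
have : affiliated_ext M D (b0 q) (D x (W0V f), D y (W0V f)).
  apply: subset_closure; apply: span_sub; exists x, y, (W0V f); split=> // g.
  have -> : y g = (q ^ n)%:C *: trans2 0 1 (x g) by rewrite /y lin_opE addr0.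
  exact: b0_proj1op.
rewrite (Delta0_b0 hD) => /(closed_sum_xiv q01 r s p t).
rewrite -!W0E -!repE => <-.
have -> : rep y f = (q ^ n)%:C *: rep (trans2 0 1 \o x) f.
  exact: (rep_scale _ f Mux).
by rewrite (rep_comp (M_trans2 0 1) Mx) l2EZ.
Qed.

Lemma rep_proj_commute n : e n \o U = U \o e n.
Proof.
have E1 := rep_comp (M_proj1op (pred1 n)) (M_trans2 0 1).
have E2 := rep_comp (M_trans2 0 1) (M_proj1op (pred1 n)).
have E3 := congr1 rep (@proj1op_trans2 R (pred1 n) 1).
have E := etrans (esym E1) (etrans E3 E2); exact E.
Qed.

Local Notation h r s p t := (ket ((r, s), (p, t)) : H4).

(** The transpose of [rep_b0], which concerns coordinates of images rather than images of basis
    vectors. It is obtained at [V g], since [e n] is symmetric and commutes with the unitary [U],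
    whose inverse is [V]. *)
Lemma rep_proj_step n r s p t :
  (q ^ n)%:C *: e n (h r s p (t + 1)) = (q ^ p)%:C *: U (e n (h r s p t)).
Proof.
apply: inner_eq => g; rewrite !innerZl.
rewrite (inner_conj g (e n (h r s p (t + 1)))) (inner_conj g (U (e n (h r s p t)))).
set V := rep (trans2 (- 0) (- 1)).
have UV : U \o V = idfun by exact: rep_trans2K.
have VU : V \o U = idfun by rewrite /V -{1}[0]opprK -{1}[1]opprK; exact: rep_trans2K.
have ge : inner g (U (e n (h r s p t))) = inner (e n (V g)) (h r s p t).
  have gE : g = U (V g) by rewrite -[RHS]/((U \o V) g) UV.
  have kE : V (U (e n (h r s p t))) = e n (h r s p t).
    by rewrite -[LHS]/((V \o U) _) VU.
  by rewrite {1}gE (inner_rep_trans2 0 1) -/V kE inner_rep_proj.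
have ge' : inner g (e n (h r s p (t + 1))) = inner (U (e n (V g))) (h r s p (t + 1)).
  have -> : U (e n (V g)) = e n (U (V g)).
    by rewrite -[LHS]/((U \o e n) (V g)) -rep_proj_commute.
  have -> : U (V g) = g by rewrite -[LHS]/((U \o V) g) UV.
  by rewrite inner_rep_proj.
rewrite ge ge' !inner_ketr; have := rep_b0 n r s p t (V g).
move: (U _ _) (e n _ _) => x y xy.
by rewrite -[(q ^ n)%:C]conjc_real -[(q ^ p)%:C]conjc_real -!conjcM xy.
Qed.

Lemma rep_proj_norm n r s p t :
  q ^ n * l2norm (e n (h r s p (t + 1))) = q ^ p * l2norm (e n (h r s p t)).
Proof.
have := congr1 (@l2norm _ _) (rep_proj_step n r s p t).
case/andP: q01 => q0 _; have qz k : 0 <= q ^ k by rewrite ltW// exprz_gt0.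
by rewrite !l2normZ !normcR !ger0_norm// l2norm_rep_trans2.
Qed.

(** Going back [k] steps gives [N t <= q^k * c] for every [k]; it matters that [N] is bounded
    towards minus infinity. *)
Lemma geometric_decay (N : int -> R) c : (forall t, 0 <= N t <= c) ->
  (forall t, N (t + 1) <= q * N t) -> forall t, N t = 0.
Proof.
move=> Nc Nq t; case/andP: q01 => q0 q1.
have c0 : 0 <= c by case/andP: (Nc 0) => /le_trans; apply.
have Nk (k : nat) : N t <= q ^+ k * c.
  suff H u : N (u + k%:Z) <= q ^+ k * c by rewrite -(subrK k%:Z t).
  elim: k u => [|k IHk] u; first by rewrite addr0 expr0 mul1r; case/andP: (Nc u).
  have -> : u + k.+1%:Z = u + k%:Z + 1 by lia.
  by rewrite (le_trans (Nq _))// exprS -mulrA ler_wpM2l// ltW.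
apply/eqP; rewrite eq_le; case/andP: (Nc t) => -> _; rewrite andbT.
apply/ler_addgt0Pr => e e0; rewrite add0r.
have := cvg_expr (_ : `|q| < 1); rewrite ger0_norm ?(ltW q0)// => /(_ q1)/cvgrPdist_lt.
have c1 : 0 < c + 1 by rewrite ltr_wpDl.
move=> /(_ (e / (c + 1)) (divr_gt0 e0 c1))[k _ /(_ k (leqnn _))]/=.
rewrite sub0r normrN ger0_norm ?exprn_ge0 ?(ltW q0)// => qk.
apply: le_trans (Nk k) _; apply: le_trans (ler_wpM2r c0 (ltW qk)) _.
by rewrite -mulrA ler_piMr ?(ltW e0)// mulrC ler_pdivrMr// mul1r lerDl.
Qed.

Lemma rep_proj_off n r s p t : n != p -> e n (h r s p t) = 0.
Proof.
move=> np; apply: l2norm0_eq0; case/andP: q01 => q0 q1.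
have [c c0 ec] := bounded_opE (rep_bounded (M_proj1op (pred1 n))).
pose N t := l2norm (e n (h r s p t)).
have Nc u : 0 <= N u <= c.
  rewrite /N l2norm_ge0/=; have := ec (h r s p u).
  by rewrite (l2norm_ket _ : l2norm (h r s p u) = 1) mulr1.
have Nrec u : q ^ n * N (u + 1) = q ^ p * N u by exact: rep_proj_norm.
have qn k : 0 < q ^ k by exact: exprz_gt0.
have step (a b : int) x y : a < b -> 0 <= y -> q ^ a * x = q ^ b * y -> x <= q * y.
  move=> ab y0 xy; rewrite -(ler_pM2l (qn a)) xy mulrA ler_wpM2r//.
  rewrite -{3}[q]expr1z -expfzDr ?gt_eqF//.
  have -> : q ^ b = q ^ (b - (a + 1)) * q ^ (a + 1) by rewrite -expfzDr ?subrK ?gt_eqF.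
  rewrite ler_piMl ?(ltW (qn _))//.
  have : 0 <= b - (a + 1) by lia.
  by case: (b - (a + 1)) => // k _; rewrite -exprnP exprn_ile1 ?ltW.
rewrite -[LHS]/(N t); case: (ltgtP n p) np => // np _.
  apply: (geometric_decay Nc) => u; apply: step np _ (Nrec u).
  by case/andP: (Nc u).
(* For [n > p] the ratio [q^(p - n)] exceeds 1: the norms decrease as [t] decreases, so [t] is
   reversed. *)
rewrite -[t]opprK; apply: (@geometric_decay (fun u => N (- u)) c) => [u|u]; first exact: Nc.
apply: step np _ _; first by case/andP: (Nc (- u)).
rewrite -(Nrec (- (u + 1))); congr (_ * N _); ring.
Qed.

Lemma proj1op_eq (P P' : pred int) : P =1 P' -> @proj1op R P = proj1op P'.
Proof. by move=> /funext->. Qed.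

Lemma proj1op_cons n s : n \notin s ->
  @proj1op R (mem (n :: s)) = 1 *: proj1op (pred1 n) + proj1op (mem s).
Proof.
move=> ns; apply/funext => f; rewrite lin_opE scale1r; apply: l2_ext => j.
rewrite l2ED !proj1opE -mulrDl /= inE; congr (_ * _).
by case: eqP => [->|_]; rewrite ?(negPf ns) ?addr0 ?add0r.
Qed.

Lemma rep_proj_mem0 (l : seq int) r s p t : p \notin l -> rep (proj1op (mem l)) (h r s p t) = 0.
Proof.
elim: l => [|n l IHl].
  have -> : @proj1op R (mem [::]) = fun=> 0.
    by apply/funext => f; apply: l2_ext => j; rewrite proj1opE mul0r.
  by rewrite rep0.
rewrite inE negb_or => /andP[pn pl].
have [nl|nl] := boolP (n \in l).
  rewrite (proj1op_eq (P' := mem l)) ?IHl// => k.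
  by rewrite /= inE; case: eqP => // ->.
rewrite proj1op_cons// (rep_lin _ (M_proj1op _) (M_proj1op _)) lin_opE IHl// addr0.
by rewrite rep_proj_off ?scaler0// eq_sym.
Qed.

Lemma rep_proj_on r s p t : e p (h r s p t) = h r s p t.
Proof.
apply: inner_eq => g.
(* Keeping [p] apart from the range lets [proj1op_cons] split it off. By [rep_proj_mem0] the
   remaining indices contribute nothing, so the sequence whose limit is taken is constant. *)
pose l N := [seq k <- irange N | k != p].
pose x_ N := @proj1op R (mem (p :: l N)).
have pl N : p \notin l N by rewrite mem_filter /= eqxx.
have xE N : rep (x_ N) (h r s p t) = e p (h r s p t).
  rewrite /x_ proj1op_cons// (rep_lin _ (M_proj1op _) (M_proj1op _)) lin_opE scale1r.
  by rewrite rep_proj_mem0// addr0.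
have x1 N f : l2norm (x_ N f) <= 1 * l2norm f.
  rewrite mul1r; apply: l2norm_bound (l2norm_ge0 _) _ => A.
  apply: le_trans (l2norm_sum_le f A); apply: ler_sum => k _.
  by rewrite proj1opE; case: (_ k.1); rewrite ?mul1r// mul0r Normc.normc0 expr0n sqr_ge0.
have i1 (f : H) : l2norm (idfun f) <= 1 * l2norm f by rewrite mul1r.
have xk i j : inner (x_ N (ket i)) (ket j) @[N --> \oo] --> inner (idfun (ket i) : H) (ket j).
  case: i => m n; apply: cvg_near_cst; near=> N.
  have -> : x_ N (ket (m, n)) = ket (m, n); last by [].
  rewrite /x_ proj1op_ket /= inE mem_filter/= mem_irange.
  suff -> : (`|m| <= N)%N by rewrite andbT orbN scale1r.
  by near: N; exists `|m|%N.
have lim : inner (rep (x_ N) (h r s p t)) g @[N --> \oo] --> inner (rep idfun (h r s p t)) g.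
  exact: (normal_seq ler01 (fun N => M_proj1op _) M_id x1 i1 xk).
move: lim; under eq_cvg do rewrite xE.
rewrite rep_id => lim; exact: (cvg_unique (@norm_hausdorff R[i] R[i]) (cvg_cst _) lim).
Unshelve. all: by end_near. Qed.

Lemma rep_shift_ket r s p t : U (h r s p t) = h r s p (t + 1).
Proof.
have := rep_proj_step p r s p t; rewrite !rep_proj_on.
case/andP: q01 => q0 _ /(scalerI _)->//.
by rewrite (inj_eq (@complexI R)) gt_eqF// exprz_gt0.
Qed.

Lemma rep_a0_ket r s p t : rep (trans2 (-1) 0) (h r s p t) = h r s (p - 1) t.
Proof.
rewrite repE -a0E (Delta0_a0 hD) W0V_ket -W0_xiv; congr (W0 _).
pose k (j : (int * int) * (int * int)) := ((j.1.1 + 1, j.1.2), (j.2.1 + 1, j.2.2)).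
have kI : injective k.
  by apply: (can_inj (g := fun j => ((j.1.1 - 1, j.1.2), (j.2.1 - 1, j.2.2)))) => -[[v a] [w b]] /=; rewrite !addrK.
have -> : optensor (@a0 R) (@a0 R) = pullback k.
  apply: optensorE; first exact: pullback_bounded.
  by move=> f g; apply: l2_ext => -[[v a] [w b]]; rewrite (pullbackE _ _ kI) /k !tensorE a0E !trans2E/= opprK !subr0.
apply: l2_ext => -[[v a] [w b]]; rewrite (pullbackE _ _ kI) /k !xivE//=.
have -> : (v + 1 - (w + 1) == t) = (v - w == t) by apply/eqP/eqP; lia.
have -> : (a + (w + 1) == r + p) = (a + w == r + (p - 1)) by apply/eqP/eqP; lia.
have -> : (b - (v + 1) == s - p) = (b - v == s - (p - 1)) by apply/eqP/eqP; lia.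
by have -> : p - (w + 1) = p - 1 - w by ring.
Qed.

(** States [rep x = 1 (x) x] without [optensor], whose value is known only once a bounded candidate
    is given; [optensor_rep] makes the passage. *)
Definition good (x : H -> H) : Prop :=
  M x /\ forall i g, rep x (ket i \ox g) = ket i \ox x g.

Lemma good_ket x : M x -> (forall i j, rep x (ket (i, j)) = ket i \ox x (ket j)) -> good x.
Proof.
move=> Mx xk; split=> // i g.
have E : rep x \o (fun g : H => ket i \ox g) = (fun g : H => ket i \ox g) \o x.
  apply: bounded_ext => [||j].
  - by apply: bounded_comp; [exact: rep_bounded|exact: tensor_boundedr].
  - by apply: bounded_comp; [exact: tensor_boundedr|exact: M_bounded].
  - by rewrite /= ket_tensor xk.
exact: (congr1 (fun z : H -> H4 => z g) E).
Qed.

Lemma good_comp x y : good x -> good y -> good (x \o y).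
Proof.
move=> [Mx xg] [My yg]; split=> [|i g]; first exact: M_comp.
by rewrite (rep_comp Mx My) /= yg xg.
Qed.

Lemma good_lin c x y : good x -> good y -> good (c *: x + y).
Proof.
move=> [Mx xg] [My yg]; split=> [|i g]; first exact: M_lin.
rewrite (rep_lin c Mx My) !lin_opE yg xg.
have [tl _] : bounded_op (fun f : H => ket i \ox f : H4) := tensor_boundedr _ (ket i).
by rewrite (linED tl) (linEZ tl).
Qed.

Lemma good_zero : good (fun=> 0).
Proof.
split=> [|i g]; first exact: M0.
by rewrite rep0 (linE0 (proj1 (tensor_boundedr _ _))).
Qed.

Lemma good_id : good idfun.
Proof. by split=> [|i g]; [exact: M_id|rewrite rep_id]. Qed.

Lemma good_inv a b : good (trans2 a b) -> good (trans2 (- a) (- b)).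
Proof.
move=> [_ Tg]; apply: good_ket => [|i [m n]]; first exact: M_trans2.
have -> : ket (i, (m, n)) = rep (trans2 a b) (ket i \ox trans2 (- a) (- b) (ket (m, n))).
  by rewrite Tg !trans2_ket !subrK ket_tensor.
have := rep_trans2K (- a) (- b); rewrite !opprK => K.
exact: (congr1 (fun z : H4 -> H4 => z (ket i \ox _)) K).
Qed.

Lemma good_trans2 a b : good (trans2 a b).
Proof.
have gU : good (trans2 0 1).
  apply: good_ket => [|[r s] [p t]]; first exact: M_trans2.
  by rewrite rep_shift_ket trans2_ket addr0 ket_tensor.
have gA : good (trans2 (-1) 0).
  apply: good_ket => [|[r s] [p t]]; first exact: M_trans2.
  by rewrite rep_a0_ket trans2_ket addr0 ket_tensor.
have gV : good (trans2 0 (-1)) by have := good_inv gU; rewrite oppr0.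
have gB : good (trans2 1 0) by have := good_inv gA; rewrite oppr0 opprK.
have step c d x y : good (trans2 c d) -> good (trans2 x y) -> good (trans2 (x + c) (y + d)).
  by move=> gc gx; have := good_comp gx gc; rewrite trans2D.
have ga : good (trans2 a 0).
  elim/int_step_ind: a => [|n IHn|n IHn]; first by rewrite trans2_0; exact: good_id.
  - by have := step 1 0 n 0 gB IHn; rewrite addr0.
  - by have := step (-1) 0 n 0 gA IHn; rewrite addr0.
elim/int_step_ind: b => [//|n IHn|n IHn].
- by have := step 0 1 a n gU IHn; rewrite addr0.
- by have := step 0 (-1) a n gV IHn; rewrite addr0.
Qed.

Lemma good_proj1 n : good (proj1op (pred1 n)).
Proof.
apply: good_ket => [|[r s] [p t]]; first exact: M_proj1op.
rewrite proj1op_ket /=; have [->|pn] := eqVneq p n.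
  by rewrite rep_proj_on scale1r ket_tensor.
rewrite rep_proj_off 1?eq_sym// scale0r.
by rewrite (linE0 (proj1 (tensor_boundedr _ _))).
Qed.

End representation.

(** * Fejer means *)

Section fejer.
Context {R : realType}.

(** Windows of length [N] in the second index. Two points at distance [d] share [N - |d|] of them
    (none if [|d| >= N]), so averaging over windows yields the Fejer weights as the multiplier of
    [schur_bound]. *)
Definition win (N : nat) (j : int) (x : int * int) : bool :=
  (0 <= x.2 - j) && (x.2 - j < N%:Z).

Lemma win_shift (a b : int) (k N : nat) : (k < N)%N ->
  [&& 0 <= a - (a - k%:Z), a - (a - k%:Z) < N%:Z &
      (0 <= b - (a - k%:Z)) && (b - (a - k%:Z) < N%:Z)] =
  (0 <= k%:Z + (b - a)) && (k%:Z + (b - a) < N%:Z).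
Proof.
move=> kN; have -> : a - (a - k%:Z) = k%:Z by ring.
have -> : b - (a - k%:Z) = k%:Z + (b - a) by ring.
by have -> : k%:Z < N%:Z by lia.
Qed.

Definition win_fset (N : nat) (x : int * int) : {fset int} :=
  [fset x.2 - k%:Z | k in iota 0 N]%fset.

Lemma sum_win (V : nmodType) N x (S : {fset int}) (F : int -> V) :
  (win_fset N x `<=` S)%fset -> (forall j, ~~ win N j x -> F j = 0) ->
  \sum_(j <- enum_fset S) F j = \sum_(0 <= k < N) F (x.2 - k%:Z).
Proof.
move=> xS F0; rewrite -(big_fset_incl _ xS) => [|j _ jx]; last first.
  apply: F0; apply: contra jx => /andP[j0 jN]; apply/imfsetP.
  by exists (absz (x.2 - j)); [rewrite /= mem_iota; lia|lia].
rewrite big_imfset/=; last by move=> k l _ _ /addrI/oppr_inj[].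
by rewrite /index_iota subn0 undup_id ?iota_uniq.
Qed.

Definition fejer_count (N : nat) (d : int) : nat :=
  (\sum_(0 <= k < N) ((0 <= k%:Z + d)%R && (k%:Z + d < N%:Z)%R))%N.

Lemma sum_ltn N K : (\sum_(0 <= k < N) (k < K) = minn N K)%N.
Proof.
elim: N => [|N IHN]; first by rewrite big_geq// min0n.
by rewrite big_nat_recr//= IHN; case: ltnP; lia.
Qed.

Lemma fejer_countE N d : fejer_count N d = (N - absz d)%N.
Proof.
rewrite /fejer_count; case: d => d /=.
  rewrite (eq_big_nat _ _ (F2 := fun k => (k < N - d)%N : nat)) => [|k kN]; first by rewrite sum_ltn; lia.
  by congr nat_of_bool; apply/idP/idP; lia.
have E : (\sum_(0 <= k < N) ((0 <= k%:Z + Negz d)%R && (k%:Z + Negz d < N%:Z)%R) +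
    \sum_(0 <= k < N) (k < d.+1) = N)%N.
  rewrite -big_split/= (eq_big_nat _ _ (F2 := fun=> 1%N)) => [|k kN].
    by rewrite big_const_nat iter_addn; lia.
  by case: (ltnP k d.+1) => kd; [rewrite (_ : _ && _ = false)|rewrite (_ : _ && _ = true)]; lia.
by move: E; rewrite sum_ltn; lia.
Qed.

(** The triangular weight [1 - |d|/(n+1)], cut off at zero. The length [n + 1] is nonzero and puts
    the support inside [irange n]. *)
Definition fejer (n : nat) (d : int) : R := (fejer_count n.+1 d)%:R / n.+1%:R.

Lemma fejer_out n d : (n < absz d)%N -> fejer n d = 0.
Proof. by move=> nd; rewrite /fejer fejer_countE (_ : (_ - _)%N = 0%N) ?mul0r//; lia. Qed.

Lemma fejer_cvg d : fejer n d @[n --> \oo] --> (1 : R).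
Proof.
have h : (1 - (absz d)%:R * harmonic n : R) @[n --> \oo] --> (1 - (absz d)%:R * 0 : R).
  by apply: cvgB; [exact: cvg_cst|apply: cvgM; [exact: cvg_cst|exact: cvg_harmonic]].
rewrite mulr0 subr0 in h; apply: cvg_trans h; apply: near_eq_cvg.
near=> n; rewrite /fejer fejer_countE /harmonic/= natrB; last first.
  by near: n; exists (absz d) => // n /=; lia.
by rewrite mulrBl mulfV ?pnatr_eq0.
Unshelve. all: by end_near. Qed.

End fejer.

(** * From the generators to the whole algebra *)

Section conclusion.
Context {R : realType}.
Variable q : R.
Hypothesis q01 : 0 < q < 1.
Notation H := (l2 R (int * int)%type).
Notation H4 := (l2 R ((int * int) * (int * int))%type).
Notation M := (@Linfty_E2 R).
Variable D : (H -> H) -> (H4 -> H4).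
Hypothesis hD : is_Delta0 q D.
Local Notation rep := (rep q D).
Local Notation good := (good q D).

Lemma good_entry x i j i' j' : good x ->
  inner (rep x (ket (i, j))) (ket (i', j')) = (i' == i)%:R * inner (x (ket j)) (ket j').
Proof. by move=> [_ xg]; rewrite -ket_tensor xg !inner_ketr tensorE ketE. Qed.

Section corner.
Variables (x : H -> H) (m n : int).
Hypothesis Mx : M x.

Let z : H -> H := proj1op (pred1 n) \o (x \o proj1op (pred1 m)).
Let coef (d : int) : R[i] := inner (x (ket (m, 0))) (ket (n, d)).
Let z_ (N : nat) : H -> H :=
  \sum_(d <- irange N) ((fejer N d)%:C * coef d) *: (trans2 (n - m) d \o proj1op (pred1 m)).

Let Mz : M z.
Proof. by apply: M_comp; [exact: M_proj1op|apply: M_comp => //; exact: M_proj1op]. Qed.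

Let z_good N : good (z_ N).
Proof.
rewrite /z_; elim: (irange N) => [|d s IHs]; first by rewrite big_nil; exact: (good_zero q01 hD).
rewrite big_cons; apply: (good_lin q01 hD _ _ IHs).
by apply: (good_comp q01 hD); [exact: (good_trans2 q01 hD)|exact: (good_proj1 q01 hD)].
Qed.

Let z_entry0 i j : inner (z (ket i)) (ket j) =
  ((i.1 == m) && (j.1 == n))%:R * coef (j.2 - i.2).
Proof.
case: i j => m' k [n' l]; rewrite /z /= proj1op_ket inner_ketr proj1opE /=.
rewrite linEZ; last by have [] := M_bounded Mx.
rewrite l2EZ -inner_ketr; have [->|_] := eqVneq m' m; last by rewrite mul0r mulr0 mul0r.
have [->|_] := eqVneq n' n; last by rewrite !mul0r.
by rewrite !mul1r M_laurent.
Qed.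

Lemma irange_uniq N : uniq (irange N).
Proof. by rewrite map_inj_uniq ?iota_uniq// => k l /addIr[]. Qed.

Let z_entry N i j : inner (z_ N (ket i)) (ket j) =
  (fejer N (j.2 - i.2))%:C * inner (z (ket i)) (ket j).
Proof.
rewrite z_entry0; case: i j => m' k [n' l] /=.
have -> : z_ N (ket (m', k)) = \sum_(d <- irange N)
    ((fejer N d)%:C * coef d) *: ((m' == m)%:R *: ket (m' + (n - m), k + d)).
  rewrite /z_; elim: (irange N) => [|d s IHs]; first by rewrite !big_nil.
  rewrite !big_cons lin_opE IHs /= proj1op_ket linEZ ?trans2_ket//.
  by have [] := trans2_bounded (R := R) (n - m) d.
rewrite inner_suml.
under eq_bigr do rewrite !innerZl inner_ket xpair_eqE.
have [->|_] := eqVneq m' m; last first.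
  by rewrite /= mul0r mulr0 big1// => d _; rewrite mul0r mulr0.
rewrite (_ : m + (n - m) = n); last by ring.
rewrite [n == n']eq_sym; have [_|_] := eqVneq n' n; last first.
  by rewrite /= mul0r mulr0 big1// => d _; rewrite mulr0 mulr0.
rewrite /=; have [lk|lk] := boolP (l - k \in irange N).
  rewrite (bigD1_seq (l - k)) ?irange_uniq//= big1 => [|d dlk].
    by rewrite addr0 (_ : k + (l - k) = l) ?eqxx ?mulr1 ?mul1r//; ring.
  rewrite (_ : (k + d == l) = false) ?mulr0//.
  by apply: contraNF dlk => /eqP <-; apply/eqP; ring.
(* Outside [irange N] the weight is zero, so the finite sum [z_ N] misses no entry. *)
rewrite fejer_out; last by move: lk; rewrite mem_irange ltnNge.
rewrite rmorph0 mul0r big_seq big1// => d dN.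
rewrite (_ : (k + d == l) = false) ?mulr0//.
by apply: contraNF lk => /eqP <-; rewrite (_ : k + d - k = d)//; ring.
Qed.

(** The point is uniformity in [N]: the bound [c'] that [z_ N] has as a finite sum depends on [N],
    and [schur_bound] replaces it by the constant of [z]. *)
Let z_bound N c : 0 <= c -> (forall f, l2norm (z f) <= c * l2norm f) ->
  forall f, l2norm (z_ N f) <= c * l2norm f.
Proof.
move=> c0 zc; have [zl _] := M_bounded Mz.
have zNb : bounded_op (z_ N) by have [/M_bounded] := z_good N.
have [c' c'0 zc'] := bounded_opE zNb; have [zNl _] := zNb.
have N0 : 0 < N.+1%:R :> R by rewrite ltr0n.
apply: (schur_bound (P := win N.+1) N0 c0 c'0 zl zNl zc zc') => [A|S i].
  (* These are all the windows that meet [A]; only the [N + 1] windows through [i] contribute to the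
     entry at [i], [j]. *)
  exists (\bigcup_(i <- A) win_fset N.+1 i)%fset => i j iA jA.
  rewrite -mulr_suml (sum_win (N := N.+1) (x := i)); first last.
  - by move=> k /negPf->.
  - exact: bigfcup_sup.
  rewrite z_entry mulrA; congr (_ * _).
  rewrite /fejer -[RHS]rmorphM mulrCA mulfV ?gt_eqF// mulr1 rmorph_nat -natr_sum.
  rewrite /fejer_count; congr (_%:R); apply: eq_big_nat => k /andP[_ kN].
  by congr nat_of_bool; rewrite /win -andbA win_shift.
apply: (@le_trans _ _ (\sum_(j <- enum_fset (win_fset N.+1 i `|` S)%fset) (win N.+1 j i)%:R)).
  by apply: ler_sum_fset (fsubsetUr _ _) => j; rewrite ler0n.
rewrite (sum_win (N := N.+1) (x := i)) ?fsubsetUl//; last by move=> j /negPf->.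
rewrite -natr_sum ler_nat; apply: (@leq_trans (\sum_(0 <= k < N.+1) 1)%N).
  by apply: leq_sum => k _; exact: leq_b1.
by rewrite big_const_nat iter_addn; lia.
Qed.

Lemma corner_entry i j i' j' :
  inner (rep z (ket (i, j))) (ket (i', j')) = (i' == i)%:R * inner (z (ket j)) (ket j').
Proof.
have [c c0 zc] := bounded_opE (M_bounded Mz).
have zk k l : inner (z_ N (ket k)) (ket l) @[N --> \oo] --> inner (z (ket k)) (ket l).
  have : (fejer N (l.2 - k.2))%:C * inner (z (ket k)) (ket l) @[N --> \oo] -->
      (1 : R)%:C * inner (z (ket k)) (ket l).
    by apply: cvgM; [apply: cvg_real; exact: fejer_cvg|exact: cvg_cst].
  rewrite rmorph1 mul1r => lim; under eq_cvg do rewrite z_entry.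
  exact: lim.
have lim : inner (rep (z_ N) (ket (i, j))) (ket (i', j')) @[N --> \oo] -->
    inner (rep z (ket (i, j))) (ket (i', j')).
  exact: (normal_seq q01 hD c0 (fun N => proj1 (z_good N)) Mz (fun N => z_bound N c0 zc) zc zk).
have lim2 : inner (rep (z_ N) (ket (i, j))) (ket (i', j')) @[N --> \oo] -->
    (i' == i)%:R * inner (z (ket j)) (ket j').
  under eq_cvg do rewrite (good_entry _ _ _ _ (z_good _)).
  by apply: cvgM; [exact: cvg_cst|exact: zk].
exact: (cvg_unique (@norm_hausdorff R[i] R[i]) lim lim2).
Qed.

End corner.

Lemma good_M x : M x -> good x.
Proof.
move=> Mx; apply: (good_ket q01 hD Mx) => i [m k]; apply: l2_ext => -[i' [n l]].
rewrite tensorE -!inner_ketr inner_ket.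
have onk (r : int * int) (p : int) (t : int) :
    rep (proj1op (pred1 p)) (ket (r, (p, t))) = ket (r, (p, t)).
  by case: r => r s; exact: (rep_proj_on q01 hD).
(* Inserting the projections that fix the two kets reduces an arbitrary entry of [rep x] to one of
   the corner of [x]. *)
rewrite -[in LHS](onk i m k) -[in LHS](onk i' n l) -(inner_rep_proj q01 hD).
have Mxm : M (x \o proj1op (pred1 m)) by apply: M_comp => //; exact: M_proj1op.
have E := rep_comp q01 hD (M_proj1op (pred1 n)) Mxm.
rewrite (rep_comp q01 hD Mx (M_proj1op (pred1 m))) in E.
have -> : rep (proj1op (pred1 n)) (rep x (rep (proj1op (pred1 m)) (ket (i, (m, k))))) =
    rep (proj1op (pred1 n) \o (x \o proj1op (pred1 m))) (ket (i, (m, k))) by rewrite E.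
rewrite corner_entry// eq_sym; congr (_ * _).
by rewrite /= proj1op_ket /= eqxx scale1r !inner_ketr proj1opE /= eqxx mul1r.
Qed.

Lemma optensor_rep x : M x -> optensor idfun x = rep x.
Proof.
move=> Mx; have [_ xg] := good_M Mx; have rb := rep_bounded q01 hD Mx.
apply: optensorE => // f g.
(* [good] treats basis vectors in the first factor; boundedness extends the identity to all [f]. *)
have E : (fun f : l2 R (int * int)%type => rep x (f \ox g)) = (fun f => f \ox x g).
  apply: bounded_ext => [||i]; last exact: xg.
  - exact: bounded_comp rb (tensor_boundedl _ g).
  - exact: tensor_boundedl.
exact: (congr1 (fun w : l2 R (int * int)%type -> H4 => w f) E).
Qed.

End conclusion.

Theorem proposition0p6 (R : realType) (q : R) (hq : 0 < q < 1) :
  orthonormal_basis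
    (fun i : int * int * int * int => let: (r, s, p, t) := i in xi0 q r s p t)
  /\
  exists W0 : l2 R ((int * int) * (int * int))%type ->
              l2 R ((int * int) * (int * int))%type,
    [/\ unitary W0,
        forall r s p t : int,
          W0 (xi0 q r s p t) = (ket r \ox ket s) \ox (ket p \ox ket t)
      & forall Delta0 : (l2 R (int * int)%type -> l2 R (int * int)%type) ->
          (l2 R ((int * int) * (int * int))%type ->
           l2 R ((int * int) * (int * int))%type),
        is_Delta0 q Delta0 ->
        forall x, Linfty_E2 x ->
          adjoint W0 \o optensor idfun x \o W0 = Delta0 x].
Proof.
have Fo := xiv_orth hq; have Go := xiw_orth hq.
have FG i t : xiw q i t = (xiv q t i)^*%C by exact: xiw_xiv.
split.
  split=> [[[[r s] p] t] [[[r' s'] p'] t']|].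
    (* The family is indexed by left-nested quadruples and [xiv] by pairs of pairs; equality of
       indices is the same. *)
    rewrite !xi0E// Fo; congr (_%:R); congr nat_of_bool.
    by apply/eqP/eqP => [[-> -> -> ->]|[-> -> -> ->]].
  rewrite -(coords_basis Fo Go FG); congr (closure (span _)); apply/seteqP; split=> f.
    by move=> [[[[r s] p] t] _ <-]; exists ((r, s), (p, t)) => //; rewrite xi0E.
  by move=> [[[r s] [p t]] _ <-]; exists (((r, s), p), t) => //; rewrite xi0E.
exists (coords (xiv q)); split.
- exact: coords_unitary Fo Go FG.
- by move=> r s p t; rewrite xi0E// coords_F// !ket_tensor.
move=> D hD x Mx; rewrite (adjoint_coords Fo Go FG) (optensor_rep hq hD Mx).
apply/funext => f /=; rewrite repE W0_def W0V_def.
by rewrite (coordsK Fo Go FG f) (coordsK Fo Go FG).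
Qed.
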